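(* For any real number $\delta > 0$, let $k \geq \frac{25(1+\delta)^2}{\delta^2}$ and $\Delta \geq 2$ be two integers such that $$\Delta \le \frac{1}{100k^3}\, 2^{k/(1+\delta)}.$$ Then there is an FPTAS for the number of independent sets in $k$-uniform linear hypergraphs with maximum degree $\Delta$.
   Context: A hypergraph $H=(V,\mathcal E)$ is $k$-uniform if every hyperedge has exactly $k$ vertices, and linear if any two distinct hyperedges share at most one vertex; the maximum degree is the maximum number of hyperedges containing a single vertex. A set $S\subseteq V$ is a (weak) independent set if no hyperedge is contained in $S$. An FPTAS is a deterministic algorithm which, given an instance of size $n$ and $\varepsilon\in(0,1)$, outputs a number within a factor $1\pm\varepsilon$ of the true count in time polynomial in $n$ and $1/\varepsilon$ ($k,\Delta,\delta$ being constants). *)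

(* Defs.v *)
From HB Require Import structures.
From mathcomp Require Import all_boot all_order all_algebra.
From mathcomp Require Import all_classical all_reals all_analysis.

Set Implicit Arguments.
Unset Strict Implicit.
Unset Printing Implicit Defensive.

Import Order.TTheory GRing.Theory Num.Theory.
Local Open Scope ring_scope.

Section Hypergraph.
Variables (V : finType) (E : {set {set V}}).

Definition uniform_hypergraph (k : nat) : Prop :=
  forall e, e \in E -> #|e| = k.

Definition linear_hypergraph : Prop :=
  forall e f, e \in E -> f \in E -> e != f -> (#|e :&: f| <= 1)%N.

Definition hdegree (v : V) : nat := #|[set e in E | v \in e]|.

Definition max_hdegree : nat := (\max_(v : V) hdegree v)%N.

Definition independent (S : {set V}) : bool :=
  [forall e in E, ~~ (e \subset S)].

Definition num_independent : nat := #|[set S : {set V} | independent S]|.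

End Hypergraph.

(** The model of computation is Jones' first-order functional language F over
    binary trees, with several functions allowed (pure Lisp without mutation),
    evaluated call-by-value. Its only data operations
    are pointer operations (cons, head, tail, test for nil), so charging one
    unit per evaluated expression node is polynomially equivalent to
    Turing-machine time. *)

Inductive tree : Type := Leaf | Node of tree & tree.

Fixpoint tree_size (t : tree) : nat :=
  if t is Node l r then (tree_size l + tree_size r).+1 else 1%N.

Definition hd_tree (t : tree) : tree := if t is Node l _ then l else Leaf.
Definition tl_tree (t : tree) : tree := if t is Node _ r then r else Leaf.

Inductive expr : Type :=
| EArg
| ENil
| ECons of expr & expr
| EHd of expr
| ETl of expr
| EIf of expr & expr & expr
| ECall of nat & expr.

(** The [i]-th entry of a program is the body of the unary function number
    [i], in which [EArg] denotes the argument; functions may be mutually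
    recursive. *)
Definition program : Type := seq expr.

(** [eval P a e v t]: with current argument [a], expression [e] evaluates to
    [v] in exactly [t] time units. There is no derivation for a diverging
    evaluation. *)
Inductive eval (P : program) (a : tree) : expr -> tree -> nat -> Prop :=
| eval_arg : eval P a EArg a 1
| eval_nil : eval P a ENil Leaf 1
| eval_cons e1 e2 v1 v2 t1 t2 :
    eval P a e1 v1 t1 -> eval P a e2 v2 t2 ->
    eval P a (ECons e1 e2) (Node v1 v2) (t1 + t2).+1
| eval_hd e v t : eval P a e v t -> eval P a (EHd e) (hd_tree v) t.+1
| eval_tl e v t : eval P a e v t -> eval P a (ETl e) (tl_tree v) t.+1
| eval_if_node e e1 e2 l r v t t1 :
    eval P a e (Node l r) t -> eval P a e1 v t1 ->
    eval P a (EIf e e1 e2) v (t + t1).+1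
| eval_if_leaf e e1 e2 v t t2 :
    eval P a e Leaf t -> eval P a e2 v t2 ->
    eval P a (EIf e e1 e2) v (t + t2).+1
| eval_call f e b v t t' :
    eval P a e b t -> eval P b (nth ENil P f) v t' ->
    eval P a (ECall f e) v (t + t').+1.

(** A program is run by calling its function number 0. *)
Definition runs (P : program) (input output : tree) (time : nat) : Prop :=
  eval P input (nth ENil P 0) output time.

Lemma eval_deterministic P a e v t :
  eval P a e v t -> forall v' t', eval P a e v' t' -> v' = v /\ t' = t.
Proof.
elim=> {a e v t} => [a|a|a e1 e2 v1 v2 t1 t2 _ IH1 _ IH2|a e v t _ IH
  |a e v t _ IH|a e e1 e2 l r v t t1 _ IH _ IH1|a e e1 e2 v t t2 _ IH _ IH2
  |a f e b v t t1 _ IH _ IH1] v' t' H; inversion H; subst => //;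
  repeat match goal with
  | IH : (forall v t, eval ?P ?a ?e v t -> _), K : eval ?P ?a ?e _ _ |- _ =>
      let E := fresh in have E := IH _ _ K; clear K; case: E => ? ?; subst
  end; by [].
Qed.

Definition tree_of_seq (s : seq tree) : tree := foldr Node Leaf s.

Definition tree_of_nat (n : nat) : tree := tree_of_seq (nseq n Leaf).

(** Outputs are fractions of two binary numerals: a numeral is the list of its
    bits, least significant first, [Leaf] being the bit 0 and every other tree
    the bit 1. A zero denominator gives the value 0. *)
Fixpoint nat_of_tree (t : tree) : nat :=
  if t is Node b t' then ((if b is Leaf then 0 else 1) + 2 * nat_of_tree t')%N
  else 0%N.

Definition value_of_tree (R : realType) (t : tree) : R :=
  (nat_of_tree (hd_tree t))%:R / (nat_of_tree (tl_tree t))%:R.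

(** [enc] encodes the instances, [dom] selects the admissible ones, and
    [count] is the quantity to be approximated. The real accuracy parameter
    [eps] is handed to the program as the unary numeral of the integer
    ceil(1/eps). The time bound is a polynomial in the size of the encoded
    instance and 1/eps. *)
Definition is_FPTAS (R : realType) (I : Type) (enc : I -> tree)
    (dom : I -> Prop) (count : I -> nat) (P : program) : Prop :=
  exists p : {poly {poly R}},
  forall (x : I) (eps : R), dom x -> 0 < eps -> eps < 1 ->
  exists (out : tree) (time : nat),
    [/\ runs P (Node (enc x) (tree_of_nat `|Num.ceil eps^-1|%N)) out time,
        time%:R <= p.[((tree_size (enc x))%:R)%:P].[eps^-1]
      & (1 - eps) * (count x)%:R <= value_of_tree R out
          <= (1 + eps) * (count x)%:R].

(** A hypergraph on the vertices 0, ..., n-1 together with a list of its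
    hyperedges, in an arbitrary order and each given as a list of vertices in
    an arbitrary order: this list is what a program gets to see. *)
Record hypergraph_input : Type := HypergraphInput {
  hg_order : nat;
  hg_edges : {set {set 'I_hg_order}};
  hg_list : seq (seq 'I_hg_order);
  hg_list_uniq : all uniq hg_list;
  hg_listP : perm_eq [seq [set v in e] | e <- hg_list] (enum hg_edges)
}.

Definition tree_of_hypergraph (H : hypergraph_input) : tree :=
  Node (tree_of_nat (hg_order H))
    (tree_of_seq
       [seq tree_of_seq [seq tree_of_nat (nat_of_ord v) | v <- e]
       | e <- hg_list H]).

Definition uniform_linear_maxdeg (k Delta : nat) (H : hypergraph_input)
    : Prop :=
  [/\ uniform_hypergraph (hg_edges H) k,
      linear_hypergraph (hg_edges H)
    & max_hdegree (hg_edges H) = Delta].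

(* Main.v *)
(** Let [p_i] be the probability that vertex [i] is unoccupied in a uniform
    independent set of the hypergraph formed by the edges avoiding the vertices
    below [i]; then the number of independent sets is the product of the
    [1 / p_i].  Each [p_i] is computed by derandomising the systematic-scan
    Glauber dynamics backwards in time.  An update draws a fair bit, and a bit 0
    vacates the vertex whatever its neighbourhood looks like.  So the final
    value of a vertex depends only on the bits at the update times reachable
    from its last update through windows (the [k] latest updates of an edge)
    all of whose bits are 1.  Uniform independent sets are invariant under every
    update, hence, up to the probability that the exploration reveals more than
    [K] bits, [p_i] is the fraction of the [2^K] answer sequences after which
    the explored part of the dynamics leaves the vertex vacant.

    A long exploration contains many all-one windows.  Among them one finds a
    forest of pairwise disjoint blocks of [q + 1] connected windows, where
    [q < sqrt k <= q + 1], consecutive blocks being at distance two.  By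
    linearity a block covers at least [(q + 1) (k - q - 1)] times, while it can
    be attached in at most [(q + 1) D^2 (q D)^q] ways, [D = 6 k^2 Delta].  The
    degree condition gives [100 k^3 Delta 2^(5 q) <= 2^k], which makes a union
    bound over forests converge geometrically: [K = O(log (n / eps))] suffices
    and the enumeration is polynomial. *)

Require Import Defs.
From HB Require Import structures.
From mathcomp Require Import all_boot all_order all_algebra.
From mathcomp Require Import boolp zify ring lra.

Set Implicit Arguments.
Unset Strict Implicit.
Unset Printing Implicit Defensive.

(** * Polynomial-time functions *)

(** The size of $q$ is a balance. A block of $q+1$ windows is located by $q+2$ neighbour steps, two
    to attach it and $q$ to grow it, so it costs about $D^{q+2}$, yet its $q+1$ windows force fewer
    than $(q+1)k$ bits: one factor $2^k$ is missing. Moreover up to $(q+1)^2$ times are lost where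
    windows of the block meet. Spread over the $q+2$ factors $D$, the deficit $k+(q+1)^2$ is least,
    of order $\sqrt k$ bits per factor, when $q$ is about $\sqrt k$. The factor $2^{5q}$ pays for
    it, and $k \ge 25(1+\delta)^2/\delta^2$ says exactly that $5\sqrt k \le k - k/(1+\delta)$.

    No mixing of the chain is needed, only stationarity. A finished exploration determines the final
    value of the vertex for every starting set, so the program may simulate from the empty set while
    the analysis starts from a uniform independent set. The horizon only has to lie beyond whatever
    $K$ revealed bits can reach. *)

Class Enc (A : Type) := enc : A -> tree.
Instance Enc_unit : Enc unit := fun _ => Leaf.
Instance Enc_bool : Enc bool := fun b => if b then Node Leaf Leaf else Leaf.
Instance Enc_nat : Enc nat := tree_of_nat.
Instance Enc_prod A B (EA : Enc A) (EB : Enc B) : Enc (A * B) :=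
  fun p => Node (enc p.1) (enc p.2).
Instance Enc_seq A (EA : Enc A) : Enc (seq A) :=
  fun s => tree_of_seq [seq enc x | x <- s].

Definition esize A (EA : Enc A) (a : A) : nat := tree_size (enc a).
Arguments esize {A EA} a.

Lemma esize_gt0 A (EA : Enc A) (a : A) : 0 < esize a.
Proof. by rewrite /esize; case: (enc a). Qed.

Lemma esize_pair A B (EA : Enc A) (EB : Enc B) (a : A) (b : B) :
  esize (a, b) = (esize a + esize b).+1.
Proof. by []. Qed.

Lemma esize_cons A (EA : Enc A) (x : A) (s : seq A) :
  esize (x :: s) = (esize x + esize s).+1.
Proof. by []. Qed.

Lemma esize_nat (n : nat) : esize n = n.*2.+1.
Proof.
elim: n => // n IH; have -> : esize n.+1 = (1 + esize n).+1 by [].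
by rewrite IH; lia.
Qed.

Lemma esize_bool (b : bool) : esize b <= 3.
Proof. by case: b. Qed.

Lemma size_le_esize A (EA : Enc A) (s : seq A) : size s <= esize s.
Proof. by elim: s => // x s IH; rewrite esize_cons /=; lia. Qed.

Lemma esize_drop A (EA : Enc A) i (s : seq A) : esize (drop i s) <= esize s.
Proof.
elim: s i => [|x s IH] [|i] //=; rewrite esize_cons.
by apply: leq_trans (IH i) _; lia.
Qed.

Lemma esize_seq_le A (EA : Enc A) (s : seq A) w :
  (forall i, i < size s -> forall x0, esize (nth x0 s i) <= w) ->
  esize s <= (size s * w.+1).+1.
Proof.
elim: s => // x s IH H; rewrite esize_cons /=.
have h0 := H 0 isT x; rewrite /= in h0.
have := IH (fun i (lti : i < size s) x0 => H i.+1 lti x0).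
by rewrite mulSn; lia.
Qed.

Arguments esize_gt0 {A EA} a.
Arguments esize_pair {A B EA EB} a b.
Arguments esize_cons {A EA} x s.
Arguments size_le_esize {A EA} s.
Arguments esize_drop {A EA} i s.

Definition pbound A (EA : Enc A) (g : A -> nat) : Prop :=
  exists c d, forall a, g a <= c * esize a ^ d.
Arguments pbound {A EA} g.

Lemma pbound_le A (EA : Enc A) (h g : A -> nat) :
  (forall a, g a <= h a) -> pbound h -> pbound g.
Proof.
by move=> le [c [d H]]; exists c, d => a; apply: leq_trans (le a) (H a).
Qed.

Lemma pbound_const A (EA : Enc A) c : pbound (fun _ : A => c).
Proof. by exists c, 0 => a; rewrite expn0 muln1. Qed.

Lemma pbound_esize A (EA : Enc A) : pbound (fun a : A => esize a).
Proof. by exists 1, 1 => a; rewrite expn1 mul1n. Qed.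

Lemma pbound_mul A (EA : Enc A) (g h : A -> nat) :
  pbound g -> pbound h -> pbound (fun a => g a * h a).
Proof.
move=> [c [d H]] [c' [d' H']]; exists (c * c'), (d + d') => a.
by rewrite expnD mulnACA; apply: leq_mul.
Qed.

Lemma pbound_add A (EA : Enc A) (g h : A -> nat) :
  pbound g -> pbound h -> pbound (fun a => g a + h a).
Proof.
move=> [c [d H]] [c' [d' H']]; exists (c + c'), (d + d') => a.
rewrite mulnDl; apply: leq_add.
  apply: leq_trans (H a) _; rewrite leq_mul2l leq_pexp2l ?orbT ?esize_gt0 //.
  exact: leq_addr.
apply: leq_trans (H' a) _; rewrite leq_mul2l leq_pexp2l ?orbT ?esize_gt0 //.
exact: leq_addl.
Qed.

Lemma pbound_exp A (EA : Enc A) (g : A -> nat) m :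
  pbound g -> pbound (fun a => g a ^ m).
Proof.
move=> pg; elim: m => [|m IH]; first exact: pbound_const.
by apply: (pbound_le _ (pbound_mul pg IH)) => a; rewrite expnS.
Qed.

Lemma pbound_comp A B (EA : Enc A) (EB : Enc B) (g : B -> nat) (f : A -> B) :
  pbound g -> pbound (fun a => esize (f a)) -> pbound (fun a => g (f a)).
Proof.
move=> [c [d H]] pf.
apply: (pbound_le (h := fun a => c * esize (f a) ^ d)) => [a|]; first exact: H.
by apply: pbound_mul (pbound_const _ _) (pbound_exp _ pf).
Qed.

Lemma expn_mono m n d : m <= n -> m ^ d <= n ^ d.
Proof. by case: d => // d; rewrite leq_exp2r. Qed.

(** A step function is run on intermediate values rather than on the input, and its time bound need
    not be monotone. [G] bounds it uniformly over all arguments of admissible size. *)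
Lemma pbound_dominate A B (EA : Enc A) (EB : Enc B) (g : B -> nat)
    (s : A -> nat) :
  pbound g -> pbound s ->
  exists2 G, pbound G & forall a b, esize b <= s a -> g b <= G a.
Proof.
move=> [c [d Hg]] ps; exists (fun a => c * s a ^ d).
  by apply: pbound_mul (pbound_const _ _) (pbound_exp _ ps).
move=> a b le; apply: leq_trans (Hg b) _.
by rewrite leq_mul2l expn_mono ?orbT.
Qed.

(** [n0] is the position at which the code [P1] is linked into a larger
    program. *)
Definition implements A B (EA : Enc A) (EB : Enc B) (f : A -> B)
    (T : A -> nat) : Prop :=
  forall n0, exists (P1 : program) (e : expr), forall P0 P2 : program,
    size P0 = n0 -> forall a, exists2 t, t <= T a &
      eval (P0 ++ P1 ++ P2) (enc a) e (enc (f a)) t.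
Arguments implements {A B EA EB} f T.

(** The size of the result is bounded separately from the time: trees are
    shared, so linear time suffices to build a tree of exponential size. *)
Definition ptime A B (EA : Enc A) (EB : Enc B) (f : A -> B) : Prop :=
  pbound (fun a => esize (f a)) /\ exists2 T, pbound T & implements f T.
Arguments ptime {A B EA EB} f.

Lemma nth_program_mid (P0 P2 : program) e :
  nth ENil (P0 ++ e :: P2) (size P0) = e.
Proof. by rewrite nth_cat ltnn subnn. Qed.

Lemma ptime_eq A B (EA : Enc A) (EB : Enc B) (f g : A -> B) :
  f =1 g -> ptime f -> ptime g.
Proof.
move=> fg [bf [T bT I]]; split; first by apply: pbound_le bf => a; rewrite fg.
exists T => // n0; have [P1 [e H]] := I n0; exists P1, e => P0 P2 s0 a.
by have [t le ev] := H P0 P2 s0 a; exists t => //; rewrite -fg.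
Qed.

(** Programs see only encodings, so one program serves two types that share them: a nonempty list is
    encoded as the pair of its head and tail, a number as a list of units. *)
Lemma ptime_enc_eq A B B' (EA : Enc A) (EB : Enc B) (EB' : Enc B')
    (f : A -> B) (g : A -> B') :
  (forall a, enc (f a) = enc (g a)) -> ptime f -> ptime g.
Proof.
move=> fg [bf [T bT I]]; split.
  by apply: pbound_le bf => a; rewrite /esize fg.
exists T => // n0; have [P1 [e H]] := I n0; exists P1, e => P0 P2 s0 a.
by have [t le ev] := H P0 P2 s0 a; exists t => //; rewrite -fg.
Qed.

Lemma ptime_id A (EA : Enc A) : ptime (fun a : A => a).
Proof.
split; first exact: pbound_esize.
exists (fun=> 1); first exact: pbound_const.
move=> n0; exists [::], EArg => P0 P2 _ a; exists 1 => //; exact: eval_arg.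
Qed.

Fixpoint tree_expr (t : tree) : expr :=
  if t is Node l r then ECons (tree_expr l) (tree_expr r) else ENil.

Lemma eval_tree_expr P a t : eval P a (tree_expr t) t (tree_size t).
Proof.
elim: t => [|l IHl r IHr] /=; first exact: eval_nil.
exact: eval_cons.
Qed.

Lemma ptime_const A B (EA : Enc A) (EB : Enc B) (b : B) :
  ptime (fun _ : A => b).
Proof.
split; first exact: pbound_const.
exists (fun=> esize b); first exact: pbound_const.
move=> n0; exists [::], (tree_expr (enc b)) => P0 P2 _ a.
by exists (esize b) => //; apply: eval_tree_expr.
Qed.

Lemma ptime_fst A B C (EA : Enc A) (EB : Enc B) (EC : Enc C)
    (f : A -> B * C) :
  ptime f -> ptime (fun a => (f a).1).
Proof.
move=> [bf [T bT I]]; split.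
  by apply: pbound_le bf => a; case: (f a) => x y; rewrite esize_pair /=; lia.
exists (fun a => T a + 1); first exact: pbound_add bT (pbound_const _ _).
move=> n0; have [P1 [e H]] := I n0; exists P1, (EHd e) => P0 P2 s0 a.
have [t le ev] := H P0 P2 s0 a; exists t.+1; first by rewrite addn1.
exact: eval_hd ev.
Qed.

Lemma ptime_snd A B C (EA : Enc A) (EB : Enc B) (EC : Enc C)
    (f : A -> B * C) :
  ptime f -> ptime (fun a => (f a).2).
Proof.
move=> [bf [T bT I]]; split.
  by apply: pbound_le bf => a; case: (f a) => x y; rewrite esize_pair /=; lia.
exists (fun a => T a + 1); first exact: pbound_add bT (pbound_const _ _).
move=> n0; have [P1 [e H]] := I n0; exists P1, (ETl e) => P0 P2 s0 a.
have [t le ev] := H P0 P2 s0 a; exists t.+1; first by rewrite addn1.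
exact: eval_tl ev.
Qed.

Lemma ptime_pair A B C (EA : Enc A) (EB : Enc B) (EC : Enc C)
    (f : A -> B) (g : A -> C) :
  ptime f -> ptime g -> ptime (fun a => (f a, g a)).
Proof.
move=> [bf [T bT I]] [bg [U bU J]]; split.
  apply: (pbound_le (h := fun a => esize (f a) + esize (g a) + 1)).
    by move=> a; rewrite esize_pair addn1.
  by apply: pbound_add (pbound_const _ _); apply: pbound_add.
exists (fun a => T a + U a + 1).
  by apply: pbound_add (pbound_const _ _); apply: pbound_add.
move=> n0; have [Pf [ef Hf]] := I n0.
have [Pg [eg Hg]] := J (n0 + size Pf).
exists (Pf ++ Pg), (ECons ef eg) => P0 P2 s0 a.
have [t le ev] := Hf P0 (Pg ++ P2) s0 a.
have [|u le' ev'] := Hg (P0 ++ Pf) P2 _ a; first by rewrite size_cat s0.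
exists (t + u).+1; first by rewrite addn1 ltnS leq_add.
by apply: eval_cons; [move: ev | move: ev']; rewrite -!catA.
Qed.

(** [eg] refers to its own argument through [EArg], so it becomes a new function of the program,
    called on the value of [f]. *)
Lemma ptime_comp A B C (EA : Enc A) (EB : Enc B) (EC : Enc C)
    (g : B -> C) (f : A -> B) :
  ptime g -> ptime f -> ptime (fun a => g (f a)).
Proof.
move=> [bg [U bU J]] [bf [T bT I]]; split.
  exact: (pbound_comp bg bf).
exists (fun a => T a + U (f a) + 1).
  by apply: pbound_add (pbound_const _ _);
    apply: pbound_add (pbound_comp bU bf).
move=> n0; have [Pf [ef Hf]] := I n0.
have [Pg [eg Hg]] := J (n0 + size Pf).
exists (Pf ++ Pg ++ [:: eg]), (ECall (n0 + size Pf + size Pg) ef) => P0 P2 s0 a.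
have [t le ev] := Hf P0 (Pg ++ eg :: P2) s0 a.
have [|u le' ev'] := Hg (P0 ++ Pf) (eg :: P2) _ (f a);
  first by rewrite size_cat s0.
exists (t + u).+1; first by rewrite addn1 ltnS leq_add.
rewrite -!catA in ev' *; apply: eval_call ev _.
have -> : P0 ++ Pf ++ Pg ++ [:: eg] ++ P2 = (P0 ++ Pf ++ Pg) ++ eg :: P2.
  by rewrite -!catA.
have -> : n0 + size Pf + size Pg = size (P0 ++ Pf ++ Pg).
  by rewrite !size_cat s0 addnA.
by rewrite nth_program_mid -!catA.
Qed.

Lemma ptime_if A B (EA : Enc A) (EB : Enc B) (c : A -> bool) (f g : A -> B) :
  ptime c -> ptime f -> ptime g -> ptime (fun a => if c a then f a else g a).
Proof.
move=> [bc [S bS K]] [bf [T bT I]] [bg [U bU J]]; split.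
  apply: (pbound_le _ (pbound_add bf bg)) => a.
  by case: ifP => _; lia.
exists (fun a => S a + (T a + U a) + 1).
  apply: pbound_add (pbound_const _ _); apply: pbound_add => //.
  exact: pbound_add.
move=> n0; have [Pc [ec Hc]] := K n0.
have [Pf [ef Hf]] := I (n0 + size Pc).
have [Pg [eg Hg]] := J (n0 + size Pc + size Pf).
exists (Pc ++ Pf ++ Pg), (EIf ec ef eg) => P0 P2 s0 a.
have [s les evs] := Hc P0 (Pf ++ Pg ++ P2) s0 a.
have [|t let_ evt] := Hf (P0 ++ Pc) (Pg ++ P2) _ a;
  first by rewrite size_cat s0.
have [|u leu evu] := Hg (P0 ++ Pc ++ Pf) P2 _ a.
  by rewrite !size_cat s0 addnA.
rewrite -!catA in evt evu *.
case: (c a) evs => evs.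
  exists (s + t).+1; first by lia.
  exact: eval_if_node evs evt.
exists (s + u).+1; first by lia.
exact: eval_if_leaf evs evu.
Qed.

Lemma ptime_nonnil A X (EA : Enc A) (EX : Enc X) (l : A -> seq X) :
  ptime l -> ptime (fun a => ~~ nilp (l a)).
Proof.
move=> [bl [S bS K]]; split.
  by apply: (pbound_le _ (pbound_const _ 3)) => a; apply: esize_bool.
exists (fun a => S a + 4); first exact: pbound_add bS (pbound_const _ _).
move=> n0; have [P1 [e H]] := K n0.
exists P1, (EIf e (ECons ENil ENil) ENil) => P0 P2 s0 a.
have [t le ev] := H P0 P2 s0 a.
case: (l a) ev => [|x s] ev /=.
  exists (t + 1).+1; first by lia.
  by apply: eval_if_leaf ev _; apply: eval_nil.
exists (t + 3).+1; first by lia.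
apply: eval_if_node ev _; apply: (@eval_cons _ _ _ _ _ _ 1 1); exact: eval_nil.
Qed.

Lemma ptime_cons A X (EA : Enc A) (EX : Enc X) (f : A -> X) (l : A -> seq X) :
  ptime f -> ptime l -> ptime (fun a => f a :: l a).
Proof.
move=> pf pl; apply: ptime_enc_eq (ptime_pair pf pl) => a; by [].
Qed.

Lemma ptime_case A X B (EA : Enc A) (EX : Enc X) (EB : Enc B)
    (l : A -> seq X) (f : A * (X * seq X) -> B) (g : A -> B) :
  ptime l -> ptime f -> ptime g ->
  ptime (fun a => if l a is x :: s then f (a, (x, s)) else g a).
Proof.
move=> [bl [S bS K]] [bf [T bT I]] [bg [U bU J]].
have bal : pbound (fun a => esize a + esize (l a) + 1).
  apply: pbound_add (pbound_const _ _).
  by apply: pbound_add => //; apply: pbound_esize.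
have [F bF HF] := pbound_dominate bf bal.
have [T' bT' HT] := pbound_dominate bT bal.
split.
  apply: (pbound_le _ (pbound_add bF bg)) => a.
  case E : (l a) => [|x s]; first exact: leq_addl.
  apply: leq_trans (leq_addr _ _); apply: HF.
  by rewrite E !esize_pair esize_cons; lia.
(* [S a] counts twice: [el] is evaluated once as the test and once inside the argument of the call,
   as expressions have no local binding. *)
exists (fun a => S a + S a + (T' a + U a) + 4).
  apply: pbound_add (pbound_const _ _); apply: pbound_add; exact: pbound_add.
move=> n0; have [Pl [el Hl]] := K n0.
have [Pf [ef Hf]] := I (n0 + size Pl).
have [Pg [eg Hg]] := J (n0 + size Pl + size Pf).
exists (Pl ++ Pf ++ Pg ++ [:: ef]).
exists (EIf el (ECall (n0 + size Pl + size Pf + size Pg) (ECons EArg el)) eg).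
move=> P0 P2 s0 a.
have [s les evs] := Hl P0 (Pf ++ Pg ++ ef :: P2) s0 a.
have [|u leu evu] := Hg (P0 ++ Pl ++ Pf) (ef :: P2) _ a.
  by rewrite !size_cat s0 addnA.
rewrite -!catA in evu *.
case E : (l a) evs => [|x xs] evs.
  exists (s + u).+1; first by lia.
  exact: eval_if_leaf evs evu.
have [|t let_ evt] := Hf (P0 ++ Pl) (Pg ++ ef :: P2) _ (a, (x, xs)).
  by rewrite size_cat s0.
have let' : t <= T' a.
  by apply: leq_trans let_ _; apply: HT; rewrite E !esize_pair esize_cons; lia.
have evs2 := evs; exists (s + ((1 + s).+1 + t).+1).+1; first by lia.
apply: eval_if_node evs _; apply: eval_call.
  by apply: eval_cons; [exact: eval_arg | exact: evs2].
have -> : P0 ++ Pl ++ Pf ++ Pg ++ [:: ef] ++ P2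
          = (P0 ++ Pl ++ Pf ++ Pg) ++ ef :: P2 by rewrite -!catA.
have -> : n0 + size Pl + size Pf + size Pg = size (P0 ++ Pl ++ Pf ++ Pg).
  by rewrite !size_cat s0 !addnA.
by rewrite nth_program_mid; move: evt; rewrite -!catA.
Qed.

Arguments ptime_id {A EA}.
Arguments ptime_const {A B EA EB} b.

(** * Recursion over lists and unary numerals *)

Section Recursion.
Variables (A X B : Type) (EA : Enc A) (EX : Enc X) (EB : Enc B).

(** The step also receives the remaining tail. A polynomial step, iterated, may multiply sizes each
    time; hence the a priori bound [h] on all intermediate results, which bounds the argument of
    every call of the step. *)
Lemma ptime_para (l : A -> seq X) (init : A -> B)
    (step : A * (X * seq X) * B -> B) (F : A -> seq X -> B) (h : A -> nat) :
  ptime l -> ptime init -> ptime step ->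
  (forall a, F a [::] = init a) ->
  (forall a x s, F a (x :: s) = step ((a, (x, s)), F a s)) ->
  pbound h -> (forall a i, esize (F a (drop i (l a))) <= h a) ->
  ptime (fun a => F a (l a)).
Proof.
move=> [bl [S bS K]] [bi [U bU J]] [bs [T bT I]] F0 FS bh Fh; split.
  by apply: pbound_le bh => a; have := Fh a 0; rewrite drop0.
have bal : pbound (fun a => esize a + esize (l a) + h a + 2).
  apply: pbound_add (pbound_const _ _); apply: pbound_add => //.
  by apply: pbound_add => //; apply: pbound_esize.
have [T' bT' HT] := pbound_dominate bT bal.
exists (fun a => S a + 3 + (esize (l a) * (T' a + 14) + (U a + 6))).
  apply: pbound_add; first exact: pbound_add bS (pbound_const _ _).
  apply: pbound_add; last exact: pbound_add bU (pbound_const _ _).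
  by apply: pbound_mul => //; apply: pbound_add bT' (pbound_const _ _).
move=> n0; have [Pl [el Hl]] := K n0.
have [Pi [ei Hi]] := J (n0 + size Pl).
have [Ps [es Hs]] := I (n0 + size Pl + size Pi).
(* Functions [q], [q.+1] and [q.+2] of the linked program are the initial value, the step and the
   loop [body]; the argument of the loop is [a] paired with the remaining list. *)
pose q := n0 + size Pl + size Pi + size Ps.
pose body := EIf (ETl EArg)
  (ECall q.+1 (ECons EArg (ECall q.+2 (ECons (EHd EArg) (ETl (ETl EArg))))))
  (ECall q (EHd EArg)).
exists (Pl ++ Pi ++ Ps ++ [:: ei; es; body]).
exists (ECall q.+2 (ECons EArg el)) => P0 P2 s0 a.
set P := P0 ++ _.
have sq : q = size (P0 ++ Pl ++ Pi ++ Ps) by rewrite !size_cat s0 !addnA.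
have ni : nth ENil P q = ei.
  have -> : P = (P0 ++ Pl ++ Pi ++ Ps) ++ ei :: es :: body :: P2.
    by rewrite /P -!catA.
  by rewrite sq nth_program_mid.
have ns : nth ENil P q.+1 = es.
  have -> : P = ((P0 ++ Pl ++ Pi ++ Ps) ++ [:: ei]) ++ es :: body :: P2.
    by rewrite /P -!catA.
  have -> : q.+1 = size ((P0 ++ Pl ++ Pi ++ Ps) ++ [:: ei]).
    by rewrite size_cat -sq addn1.
  by rewrite nth_program_mid.
have nb : nth ENil P q.+2 = body.
  have -> : P = ((P0 ++ Pl ++ Pi ++ Ps) ++ [:: ei; es]) ++ body :: P2.
    by rewrite /P -!catA.
  have -> : q.+2 = size ((P0 ++ Pl ++ Pi ++ Ps) ++ [:: ei; es]).
    by rewrite size_cat -sq addn2.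
  by rewrite nth_program_mid.
have loop : forall xs i, xs = drop i (l a) ->
    exists2 t, t <= size xs * (T' a + 14) + (U a + 6) &
      eval P (enc (a, xs)) body (enc (F a xs)) t.
  elim=> [|x xs IH] i Ei.
    have [|u leu evu] := Hi (P0 ++ Pl) (Ps ++ [:: ei; es; body] ++ P2) _ a.
      by rewrite size_cat s0.
    exists (2 + (2 + u).+1).+1; first by lia.
    apply: (@eval_if_leaf _ _ _ _ _ _ 2).
      by apply: (@eval_tl _ _ _ (enc (a, [::]))); apply: eval_arg.
    rewrite F0; apply: (@eval_call _ _ _ _ (enc a)).
      by apply: (@eval_hd _ _ _ (enc (a, [::]))); apply: eval_arg.
    by rewrite ni /P; move: evu; rewrite -!catA.
  have [|t let_ evt] := IH i.+1.
    have lti : i < size (l a).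
      by rewrite ltnNge; apply/negP => /drop_oversize; rewrite -Ei.
    by move: Ei; rewrite (drop_nth x lti) => -[_].
  have [|u leu evu] := Hs (P0 ++ Pl ++ Pi) ([:: ei; es; body] ++ P2) _
                          (a, (x, xs), F a xs).
    by rewrite !size_cat s0 !addnA.
  have leu' : u <= T' a.
    apply: leq_trans leu _; apply: HT.
    have ti : esize (x :: xs) <= esize (l a) by rewrite Ei; apply: esize_drop.
    have tF : esize (F a xs) <= h a.
      have := Fh a i.+1; rewrite -add1n -drop_drop -Ei /= drop0; exact.
    by rewrite !esize_pair; move: ti; rewrite esize_cons; lia.
  exists (2 + ((1 + ((2 + 3).+1 + t).+1).+1 + u).+1).+1.
    by rewrite /= mulSn; lia.
  apply: (@eval_if_node _ _ _ _ _ (enc x) (enc xs) _ 2).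
    by apply: (@eval_tl _ _ _ (enc (a, x :: xs))); apply: eval_arg.
  rewrite FS; apply: eval_call.
    apply: eval_cons; first exact: eval_arg.
    apply: (@eval_call _ _ _ _ (enc (a, xs))).
      apply: (@eval_cons _ _ _ _ (enc a) (enc xs) 2 3).
        by apply: (@eval_hd _ _ _ (enc (a, x :: xs))); apply: eval_arg.
      apply: (@eval_tl _ _ _ (enc (x :: xs)) 2).
      by apply: (@eval_tl _ _ _ (enc (a, x :: xs))); apply: eval_arg.
    by rewrite nb; exact: evt.
  by rewrite ns /P; move: evu; rewrite -!catA.
have [t let_ evt] := loop (l a) 0 (esym (drop0 _)).
have [s les evs] := Hl P0 (Pi ++ Ps ++ [:: ei; es; body] ++ P2) s0 a.
exists ((1 + s).+1 + t).+1.
  have : size (l a) * (T' a + 14) <= esize (l a) * (T' a + 14).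
    by rewrite leq_mul2r size_le_esize orbT.
  by lia.
apply: (@eval_call _ _ _ _ (enc (a, l a))).
  apply: eval_cons; first exact: eval_arg.
  by rewrite /P; move: evs; rewrite -!catA.
by rewrite nb.
Qed.

Lemma ptime_foldr (l : A -> seq X) (init : A -> B)
    (step : A -> X -> B -> B) (h : A -> nat) :
  ptime l -> ptime init -> ptime (fun p : A * X * B => step p.1.1 p.1.2 p.2) ->
  pbound h ->
  (forall a i, esize (foldr (step a) (init a) (drop i (l a))) <= h a) ->
  ptime (fun a => foldr (step a) (init a) (l a)).
Proof.
move=> pl pi ps bh Hh.
pose step' (p : A * (X * seq X) * B) := step p.1.1 p.1.2.1 p.2.
apply: (@ptime_para l init step' (fun a s => foldr (step a) (init a) s) h) =>
  //.
apply: (ptime_comp ps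
  (f := fun p : A * (X * seq X) * B => ((p.1.1, p.1.2.1), p.2))).
apply: ptime_pair; last exact: ptime_snd ptime_id.
apply: ptime_pair; first exact: ptime_fst (ptime_fst ptime_id).
exact: ptime_fst (ptime_snd (ptime_fst ptime_id)).
Qed.

Lemma esize_foldr_add (init : B) (step : X -> B -> B) (g : X -> nat) w :
  (forall x b, esize (step x b) <= esize b + g x) ->
  forall l, (forall x, esize x <= esize l -> g x <= w) ->
  esize (foldr step init l) <= esize init + size l * w.
Proof.
move=> H; elim=> [|x l IH] Hg /=; first by rewrite addn0.
have Hx : g x <= w by apply: Hg; rewrite esize_cons; lia.
have {}IH : esize (foldr step init l) <= esize init + size l * w.
  by apply: IH => y le; apply: Hg; rewrite esize_cons; lia.
by have := H x (foldr step init l); rewrite mulSn; lia.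
Qed.

(** The growth [g] of one step does not depend on the accumulator, so the intermediate results stay
    polynomial without a separate bound. *)
Lemma ptime_foldr_add (l : A -> seq X) (init : A -> B)
    (step : A -> X -> B -> B) (g : A * X -> nat) :
  ptime l -> ptime init -> ptime (fun p : A * X * B => step p.1.1 p.1.2 p.2) ->
  pbound g ->
  (forall a x b, esize (step a x b) <= esize b + g (a, x)) ->
  ptime (fun a => foldr (step a) (init a) (l a)).
Proof.
move=> pl pi ps bg Hg.
have bal : pbound (fun a => esize a + esize (l a) + 1).
  apply: pbound_add (pbound_const _ _).
  by apply: pbound_add pl.1; apply: pbound_esize.
have [G bG HG] := pbound_dominate bg bal.
apply: (@ptime_foldr l init step (fun a => esize (init a) + esize (l a) * G
  a)) => //.
  by apply: pbound_add pi.1 _; apply: pbound_mul pl.1 bG.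
move=> a i.
apply: leq_trans (_ : esize (init a) + size (drop i (l a)) * G a <= _).
  apply: (@esize_foldr_add _ _ (fun x => g (a, x))) => // x le.
  apply: HG; rewrite esize_pair; have := @esize_drop _ EX i (l a); lia.
rewrite leq_add2l leq_mul2r; apply/orP; right.
exact: leq_trans (size_le_esize _) (esize_drop i _).
Qed.

End Recursion.

Lemma ptime_nseq_unit A (EA : Enc A) (f : A -> nat) :
  ptime f -> ptime (fun a => nseq (f a) tt).
Proof.
apply: ptime_enc_eq => a; rewrite /enc /Enc_nat /Enc_seq /tree_of_nat.
by congr tree_of_seq; rewrite map_nseq.
Qed.

Lemma enc_seq_unit (s : seq unit) : enc s = enc (size s).
Proof.
rewrite /enc /Enc_nat /Enc_seq /tree_of_nat; congr tree_of_seq.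
by elim: s => //= x s ->.
Qed.

Lemma ptime_size_unit A (EA : Enc A) (f : A -> seq unit) :
  ptime f -> ptime (fun a => size (f a)).
Proof. by apply: ptime_enc_eq => a; rewrite enc_seq_unit. Qed.

Section NatRecursion.
Variables (A B : Type) (EA : Enc A) (EB : Enc B).

(** A numeral is run through as a list of units; the counter is the length of the remaining tail. *)
Lemma ptime_natrec (m : A -> nat) (init : A -> B)
    (step : A -> nat -> B -> B) (F : A -> nat -> B) (h : A -> nat) :
  ptime m -> ptime init ->
  ptime (fun p : A * nat * B => step p.1.1 p.1.2 p.2) ->
  (forall a, F a 0 = init a) ->
  (forall a j, F a j.+1 = step a j (F a j)) ->
  pbound h -> (forall a j, j <= m a -> esize (F a j) <= h a) ->
  ptime (fun a => F a (m a)).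
Proof.
move=> pm pi ps F0 FS bh Hh.
pose step' (p : A * (unit * seq unit) * B) := step p.1.1 (size p.1.2.2) p.2.
apply: (ptime_eq (f := fun a => F a (size (nseq (m a) tt)))).
  by move=> a; rewrite size_nseq.
apply: (@ptime_para _ _ _ _ _ _ (fun a => nseq (m a) tt) init step'
          (fun a s => F a (size s)) h) => //.
- exact: ptime_nseq_unit.
- apply: (ptime_comp ps
    (f := fun p : A * (unit * seq unit) * B => ((p.1.1, size p.1.2.2), p.2))).
  apply: ptime_pair; last exact: ptime_snd ptime_id.
  apply: ptime_pair; first exact: ptime_fst (ptime_fst ptime_id).
  apply: ptime_size_unit.
  exact: ptime_snd (ptime_snd (ptime_fst ptime_id)).
- by move=> a x s; rewrite /= FS.
by move=> a i; apply: Hh; rewrite size_drop size_nseq leq_subr.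
Qed.

Lemma ptime_natrec_add (m : A -> nat) (init : A -> B)
    (step : A -> nat -> B -> B) (F : A -> nat -> B) (g : A * nat -> nat) :
  ptime m -> ptime init ->
  ptime (fun p : A * nat * B => step p.1.1 p.1.2 p.2) ->
  (forall a, F a 0 = init a) ->
  (forall a j, F a j.+1 = step a j (F a j)) ->
  pbound g -> (forall a j b, esize (step a j b) <= esize b + g (a, j)) ->
  ptime (fun a => F a (m a)).
Proof.
move=> pm pi ps F0 FS bg Hg.
have bal : pbound (fun a => esize a + esize (m a) + 1).
  apply: pbound_add (pbound_const _ _).
  by apply: pbound_add pm.1; apply: pbound_esize.
have [G bG HG] := pbound_dominate bg bal.
apply: (@ptime_natrec m init step F (fun a => esize (init a) + esize (m a) * G
  a)) => //.
  by apply: pbound_add pi.1 _; apply: pbound_mul pm.1 bG.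
move=> a j le.
apply: leq_trans (_ : esize (init a) + j * G a <= _); last first.
  by rewrite leq_add2l leq_mul2r esize_nat; apply/orP; right; lia.
elim: j le => [|j IH] le; first by rewrite F0 addn0.
rewrite FS; apply: leq_trans (Hg _ _ _) _.
have : g (a, j) <= G a by apply: HG; rewrite esize_pair !esize_nat; lia.
by have := IH (ltnW le); rewrite mulSn; lia.
Qed.

End NatRecursion.

(** * Arithmetic, boolean and list operations *)

Lemma ptime_succ A (EA : Enc A) (f : A -> nat) : ptime f ->
  ptime (fun a => (f a).+1).
Proof.
move=> pf; exact: (ptime_enc_eq _ (ptime_pair (ptime_const tt) pf)).
Qed.

Lemma ptime_behead A X (EA : Enc A) (EX : Enc X)
    (l : A -> seq X) : ptime l -> ptime (fun a => behead (l a)).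
Proof.
move=> pl; apply: (ptime_eq (f := fun a => if l a is x :: s then
    (fun p : A * (X * seq X) => p.2.2) (a, (x, s)) else [::])).
  by move=> a; case: (l a).
apply: (ptime_case (f := fun p : A * (X * seq X) => p.2.2)) => //.
  exact: ptime_snd (ptime_snd ptime_id).
exact: ptime_const.
Qed.

Lemma ptime_pred A (EA : Enc A) (f : A -> nat) : ptime f ->
  ptime (fun a => (f a).-1).
Proof.
move=> pf; apply: (ptime_eq (f := fun a => (size (nseq (f a) tt)).-1)).
  by move=> a; rewrite size_nseq.
have pn := ptime_nseq_unit pf.
apply: (ptime_eq (f := fun a =>
    size (if nseq (f a) tt is x :: s then
            (fun p : A * (unit * seq unit) => p.2.2) (a, (x, s)) else [::]))).
  by move=> a; rewrite size_nseq; case: (f a) => // m; rewrite size_nseq.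
apply: ptime_size_unit.
apply: (ptime_case (f := fun p : A * (unit * seq unit) => p.2.2)) => //.
  exact: ptime_snd (ptime_snd ptime_id).
exact: ptime_const.
Qed.

Lemma ptime_neg A (EA : Enc A) (c : A -> bool) : ptime c ->
  ptime (fun a => ~~ c a).
Proof.
move=> pc; apply: (ptime_eq (f := fun a => if c a then false else true)).
  by move=> a; case: (c a).
by apply: ptime_if => //; apply: ptime_const.
Qed.

Lemma ptime_and A (EA : Enc A) (c d : A -> bool) :
  ptime c -> ptime d -> ptime (fun a => c a && d a).
Proof. by move=> pc pd; exact: (ptime_if pc pd (ptime_const false)). Qed.

Lemma ptime_or A (EA : Enc A) (c d : A -> bool) :
  ptime c -> ptime d -> ptime (fun a => c a || d a).
Proof. by move=> pc pd; exact: (ptime_if pc (ptime_const true) pd). Qed.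

Lemma ptime_addb A (EA : Enc A) (c d : A -> bool) :
  ptime c -> ptime d -> ptime (fun a => c a (+) d a).
Proof.
move=> pc pd; apply: ptime_eq (ptime_if pc (ptime_neg pd) pd) => a.
by case: (c a).
Qed.

Lemma ptime_eq0 A (EA : Enc A) (f : A -> nat) : ptime f ->
  ptime (fun a => f a == 0).
Proof.
move=> pf; apply: (ptime_eq (f := fun a => ~~ ~~ nilp (nseq (f a) tt))).
  by move=> a; rewrite negbK /nilp size_nseq.
by apply: ptime_neg; apply: ptime_nonnil; apply: ptime_nseq_unit.
Qed.

Lemma ptime_nilp A X (EA : Enc A) (EX : Enc X)
    (l : A -> seq X) : ptime l -> ptime (fun a => nilp (l a)).
Proof.
move=> pl; apply: (ptime_eq (f := fun a => ~~ ~~ nilp (l a))).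
  by move=> a; rewrite negbK.
by apply: ptime_neg; apply: ptime_nonnil.
Qed.

Lemma ptime_add A (EA : Enc A) (f g : A -> nat) :
  ptime f -> ptime g -> ptime (fun a => f a + g a).
Proof.
move=> pf pg.
apply: (@ptime_natrec_add _ _ _ _ f g (fun _ _ b => b.+1)
          (fun a j => j + g a) (fun=> 2)) => //.
- by apply: ptime_succ; apply: ptime_snd ptime_id.
- exact: pbound_const.
by move=> a j b; rewrite /= !esize_nat; lia.
Qed.

Lemma ptime_mul A (EA : Enc A) (f g : A -> nat) :
  ptime f -> ptime g -> ptime (fun a => f a * g a).
Proof.
move=> pf pg.
apply: (@ptime_natrec_add _ _ _ _ f (fun=> 0) (fun a _ b => g a + b)
          (fun a j => j * g a) (fun p => esize (g p.1))) => //.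
- exact: ptime_const.
- apply: ptime_add; last exact: ptime_snd ptime_id.
  by apply: (ptime_comp pg); apply: ptime_fst (ptime_fst ptime_id).
- by apply: (pbound_comp pg.1); have [] := ptime_fst (@ptime_id (A * nat) _).
by move=> a j b; rewrite /= !esize_nat; lia.
Qed.

Lemma ptime_sub A (EA : Enc A) (f g : A -> nat) :
  ptime f -> ptime g -> ptime (fun a => f a - g a).
Proof.
move=> pf pg.
apply: (@ptime_natrec_add _ _ _ _ g f (fun _ _ b => b.-1)
          (fun a j => f a - j) (fun=> 0)) => //.
- by apply: ptime_pred; apply: ptime_snd ptime_id.
- by move=> a; rewrite subn0.
- by move=> a j; rewrite subnS.
- exact: pbound_const.
by move=> a j b; rewrite /= !esize_nat; lia.
Qed.

Lemma ptime_leq A (EA : Enc A) (f g : A -> nat) :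
  ptime f -> ptime g -> ptime (fun a => f a <= g a).
Proof. by move=> pf pg; apply: ptime_eq0; apply: ptime_sub. Qed.

Lemma ptime_eqn A (EA : Enc A) (f g : A -> nat) :
  ptime f -> ptime g -> ptime (fun a => f a == g a).
Proof.
move=> pf pg; apply: (ptime_eq (f := fun a => (f a <= g a) && (g a <= f a))).
  by move=> a; rewrite eqn_leq.
by apply: ptime_and; apply: ptime_leq.
Qed.

(** The remainder is counted upwards and reset when it reaches the modulus; with modulus 0 it is
    never reset, as [j %% 0 = j] requires. *)
Lemma ptime_mod A (EA : Enc A) (f g : A -> nat) :
  ptime f -> ptime g -> ptime (fun a => f a %% g a).
Proof.
move=> pf pg.
apply: (@ptime_natrec_add _ _ _ _ f (fun=> 0)
   (fun a _ b => if b.+1 == g a then 0 else b.+1)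
          (fun a j => j %% g a) (fun=> 2)) => //.
- exact: ptime_const.
- have pb : ptime (fun p : A * nat * nat => p.2.+1).
    by apply: ptime_succ; apply: ptime_snd ptime_id.
  apply: ptime_if => //; last exact: ptime_const.
  apply: ptime_eqn => //.
  by apply: (ptime_comp pg); apply: ptime_fst (ptime_fst ptime_id).
- by move=> a; rewrite mod0n.
- move=> a j; case: (posnP (g a)) => [->|gp]; first by rewrite !modn0.
  have := ltn_pmod j gp; rewrite leq_eqVlt => /orP[/eqP E|lt].
    by rewrite E eqxx -addn1 -modnDml addn1 E modnn.
  by rewrite ltn_eqF // -addn1 -modnDml addn1 modn_small.
- exact: pbound_const.
by move=> a j b; case: ifP; rewrite !esize_nat; lia.
Qed.

Lemma esize_cat X (EX : Enc X) (s t : seq X) :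
  esize (s ++ t) < esize s + esize t.
Proof. by elim: s => [|x s IH] //=; rewrite !esize_cons; lia. Qed.

Lemma ptime_cat A X (EA : Enc A) (EX : Enc X)
    (l m : A -> seq X) :
  ptime l -> ptime m -> ptime (fun a => l a ++ m a).
Proof.
move=> pl pm; apply: (ptime_eq (f := fun a => foldr cons (m a) (l a))).
  by move=> a; elim: (l a) => //= x s ->.
apply: (@ptime_foldr_add A X _ EA EX _ l m (fun _ x b => x :: b)
          (fun p => esize p.2 + 1)) => //.
- apply: ptime_cons; last exact: ptime_snd ptime_id.
  exact: ptime_snd (ptime_fst ptime_id).
- apply: pbound_add (pbound_const _ _).
  by have [] := ptime_snd (@ptime_id (A * X) _).
by move=> a x b; rewrite esize_cons /=; lia.
Qed.

Lemma ptime_map A X Y (EA : Enc A) (EX : Enc X) (EY : Enc Y)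
    (f : A -> X -> Y) (l : A -> seq X) :
  ptime (fun p : A * X => f p.1 p.2) -> ptime l ->
  ptime (fun a => [seq f a x | x <- l a]).
Proof.
move=> pf pl.
apply: (ptime_eq (f := fun a => foldr (fun x b => f a x :: b) [::] (l a))).
  by move=> a.
apply: (@ptime_foldr_add A X _ EA EX _ l (fun=> [::]) (fun a x b => f a x :: b)
          (fun p => esize (f p.1 p.2) + 1)) => //.
- exact: ptime_const.
- apply: ptime_cons; last exact: ptime_snd ptime_id.
  exact: (ptime_comp pf (ptime_fst ptime_id)).
- exact: pbound_add pf.1 (pbound_const _ _).
by move=> a x b; rewrite esize_cons /=; lia.
Qed.

Lemma ptime_filter A X (EA : Enc A) (EX : Enc X)
    (c : A -> X -> bool) (l : A -> seq X) :
  ptime (fun p : A * X => c p.1 p.2) -> ptime l ->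
  ptime (fun a => [seq x <- l a | c a x]).
Proof.
move=> pc pl.
apply: (ptime_eq (f := fun a =>
          foldr (fun x b => if c a x then x :: b else b) [::] (l a))).
  by move=> a.
apply: (@ptime_foldr_add A X _ EA EX _ l (fun=> [::])
   (fun a x b => if c a x then x :: b else b) (fun p => esize p.2 + 1)) => //.
- exact: ptime_const.
- apply: ptime_if; first exact: (ptime_comp pc (ptime_fst ptime_id)).
    apply: ptime_cons; last exact: ptime_snd ptime_id.
    exact: ptime_snd (ptime_fst ptime_id).
  exact: ptime_snd ptime_id.
- apply: pbound_add (pbound_const _ _).
  by have [] := ptime_snd (@ptime_id (A * X) _).
by move=> a x b; case: ifP; rewrite ?esize_cons /=; lia.
Qed.

Lemma ptime_all A X (EA : Enc A) (EX : Enc X)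
    (c : A -> X -> bool) (l : A -> seq X) :
  ptime (fun p : A * X => c p.1 p.2) -> ptime l ->
  ptime (fun a => all (c a) (l a)).
Proof.
move=> pc pl.
apply: (ptime_eq (f := fun a => foldr (fun x b => c a x && b) true (l a))).
  by move=> a; elim: (l a) => //= x s ->.
apply: (@ptime_foldr_add A X _ EA EX _ l (fun=> true)
          (fun a x b => c a x && b) (fun p => 3)) => //.
- exact: ptime_const.
- apply: ptime_and; last exact: ptime_snd ptime_id.
  exact: (ptime_comp pc (ptime_fst ptime_id)).
- exact: pbound_const.
by move=> a x b; apply: leq_trans (esize_bool _) (leq_addl _ _).
Qed.

Lemma ptime_size A X (EA : Enc A) (EX : Enc X)
    (l : A -> seq X) : ptime l -> ptime (fun a => size (l a)).
Proof.
move=> pl.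
apply: (ptime_eq (f := fun a => foldr (fun _ => S) 0 (l a))).
  by move=> a; elim: (l a) => //= x s ->.
apply: (@ptime_foldr_add A X _ EA EX _ l (fun=> 0)
          (fun a x b => b.+1) (fun p => 2)) => //.
- exact: ptime_const.
- by apply: ptime_succ; apply: ptime_snd ptime_id.
- exact: pbound_const.
by move=> a x b; rewrite !esize_nat; lia.
Qed.

Lemma ptime_rev A X (EA : Enc A) (EX : Enc X)
    (l : A -> seq X) : ptime l -> ptime (fun a => rev (l a)).
Proof.
move=> pl.
apply: (ptime_eq (f := fun a => foldr (fun x b => b ++ [:: x]) [::] (l a))).
  by move=> a; elim: (l a) => //= x s ->; rewrite rev_cons cats1.
apply: (@ptime_foldr_add A X _ EA EX _ l (fun=> [::])
          (fun a x b => b ++ [:: x]) (fun p => esize p.2 + 1)) => //.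
- exact: ptime_const.
- apply: ptime_cat; first exact: ptime_snd ptime_id.
  apply: ptime_cons; last exact: ptime_const.
  exact: ptime_snd (ptime_fst ptime_id).
- apply: pbound_add (pbound_const _ _).
  by have [] := ptime_snd (@ptime_id (A * X) _).
move=> a x b; have := @esize_cat _ EX b [:: x]; rewrite esize_cons.
have -> : esize ([::] : seq X) = 1 by [].
by rewrite /=; lia.
Qed.

Lemma ptime_flatten A X (EA : Enc A) (EX : Enc X) (l : A -> seq (seq X)) :
  ptime l -> ptime (fun a => flatten (l a)).
Proof.
move=> pl.
apply: (@ptime_foldr_add A (seq X) _ EA _ _ l (fun=> [::])
          (fun a x b => x ++ b) (fun p => esize p.2)) => //.
- exact: ptime_const.
- apply: ptime_cat; last exact: ptime_snd ptime_id.
  exact: ptime_snd (ptime_fst ptime_id).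
- by have [] := ptime_snd (@ptime_id (A * seq X) _).
by move=> a x b /=; have := @esize_cat _ EX x b; lia.
Qed.

Lemma ptime_mem A (EA : Enc A) (f : A -> nat) (l : A -> seq nat) :
  ptime f -> ptime l -> ptime (fun a => f a \in l a).
Proof.
move=> pf pl.
apply: (ptime_eq (f := fun a => ~~ all (fun y => ~~ (f a == y)) (l a))).
  move=> a; rewrite -has_predC -has_pred1; apply: eq_has => y /=.
  by rewrite negbK eq_sym.
apply: ptime_neg; apply: ptime_all => //; apply: ptime_neg; apply: ptime_eqn.
  exact: (ptime_comp pf (ptime_fst ptime_id)).
exact: ptime_snd ptime_id.
Qed.

Lemma ptime_iota A (EA : Enc A) (f g : A -> nat) :
  ptime f -> ptime g -> ptime (fun a => iota (f a) (g a)).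
Proof.
move=> pf pg.
have pfj : ptime (fun p : A * nat => f p.1 + p.2).
  apply: ptime_add; last exact: ptime_snd ptime_id.
  exact: (ptime_comp pf (ptime_fst ptime_id)).
apply: (@ptime_natrec_add _ _ _ _ g (fun=> [::])
   (fun a j b => b ++ [:: f a + j]) (fun a j => iota (f a) j)
   (fun p => esize (f p.1 + p.2) + 1)) => //.
- exact: ptime_const.
- apply: ptime_cat; first exact: ptime_snd ptime_id.
  apply: ptime_cons; last exact: ptime_const.
  exact: (ptime_comp pfj (ptime_fst ptime_id)).
- by move=> a j; rewrite -addn1 iotaD.
- exact: pbound_add pfj.1 (pbound_const _ _).
move=> a j b; have := @esize_cat _ Enc_nat b [:: f a + j]; rewrite esize_cons.
have -> : esize ([::] : seq nat) = 1 by [].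
by rewrite /=; lia.
Qed.

(** An extension point of [ptime_step], redefined once the functions of the algorithm have their own
    lemmas. *)
Ltac ptime_local := fail.

Ltac ptime_step :=
  cbv beta;
  lazymatch goal with
  | |- ptime (fun a => a) => exact: ptime_id
  | |- ptime (fun _ => ?c) => exact: ptime_const
  | |- ptime fst => exact: (ptime_fst ptime_id)
  | |- ptime snd => exact: (ptime_snd ptime_id)
  | |- ptime (fun a => (@?f a).1) => refine (ptime_fst (f := f) _)
  | |- ptime (fun a => (@?f a).2) => refine (ptime_snd (f := f) _)
  | |- ptime (fun a => (@?f a, @?g a)) =>
      refine (ptime_pair (f := f) (g := g) _ _)
  | |- ptime (fun a => @?f a :: @?g a) =>
      refine (ptime_cons (f := f) (l := g) _ _)
  | |- ptime (fun a => @?f a && @?g a) =>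
      refine (ptime_and (c := f) (d := g) _ _)
  | |- ptime (fun a => @?f a || @?g a) =>
      refine (ptime_or (c := f) (d := g) _ _)
  | |- ptime (fun a => @?f a (+) @?g a) =>
      refine (ptime_addb (c := f) (d := g) _ _)
  | |- ptime (fun a => ~~ @?f a) => refine (ptime_neg (c := f) _)
  | |- ptime (fun a => (@?f a).+1) => refine (ptime_succ (f := f) _)
  | |- ptime (fun a => @?f a + @?g a) =>
      refine (ptime_add (f := f) (g := g) _ _)
  | |- ptime (fun a => @?f a * @?g a) =>
      refine (ptime_mul (f := f) (g := g) _ _)
  | |- ptime (fun a => @?f a %% @?g a) =>
      refine (ptime_mod (f := f) (g := g) _ _)
  | |- ptime (fun a => @?f a <= @?g a) =>
      refine (ptime_leq (f := f) (g := g) _ _)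
  | |- ptime (fun a => @eq_op _ (@?f a) (@?g a)) =>
      refine (ptime_eqn (f := f) (g := g) _ _)
  | |- ptime (fun a => @?f a \in @?l a) =>
      refine (ptime_mem (f := f) (l := l) _ _)
  | |- ptime (fun a => iota (@?f a) (@?g a)) =>
      refine (ptime_iota (f := f) (g := g) _ _)
  | |- ptime (fun a => @?l a ++ @?m a) =>
      refine (ptime_cat (l := l) (m := m) _ _)
  | |- ptime (fun a => map (@?f a) (@?l a)) =>
      refine (ptime_map (f := f) (l := l) _ _)
  | |- ptime (fun a => filter (@?f a) (@?l a)) =>
      refine (ptime_filter (c := f) (l := l) _ _)
  | |- ptime (fun a => all (@?f a) (@?l a)) =>
      refine (ptime_all (c := f) (l := l) _ _)
  | |- ptime (fun a => flatten (@?l a)) => refine (ptime_flatten (l := l) _)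
  | |- ptime (fun a => size (@?l a)) => refine (ptime_size (l := l) _)
  | |- ptime (fun a => rev (@?l a)) => refine (ptime_rev (l := l) _)
  | |- ptime (fun a => nilp (@?l a)) => refine (ptime_nilp (l := l) _)
  | |- ptime (fun a => behead (@?l a)) => refine (ptime_behead (l := l) _)
  | _ => first
      [ assumption
      | ptime_local
      | match goal with
        | H : ptime ?f |- ptime (fun p => ?f (@?g p)) =>
            refine (ptime_comp H (f := g) _)
        end
      | simple eapply ptime_if ]
  end.

Ltac ptime_auto := repeat ptime_step.

(** * The algorithm *)

(** Update times are numbered backwards: time 0 is the last update, and time [t]
    updates the vertex [t %% n].  So [win n e t] lists the latest updates of the
    vertices of [e] that happened no later than [t]. *)
Definition win (n : nat) (e : seq nat) (t : nat) : seq nat :=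
  [seq x <- iota t n | x %% n \in e].

Definition incident (n : nat) (Es : seq (seq nat)) (t : nat) : seq (seq nat) :=
  [seq e <- Es | t %% n \in e].

Definition hot (n : nat) (ones : seq nat) (e : seq nat) (t : nat) : bool :=
  all (fun x => x \in ones) (win n e t).

(** One pass through the times in increasing order closes the set, because [win n e m'] contains no
    time below [m']. *)
Fixpoint reach (n : nat) (Es : seq (seq nat)) (ones : seq nat) (v m : nat)
    : seq nat :=
  if m is m'.+1 then
    if m' \in reach n Es ones v m' then
      reach n Es ones v m' ++
      flatten [seq win n e m' | e <- incident n Es m' & hot n ones e m']
    else reach n Es ones v m'
  else [:: v].

(** The bits to be known. Windows that turn out to contain a 0 are included, since that 0 has to be
    seen. *)
Definition needed (n : nat) (Es : seq (seq nat)) (A : seq nat) : seq nat :=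
  flatten [seq t :: flatten [seq win n e t | e <- incident n Es t] | t <- A].

Definition ones_of (rho : seq (nat * bool)) : seq nat :=
  [seq p.1 | p <- rho & p.2].

Definition pending (n : nat) (Es : seq (seq nat)) (v N : nat)
    (rho : seq (nat * bool)) : seq nat :=
  [seq x <- needed n Es (reach n Es (ones_of rho) v N)
  | (x < N) && (x \notin [seq p.1 | p <- rho])].

(** A finished branch is duplicated, so that all entries of a level have the
    same weight. *)
Definition branch (n : nat) (Es : seq (seq nat)) (v N : nat)
    (rho : seq (nat * bool)) : seq (seq (nat * bool)) :=
  if pending n Es v N rho is x :: _
  then [:: (x, false) :: rho; (x, true) :: rho] else [:: rho; rho].

Fixpoint level (n : nat) (Es : seq (seq nat)) (v N K : nat)
    : seq (seq (nat * bool)) :=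
  if K is K'.+1 then
    flatten [seq branch n Es v N rho | rho <- level n Es v N K']
  else [:: [::]].

Definition glauber (n : nat) (Es : seq (seq nat)) (ones : seq nat) (t : nat)
    (S : seq nat) : seq nat :=
  if (t \in ones) &&
     all (fun e => ~~ all (fun u => (u == t %% n) || (u \in S)) e)
       (incident n Es t)
  then t %% n :: S else [seq u <- S | u != t %% n].

(** [foldr] makes the oldest update, time [N - 1], the innermost one. *)
Definition scan (n : nat) (Es : seq (seq nat)) (ones : seq nat) (N : nat)
    : seq nat :=
  foldr (glauber n Es ones) [::] (iota 0 N).

(** Unfinished branches are not counted as vacant, so the estimate of the vacancy probability errs
    only downwards. *)
Definition vacant_leaf (n : nat) (Es : seq (seq nat)) (v N : nat)
    (rho : seq (nat * bool)) : bool :=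
  nilp (pending n Es v N rho) && (v \notin scan n Es (ones_of rho) N).

Definition vacant_count (n : nat) (Es : seq (seq nat)) (v N K : nat) : nat :=
  size [seq rho <- level n Es v N K | vacant_leaf n Es v N rho].

(** A pair [(l, 2 ^ l)] with [m < 2 ^ l <= 2 m + 1]. *)
Fixpoint lgp (m : nat) : nat * nat :=
  if m is m'.+1 then
    if (lgp m').2 <= m'.+1 then ((lgp m').1.+1, (lgp m').2 + (lgp m').2)
    else lgp m'
  else (0, 1).

Definition lg (m : nat) : nat := (lgp m).1.

Lemma lgpP m : [/\ (lgp m).2 = 2 ^ (lgp m).1, m < (lgp m).2
                 & (lgp m).2 <= m.*2.+1].
Proof.
elim: m => // m [E lt le] /=; case: ifP => [le'|] /=; last by split; lia.
by split; [rewrite expnS -E mul2n addnn | lia | lia].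
Qed.

(** A full adder; the state holds the digits of the second summand still to come, the carry and the
    output in reverse. *)
Definition badd_step (x : bool) (st : seq bool * (bool * seq bool)) :
    seq bool * (bool * seq bool) :=
  (behead st.1,
    ((x && head false st.1) || (st.2.1 && (x || head false st.1)),
     (x (+) head false st.1 (+) st.2.1) :: st.2.2)).

(** Little-endian addition; the digits of [ys] beyond the length of [xs] are
    dropped. *)
Definition badd (xs ys : seq bool) : seq bool :=
  let st := foldr badd_step (ys, (false, [::])) (rev xs) in
  rev (st.2.1 :: st.2.2).

(** Repeated addition is affordable because the factors are unary numbers. The zero has as many
    digits as [x], so that [badd] never drops a digit of [x]. *)
Fixpoint bmul (m : nat) (x : seq bool) : seq bool :=
  if m is m'.+1 then badd (bmul m' x) x else [seq false | _ <- x].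

Definition avoiding (i : nat) (Es : seq (seq nat)) : seq (seq nat) :=
  [seq e <- Es | all (fun u => i <= u) e].

(** [q] is here the rounded-up $1/\varepsilon$. The tail must fall to order $\varepsilon/n$, which
    takes [lg (16 * (n * q))] blocks, and the bound on the revealed bits is affine in the number of
    blocks. *)
Definition depth (c1 c0 n q : nat) : nat := c1 * lg (16 * (n * q)) + c0.

Definition vacant_counts (c1 c0 : nat) (a : nat * seq (seq nat) * nat) :
  seq nat :=
  [seq vacant_count a.1.1 (avoiding i a.1.2) i
         (a.1.1 * (depth c1 c0 a.1.1 a.2).+2) (depth c1 c0 a.1.1 a.2)
  | i <- iota 0 a.1.1].

(** Each vacancy probability is estimated by a vacant count over $2^K$. The product of the inverses
    has numerator $2^{Kn}$, so no division is performed. *)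
Definition count_fraction (c1 c0 : nat) (a : nat * seq (seq nat) * nat)
    : seq bool * seq bool :=
  ([seq false | _ <- iota 0 (depth c1 c0 a.1.1 a.2 * a.1.1)] ++ [:: true],
   foldr bmul [:: true] (vacant_counts c1 c0 a)).

(** * Running time of the algorithm *)

Lemma esize_filter X (EX : Enc X) (c : pred X) (s : seq X) :
  esize [seq x <- s | c x] <= esize s.
Proof. by elim: s => //= x s IH; case: ifP; rewrite !esize_cons; lia. Qed.

Lemma ptime_head A X (EA : Enc A) (EX : Enc X) (x0 : X) (l : A -> seq X) :
  ptime l -> ptime (fun a => head x0 (l a)).
Proof.
move=> pl; apply: (ptime_eq (f := fun a => if l a is x :: s then
    (fun p : A * (X * seq X) => p.2.1) (a, (x, s)) else x0)).
  by move=> a; case: (l a).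
apply: (ptime_case (f := fun p : A * (X * seq X) => p.2.1)) => //; ptime_auto.
Qed.

Lemma ptime_win A (EA : Enc A) (n : A -> nat) (e : A -> seq nat)
    (t : A -> nat) :
  ptime n -> ptime e -> ptime t -> ptime (fun a => win (n a) (e a) (t a)).
Proof. by move=> pn pe pt; rewrite /win; ptime_auto. Qed.

Lemma ptime_incident A (EA : Enc A) (n : A -> nat) (Es : A -> seq (seq nat))
    (t : A -> nat) :
  ptime n -> ptime Es -> ptime t ->
  ptime (fun a => incident (n a) (Es a) (t a)).
Proof. by move=> pn pe pt; rewrite /incident; ptime_auto. Qed.

Ltac ptime_local ::=
  lazymatch goal with
  | |- ptime (fun a => head ?x0 (@?l a)) => refine (ptime_head x0 (l := l) _)
  | |- ptime (fun a => win (@?n a) (@?e a) (@?t a)) =>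
      refine (ptime_win (n := n) (e := e) (t := t) _ _ _)
  | |- ptime (fun a => incident (@?n a) (@?e a) (@?t a)) =>
      refine (ptime_incident (n := n) (Es := e) (t := t) _ _ _)
  end.

Lemma ptime_reach A (EA : Enc A) (n : A -> nat) (Es : A -> seq (seq nat))
    (ones : A -> seq nat) (v m : A -> nat) :
  ptime n -> ptime Es -> ptime ones -> ptime v -> ptime m ->
  ptime (fun a => reach (n a) (Es a) (ones a) (v a) (m a)).
Proof.
move=> pn pE po pv pm.
have pg : ptime (fun p : A * nat =>
    flatten [seq win (n p.1) e p.2
            | e <- incident (n p.1) (Es p.1) p.2 & hot (n p.1) (ones p.1) e
              p.2]).
  by rewrite /hot; ptime_auto.
apply: (@ptime_natrec_add _ _ _ _ m (fun a => [:: v a]) (fun a j b =>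
    if j \in b then b ++ flatten [seq win (n a) e j
       | e <- incident (n a) (Es a) j & hot (n a) (ones a) e j] else b)
  (fun a j => reach (n a) (Es a) (ones a) (v a) j) _ pm _ _ _ _ pg.1) => //.
- by ptime_auto.
- by rewrite /hot; ptime_auto.
move=> a j b; case: ifP => _ /=; last exact: leq_addr.
by apply: ltnW; apply: esize_cat.
Qed.

Lemma ptime_scan A (EA : Enc A) (n : A -> nat) (Es : A -> seq (seq nat))
    (ones : A -> seq nat) (N : A -> nat) :
  ptime n -> ptime Es -> ptime ones -> ptime N ->
  ptime (fun a => scan (n a) (Es a) (ones a) (N a)).
Proof.
move=> pn pE po pN; rewrite /scan.
have pg : ptime (fun p : A * nat => p.2 %% n p.1) by ptime_auto.
apply: (@ptime_foldr_add _ _ _ _ _ _ (fun a => iota 0 (N a)) (fun=> [::])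
  (fun a => glauber (n a) (Es a) (ones a))
  (fun p => esize (p.2 %% n p.1) + 1)); rewrite ?/glauber; try by ptime_auto.
- exact: pbound_add pg.1 (pbound_const _ _).
move=> a t S /=; case: ifP => _; first by rewrite esize_cons; lia.
by apply: leq_trans (esize_filter _ _ _) (leq_addr _ _).
Qed.

Lemma ptime_pending A (EA : Enc A) (n : A -> nat) (Es : A -> seq (seq nat))
    (v N : A -> nat) (rho : A -> seq (nat * bool)) :
  ptime n -> ptime Es -> ptime v -> ptime N -> ptime rho ->
  ptime (fun a => pending (n a) (Es a) (v a) (N a) (rho a)).
Proof.
move=> pn pE pv pN prho.
have po : ptime (fun a => ones_of (rho a)) by rewrite /ones_of; ptime_auto.
have pr := ptime_reach pn pE po pv pN.
by rewrite /pending /needed; ptime_auto.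
Qed.

Lemma ptime_branch A (EA : Enc A) (n : A -> nat) (Es : A -> seq (seq nat))
    (v N : A -> nat) (rho : A -> seq (nat * bool)) :
  ptime n -> ptime Es -> ptime v -> ptime N -> ptime rho ->
  ptime (fun a => branch (n a) (Es a) (v a) (N a) (rho a)).
Proof.
move=> pn pE pv pN prho; have pp := ptime_pending pn pE pv pN prho.
apply: (ptime_case (f := fun p : A * (nat * seq nat) =>
  [:: (p.2.1, false) :: rho p.1; (p.2.1, true) :: rho p.1]) pp); ptime_auto.
Qed.

Lemma size_branch n Es v N rho : size (branch n Es v N rho) = 2.
Proof. by rewrite /branch; case: pending. Qed.

Lemma size_level n Es v N K : size (level n Es v N K) = 2 ^ K.
Proof.
elim: K => //= K IH; rewrite size_flatten /shape -map_comp expnSr -IH.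
by elim: (level _ _ _ _ _) => //= rho s ->; rewrite size_branch mulSn.
Qed.

Lemma esize_level_mem n Es v N K (rho : seq (nat * bool)) :
  rho \in level n Es v N K -> esize rho <= (K * (N.*2 + 6)).+1.
Proof.
elim: K rho => [|K IH] rho /=; first by rewrite mem_seq1 => /eqP ->.
case/flatten_mapP => rho' /IH le; rewrite /branch.
have cons_le x b : x \in pending n Es v N rho' ->
    esize ((x, b) :: rho') <= (K.+1 * (N.*2 + 6)).+1.
  rewrite mem_filter => /andP[/andP[lt _] _]; rewrite esize_cons.
  apply: leq_ltn_trans (_ : (x.*2.+1 + 3).+1 + (K * (N.*2 + 6)).+1 < _).
    by apply: leq_add le;
      rewrite esize_pair esize_nat ltnS leq_add2l esize_bool.
  by lia.
have le' : esize rho' <= (K.+1 * (N.*2 + 6)).+1 by apply: leq_trans le _; lia.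
case: (pending _ _ _ _ _) cons_le => [|x s] H.
  by rewrite !mem_seq2 => /orP[] /eqP ->.
by rewrite mem_seq2 => /orP[] /eqP ->; apply: H; apply: mem_head.
Qed.

Lemma esize_level n Es v N K :
  esize (level n Es v N K) <= (2 ^ K * (K * (N.*2 + 6)).+2).+1.
Proof.
rewrite -(size_level n Es v N K); apply: esize_seq_le => i lti x0.
by apply: (@esize_level_mem n Es v N K); apply: (@mem_nth (seq (nat * bool))).
Qed.

(** A level doubles at every step, so the polynomial bound on $2^K$ is what keeps it small. *)
Lemma ptime_level A (EA : Enc A) (n : A -> nat) (Es : A -> seq (seq nat))
    (v N K : A -> nat) :
  ptime n -> ptime Es -> ptime v -> ptime N -> ptime K ->
  pbound (fun a => 2 ^ K a) ->
  ptime (fun a => level (n a) (Es a) (v a) (N a) (K a)).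
Proof.
move=> pn pE pv pN pK b2K.
have pb : ptime (fun p : A * nat * seq (seq (nat * bool)) * seq (nat * bool) =>
    branch (n p.1.1.1) (Es p.1.1.1) (v p.1.1.1) (N p.1.1.1) p.2).
  by apply: ptime_branch; ptime_auto.
apply: (@ptime_natrec _ _ _ _ K (fun=> [:: [::]])
  (fun a _ b => flatten [seq branch (n a) (Es a) (v a) (N a) rho | rho <- b])
  (fun a j => level (n a) (Es a) (v a) (N a) j)
  (fun a => 2 ^ K a * (esize (K a) * (esize (N a) + 6) + 2) + 1)) => //.
- by ptime_auto.
- apply: ptime_flatten.
  apply: (ptime_map (f := fun (p : A * nat * seq (seq (nat * bool))) rho =>
    branch (n p.1.1) (Es p.1.1) (v p.1.1) (N p.1.1) rho) pb).
  by ptime_auto.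
- apply: pbound_add (pbound_const _ _); apply: pbound_mul => //.
  apply: pbound_add (pbound_const _ _); apply: pbound_mul pK.1 _.
  exact: pbound_add pN.1 (pbound_const _ _).
move=> a j le; apply: leq_trans (esize_level _ _ _ _ _) _.
rewrite addn1 ltnS; apply: leq_mul; first by rewrite leq_exp2l.
rewrite -addn2 leq_add2r; apply: leq_mul; rewrite !esize_nat; lia.
Qed.

Lemma ptime_vacant_count A (EA : Enc A) (n : A -> nat) (Es : A -> seq (seq nat))
    (v N K : A -> nat) :
  ptime n -> ptime Es -> ptime v -> ptime N -> ptime K ->
  pbound (fun a => 2 ^ K a) ->
  ptime (fun a => vacant_count (n a) (Es a) (v a) (N a) (K a)).
Proof.
move=> pn pE pv pN pK b2K; have pl := ptime_level pn pE pv pN pK b2K.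
have pp : ptime (fun p : A * seq (nat * bool) =>
    pending (n p.1) (Es p.1) (v p.1) (N p.1) p.2).
  by apply: ptime_pending; ptime_auto.
have ps : ptime (fun p : A * seq (nat * bool) =>
    scan (n p.1) (Es p.1) (ones_of p.2) (N p.1)).
  by rewrite /ones_of; apply: ptime_scan; ptime_auto.
rewrite /vacant_count /vacant_leaf; apply: ptime_size.
apply: (ptime_filter (c :=
  fun a rho => nilp (pending (n a) (Es a) (v a) (N a) rho)
  && (v a \notin scan (n a) (Es a) (ones_of rho) (N a))) _ pl).
apply: ptime_and; first exact: ptime_nilp.
by apply: ptime_neg; apply: ptime_mem => //; ptime_auto.
Qed.

Lemma ptime_lg A (EA : Enc A) (f : A -> nat) :
  ptime f -> ptime (fun a => lg (f a)).
Proof.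
move=> pf; apply: ptime_fst.
apply: (@ptime_natrec _ _ _ _ f (fun=> (0, 1))
  (fun a j b => if b.2 <= j.+1 then (b.1.+1, b.2 + b.2) else b)
  (fun a j => lgp j) (fun a => 10 * (esize (f a) + 1))) => //;
    try by ptime_auto.
- apply: pbound_mul (pbound_const _ _) _.
  exact: pbound_add pf.1 (pbound_const _ _).
move=> a j le; case: (lgpP j) => E lt le2.
case: (lgp j) E lt le2 => l p /= E lt le2.
have := ltn_expl l (isT : 1 < 2); rewrite -E => ltl.
by rewrite esize_pair !esize_nat; lia.
Qed.

Lemma esize_bits (s : seq bool) : esize s <= 4 * size s + 1.
Proof.
rewrite mulnC addn1; apply: esize_seq_le => i _ x0; exact: esize_bool.
Qed.

Lemma size_badd xs ys : size (badd xs ys) = (size xs).+1.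
Proof.
rewrite /badd size_rev /= -(size_rev xs); congr S.
by elim: (rev xs) => //= x s ->.
Qed.

Lemma size_bmul m x : size (bmul m x) = size x + m.
Proof.
elim: m => [|m IH] /=; first by rewrite size_map addn0.
by rewrite size_badd IH addnS.
Qed.

Lemma ptime_badd A (EA : Enc A) (f g : A -> seq bool) :
  ptime f -> ptime g -> ptime (fun a => badd (f a) (g a)).
Proof.
move=> pf pg; rewrite /badd.
have ps : ptime (fun a => foldr badd_step (g a, (false, [::])) (rev (f a))).
  apply: (@ptime_foldr_add _ _ _ _ _ _ (fun a => rev (f a))
    (fun a => (g a, (false, [::]))) (fun=> badd_step) (fun=> 10));
    rewrite ?/badd_step; try by ptime_auto.
  - exact: pbound_const.
  move=> a x [ys [c res]] /=; rewrite !esize_pair !esize_cons.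
  have : esize (behead ys) <= esize ys.
    by rewrite -drop1; apply: esize_drop.
  have := @esize_gt0 _ _ c.
  set b1 := (_ || _); set b2 := (_ (+) _).
  have := esize_bool b1; have := esize_bool b2; lia.
apply: ptime_rev; apply: ptime_cons; ptime_auto.
Qed.

Lemma ptime_bmul A (EA : Enc A) (m : A -> nat) (x : A -> seq bool) :
  ptime m -> ptime x -> ptime (fun a => bmul (m a) (x a)).
Proof.
move=> pm px.
apply: (@ptime_natrec _ _ _ _ m (fun a => [seq false | _ <- x a])
  (fun a _ b => badd b (x a)) (fun a j => bmul j (x a))
  (fun a => 4 * (esize (x a) + esize (m a)) + 1)) => //; try by ptime_auto.
- by apply: ptime_badd; ptime_auto.
- apply: pbound_add (pbound_const _ _); apply: pbound_mul (pbound_const _ _) _.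
  exact: pbound_add px.1 pm.1.
move=> a j le; apply: leq_trans (esize_bits _) _.
rewrite leq_add2r leq_mul2l size_bmul esize_nat /=.
by have := @size_le_esize _ Enc_bool (x a); lia.
Qed.

(** Multiplication by [m] appends [m] digits. This wasteful length is still linear in the input,
    because the factors are given in unary. *)
Lemma ptime_bprod A (EA : Enc A) (l : A -> seq nat) :
  ptime l -> ptime (fun a => foldr bmul [:: true] (l a)).
Proof.
move=> pl.
apply: (@ptime_foldr _ _ _ _ _ _ l (fun=> [:: true]) (fun=> bmul)
  (fun a => 4 * (esize (l a) + 1) + 1)) => //; try by ptime_auto.
- by apply: ptime_bmul; ptime_auto.
- apply: pbound_add (pbound_const _ _); apply: pbound_mul (pbound_const _ _) _.
  exact: pbound_add pl.1 (pbound_const _ _).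
move=> a i; apply: leq_trans (esize_bits _) _; rewrite leq_add2r leq_mul2l /=.
apply: leq_trans (_ : esize (drop i (l a)) + 1 <= _); last first.
  by rewrite leq_add2r esize_drop.
elim: (drop i (l a)) => //= m s IH; rewrite size_bmul esize_cons esize_nat; lia.
Qed.

Lemma ptime_count_fraction c1 c0 : ptime (count_fraction c1 c0).
Proof.
have pK : ptime (fun a : nat * seq (seq nat) * nat => depth c1 c0 a.1.1 a.2).
  by apply: ptime_add; ptime_auto; apply: ptime_lg; ptime_auto.
have b2K : pbound (fun a : nat * seq (seq nat) * nat =>
    2 ^ depth c1 c0 a.1.1 a.2).
  (* As [2 ^ lg m] is at most [2 * m + 1], the number of leaves is polynomial, of a degree fixed by
     the constant [c1]. *)
  apply: (@pbound_le _ _ (fun a => (32 * (esize a * esize a) + 1) ^ c1 * 2 ^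
    c0)).
    move=> [[n Es] q] /=; rewrite /depth expnD leq_mul2r; apply/orP; right.
    rewrite mulnC expnM; apply: expn_mono.
    case: (lgpP (16 * (n * q))) => <- _ le; apply: leq_trans le _.
    rewrite -muln2 -addn1 leq_add2r mulnC mulnA leq_mul2l /=.
    by apply: leq_mul; rewrite !esize_pair !esize_nat; lia.
  apply: pbound_mul (pbound_const _ _); apply: pbound_exp.
  apply: pbound_add (pbound_const _ _); apply: pbound_mul (pbound_const _ _) _.
  by apply: pbound_mul; apply: pbound_esize.
have pK' : ptime (fun p : nat * seq (seq nat) * nat * nat =>
    depth c1 c0 p.1.1.1 p.1.2).
  exact: (ptime_comp pK (ptime_fst ptime_id)).
apply: ptime_pair.
  apply: ptime_cat; last by ptime_auto.
  apply: (ptime_map (f := fun _ _ => false)); first by ptime_auto.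
  apply: ptime_iota; first by ptime_auto.
  by apply: ptime_mul => //; ptime_auto.
apply: ptime_bprod; rewrite /vacant_counts.
apply: (ptime_map (f := fun (a : nat * seq (seq nat) * nat) i =>
  vacant_count a.1.1 (avoiding i a.1.2) i
         (a.1.1 * (depth c1 c0 a.1.1 a.2).+2) (depth c1 c0 a.1.1 a.2))).
  apply: ptime_vacant_count => //; try by rewrite ?/avoiding; ptime_auto.
  apply: (pbound_comp b2K).
  by have [] := ptime_fst (@ptime_id (nat * seq (seq nat) * nat * nat) _).
by ptime_auto.
Qed.

(** * Forests of blocks *)

Import Order.TTheory GRing.Theory Num.Theory.

(** Left-child right-sibling encoding of forests whose nodes are blocks: in
    [FNode b l r] the forest [l] is attached to [b], and [r] holds the siblings
    of [b]. *)
Inductive forest (X : Type) : Type :=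
  FNil | FNode of seq X & forest X & forest X.
Arguments FNil {X}.
HB.instance Definition _ (X : Type) := gen_eqMixin (forest X).

Fixpoint fsize (X : Type) (F : forest X) : nat :=
  if F is FNode _ l r then (fsize l + fsize r).+1 else 0.

Fixpoint fnodes (X : Type) (F : forest X) : seq X :=
  if F is FNode b l r then b ++ fnodes l ++ fnodes r else [::].

Section Forests.
Variables (X : eqType) (nbrs : X -> seq X) (D q : nat).

(** Listings of connected sets through [y], newest element first. Counting a set once per listing is
    harmless in a union bound. *)
Fixpoint grow (i : nat) (y : X) : seq (seq X) :=
  if i is i'.+1 then
    flatten [seq [seq z :: b | z <- flatten [seq nbrs x | x <- b]]
            | b <- grow i' y]
  else [:: [:: y]].

Definition blocks (Y : seq X) : seq (seq X) := flatten [seq grow q y | y <- Y].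

(** Elements two steps from a block: what remains after deleting the block and its neighbours is
    entered through them. *)
Definition entries (b : seq X) : seq X :=
  flatten [seq nbrs y | y <- flatten [seq nbrs x | x <- b]].

(** Siblings draw on the same [Y] without recording which roots are used up: the enumeration only
    has to contain the forest that is wanted. *)
Fixpoint forests (h : nat) (Y : seq X) : seq (forest X) :=
  if h is h'.+1 then
    FNil :: flatten [seq flatten [seq [seq FNode b l r | r <- forests h' Y]
                                 | l <- forests h' (entries b)]
                    | b <- blocks Y]
  else [:: FNil].

Hypothesis size_nbrs : forall x, size (nbrs x) <= D.

Lemma size_flatten_le (T U : eqType) (f : T -> seq U) (s : seq T) w :
  (forall x, x \in s -> size (f x) <= w) ->
  size (flatten [seq f x | x <- s]) <= size s * w.
Proof.
elim: s => //= x s IH H; rewrite size_cat mulSn leq_add ?H ?mem_head //.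
by apply: IH => y ys; apply: H; rewrite inE ys orbT.
Qed.

Lemma size_grow_mem i y b : b \in grow i y -> size b = i.+1.
Proof.
elim: i b => [|i IH] b /=; first by rewrite mem_seq1 => /eqP ->.
by case/flatten_mapP => b' /IH sb /mapP[z _ ->] /=; rewrite sb.
Qed.

Lemma size_grow i y : size (grow i y) <= (i * D) ^ i.
Proof.
elim: i => //= i IH; apply: leq_trans (_ : (i * D) ^ i * (i.+1 * D) <= _).
  apply: leq_trans (size_flatten_le (w := i.+1 * D) _) _.
    move=> b /size_grow_mem sb; rewrite size_map -sb.
    by apply: size_flatten_le.
  by rewrite leq_mul2r IH orbT.
rewrite expnSr leq_mul2r; apply/orP; right.
by case: i {IH} => // i; rewrite leq_exp2r // leq_mul2r ltnW // orbT.
Qed.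

Lemma size_blocks_mem Y b : b \in blocks Y -> size b = q.+1.
Proof. by case/flatten_mapP => y _; apply: size_grow_mem. Qed.

Lemma size_blocks Y : size (blocks Y) <= size Y * (q * D) ^ q.
Proof. by apply: size_flatten_le => y _; apply: size_grow. Qed.

Lemma size_entries b : size (entries b) <= size b * D * D.
Proof.
apply: leq_trans (size_flatten_le (w := D) _) _; first by [].
by rewrite leq_mul2r size_flatten_le ?orbT.
Qed.

Lemma forests_sum (R : realFieldType) (x : R) h Y :
  (0 <= x)%R ->
  (4 * x * ((q.+1 * D * D) * (q * D) ^ q)%N%:R <= 1)%R ->
  size Y <= q.+1 * D * D ->
  (\sum_(F <- forests h Y) x ^+ fsize F <= 2)%R.
Proof.
move=> x0 xL; elim: h Y => [|h IH] Y sY /=.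
  by rewrite big_seq1 expr0; lra.
rewrite big_cons /= expr0 big_flatten big_map /=.
set S := (\sum_(F <- forests h Y) x ^+ fsize F)%R.
have S0 : (0 <= S)%R by apply: sumr_ge0 => F _; apply: exprn_ge0.
have S2 : (S <= 2)%R by apply: IH.
have le_b : (\sum_(b <- blocks Y) \sum_(F <- flatten
     [seq [seq FNode b l r | r <- forests h Y] | l <- forests h (entries b)])
     x ^+ fsize F <= \sum_(b <- blocks Y) 4 * x)%R.
  rewrite big_seq [leRHS]big_seq; apply: ler_sum => b bY.
  rewrite big_flatten big_map /=.
  under eq_bigr => l _.
    rewrite big_map /=.
    under eq_bigr => r _ do rewrite exprS exprD mulrA.
    rewrite -mulr_sumr -/S.
    over.
  rewrite -mulr_suml -mulr_sumr.
  set S' := (\sum_(F <- _) _)%R.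
  have S'0 : (0 <= S')%R by apply: sumr_ge0 => F _; apply: exprn_ge0.
  have S'2 : (S' <= 2)%R.
    apply: IH; apply: leq_trans (size_entries b) _.
    by rewrite (size_blocks_mem bY).
  have : (S' * S <= 2 * 2)%R by apply: ler_pM.
  rewrite -mulrA [(4 * x)%R]mulrC => le4; apply: ler_wpM2l => //.
  by apply: le_trans le4 _; lra.
have : (\sum_(b <- blocks Y) 4 * x <= 1)%R.
  rewrite big_const_seq count_predT iter_addr_0 -[leLHS]mulr_natr.
  apply: le_trans xL; apply: ler_wpM2l; first by lra.
  rewrite ler_nat; apply: leq_trans (size_blocks Y) _.
  by rewrite leq_mul2r sY orbT.
by lra.
Qed.

(** * Connectivity and extraction of a forest *)

Variable adj : rel X.
Hypothesis adj_nbrs : forall x y, adj x y -> y \in nbrs x.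

Inductive conn (C : seq X) (x : X) : X -> Prop :=
| conn_refl : x \in C -> conn C x x
| conn_step y z : conn C x y -> z \in C -> adj y z -> conn C x z.

Lemma conn_mem C x z : conn C x z -> z \in C.
Proof. by case. Qed.

Lemma conn_root C x z : conn C x z -> x \in C.
Proof. by elim. Qed.

Definition comp (C : seq X) (y : X) : seq X := [seq z <- C | `[< conn C y z >]].

Lemma mem_comp C y z : (z \in comp C y) = `[< conn C y z >].
Proof.
rewrite mem_filter; case: asboolP => //= /conn_mem; exact.
Qed.

Lemma comp_closed C y z z' :
  z \in comp C y -> z' \in C -> adj z z' -> z' \in comp C y.
Proof.
rewrite !mem_comp => /asboolP cz z'C a; apply/asboolP; exact: conn_step cz _ a.
Qed.

Lemma comp_conn C y z : z \in comp C y -> conn (comp C y) y z.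
Proof.
rewrite mem_comp => /asboolP; elim=> [yC|u z' cu IH zC a].
  by apply: conn_refl; rewrite mem_comp; apply/asboolP; apply: conn_refl.
apply: (conn_step IH _ a); rewrite mem_comp; apply/asboolP.
exact: conn_step cu zC a.
Qed.

Lemma conn_outside C y y' z : conn C y' z -> z \notin comp C y ->
  conn [seq z <- C | z \notin comp C y] y' z.
Proof.
elim=> [yC|u z' cu IH zC a] nz.
  by apply: conn_refl; rewrite mem_filter nz.
apply: (conn_step _ _ a); last by rewrite mem_filter nz.
by apply: IH; apply: contra nz => uK; apply: comp_closed uK zC a.
Qed.

Lemma conn_crossing K y (b : seq X) z : conn K y z -> y \in b -> z \notin b ->
  exists x u, [/\ x \in b, u \in K, u \notin b & adj x u].
Proof.
elim=> [yK -> //|u z' cu IH zK a] yb zb.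
have [ub|nub] := boolP (u \in b); last exact: IH.
by exists u, z'.
Qed.

(** As long as the block has fewer elements than [K], some path inside [K] leaves it, and the first
    element outside can be added. *)
Lemma grow_block K y i : uniq K -> y \in K ->
  (forall z, z \in K -> conn K y z) -> i < size K ->
  exists b, [/\ b \in grow i y, uniq b, {subset b <= K} & y \in b].
Proof.
move=> uK yK cK; elim: i => [|i IH] lt.
  exists [:: y]; split; rewrite ?mem_seq1 //.
  by move=> z; rewrite mem_seq1 => /eqP ->.
have [b [bg ub bK yb]] := IH (ltnW lt).
have [/allP sub|] := boolP (all (fun z => z \in b) K).
  by have := uniq_leq_size uK sub; rewrite (size_grow_mem bg) leqNgt lt.
rewrite -has_predC => /hasP[z zK /= zb].
have [x [u [xb uK' ub' a]]] := conn_crossing (cK z zK) yb zb.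
exists (u :: b); split.
- apply/flatten_mapP; exists b => //; apply/mapP; exists u => //.
  by apply/flatten_mapP; exists x => //; apply: adj_nbrs.
- by rewrite /= ub'.
- by move=> v; rewrite inE => /orP[/eqP -> //|/bK].
by rewrite inE yb orbT.
Qed.

Definition far (b : seq X) (z : X) : bool :=
  (z \notin b) && all (fun x => ~~ adj x z) b.

(** Where the path last turns far, the preceding element is not far yet. It is not in [b] either,
    its successor being far, so it is a neighbour of [b] and the successor is an entry. *)
Lemma conn_far K y b z : conn K y z -> y \in b -> far b z ->
  exists2 y', y' \in entries b & conn [seq z <- K | far b z] y' z.
Proof.
move=> + yb; elim=> [yK|u z' cu IH zK a] fz.
  by move: fz; rewrite /far yb.
have [fu|nfu] := boolP (far b u).
  have [y' ye cy] := IH fu; exists y' => //.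
  by apply: conn_step cy _ a; rewrite mem_filter fz.
exists z'; last by apply: conn_refl; rewrite mem_filter fz.
move: nfu; rewrite negb_and negbK -has_predC => /orP[ub|/hasP[x xb]].
  by case/andP: fz => _ /allP/(_ u ub); rewrite a.
rewrite /= negbK => ax; apply/flatten_mapP; exists u; last exact: adj_nbrs.
by apply/flatten_mapP; exists x => //; apply: adj_nbrs.
Qed.

Lemma size_near K b : uniq K ->
  size [seq z <- K | ~~ far b z] <= size b * D.+1.
Proof.
move=> uK; rewrite mulnS.
apply: (@leq_trans (size (b ++ flatten [seq nbrs x | x <- b]))).
  apply: uniq_leq_size; first exact: filter_uniq.
  move=> z; rewrite mem_filter negb_and negbK -has_predC mem_cat => /andP[+ _].
  case/orP => [-> //|/hasP[x xb /=]]; rewrite negbK => a.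
  by apply/orP; right; apply/flatten_mapP; exists x => //; apply: adj_nbrs.
by rewrite size_cat leq_add2l; apply: size_flatten_le.
Qed.

Section Selection.
Variables (C0 : seq X) (wt : seq X -> nat) (w : nat).
Hypothesis wt_nil : wt [::] = 0.
Hypothesis wt_cat : forall s1 s2, {subset s1 <= C0} -> {subset s2 <= C0} ->
  (forall x y, x \in s1 -> y \in s2 -> ~~ adj x y) ->
  wt s1 + wt s2 <= wt (s1 ++ s2).
Hypothesis wt_block : forall b, uniq b -> {subset b <= C0} -> size b = q.+1 ->
  w <= wt b.

(** What one block is charged: itself with its neighbours, and [q.+1] for each of its at most
    [q.+1 * D * D] entries. *)
Let B := q.+1 * D.+1 + q.+1 * (q.+1 * D * D).

(** The component of the first root either is too small for a block and is dropped at the expense of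
    that root, or contains a block through it. Deleting what is near the block leaves a remainder
    not adjacent to it, so weights add up, and this remainder is covered from [entries b]. The set
    [Z] stays fixed while [Y] shrinks, because siblings are drawn from all of [Z]. The size bound
    [m] doubles as the fuel of [forests]. *)
Lemma forest_selection m C Y Z : size C <= m -> uniq C -> {subset C <= C0} ->
  {subset Y <= Z} -> (forall z, z \in C -> exists2 y, y \in Y & conn C y z) ->
  exists F, [/\ F \in forests m Z, {subset fnodes F <= C},
    w * fsize F <= wt (fnodes F) & size C <= B * fsize F + q.+1 * size Y].
Proof.
elim: m C Y Z => [|m IHm] C Y Z sC uC CC0 YZ cov.
  exists FNil; move: sC; rewrite leqn0 => /nilP ->.
  by split => //; rewrite ?mem_head ?wt_nil ?muln0.
elim: Y C YZ sC uC CC0 cov => [|y Y IHY] C YZ sC uC CC0 cov.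
  case: C sC uC CC0 cov => [|z C] _ _ _ cov.
    by exists FNil; split => //; rewrite ?mem_head ?wt_nil ?muln0.
  by have [] := cov z (mem_head _ _).
have YZ' : {subset Y <= Z} by move=> u uY; apply: YZ; rewrite inE uY orbT.
have [yC|yC] := boolP (y \in C); last first.
  have [|F [FF FC wF le]] := IHY C YZ' sC uC CC0.
    move=> z /cov[u]; rewrite inE => /orP[/eqP -> /conn_root|uY cu].
      by rewrite (negbTE yC).
    by exists u.
  by exists F; split => //=; apply: leq_trans le _;
    rewrite leq_add2l leq_mul2l leqnSn orbT.
pose K := comp C y; pose C2 := [seq z <- C | z \notin K].
have KC : {subset K <= C} by move=> z; rewrite mem_filter => /andP[].
have C2C : {subset C2 <= C} by move=> z; rewrite mem_filter => /andP[].
have yK : y \in K by rewrite mem_comp; apply/asboolP; apply: conn_refl.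
have uK : uniq K by apply: filter_uniq.
have uC2 : uniq C2 by apply: filter_uniq.
have szC : size C = size K + size C2.
  rewrite !size_filter -[LHS](count_predC (fun z => `[< conn C y z >])).
  congr (_ + _); apply: eq_in_count => z zC /=.
  by rewrite mem_comp.
have K0 : 0 < size K by case: (K) yK.
have cov2 z : z \in C2 -> exists2 u, u \in Y & conn C2 u z.
  rewrite mem_filter => /andP[nz zC]; have [u uY cu] := cov z zC.
  move: uY; rewrite inE => /orP[/eqP E|uY]; last first.
    by exists u => //; apply: conn_outside.
  by case/negP: nz; rewrite mem_comp; apply/asboolP; rewrite -E.
have KC2 x z : x \in K -> z \in C2 -> ~~ adj x z.
  move=> xK; rewrite mem_filter => /andP[nz zC]; apply: contra nz => a.
  exact: comp_closed xK zC a.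
have [sK|sK] := leqP (size K) q.
  have [||F [FF FC wF le]] := IHY C2 YZ' _ uC2 _ cov2.
  - by apply: leq_trans sC; rewrite szC leq_addl.
  - by move=> z /C2C/CC0.
  exists F; split => //; first by move=> z /FC/C2C.
  by rewrite szC /= mulnS; lia.
have [b [bg ub bK yb]] := grow_block uK yK (@comp_conn C y) sK.
have sb := size_grow_mem bg.
pose K' := [seq z <- K | far b z].
have K'K : {subset K' <= K} by move=> z; rewrite mem_filter => /andP[].
have szK : size K = size K' + size [seq z <- K | ~~ far b z].
  by rewrite -(count_predC (far b) K) -!size_filter.
have near_le := size_near b uK; rewrite sb in near_le.
have near_gt0 : 0 < size [seq z <- K | ~~ far b z].
  have : y \in [seq z <- K | ~~ far b z].
    by rewrite mem_filter yK /far yb.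
  by case: filter.
have [||||| Fl [FlF FlK wFl lel]] := IHm K' (entries b) (entries b).
- by lia.
- exact: filter_uniq.
- by move=> z /K'K/KC/CC0.
- by [].
- move=> z; rewrite mem_filter => /andP[fz zK].
  exact: conn_far (comp_conn zK) yb fz.
have [|| Fr [FrF FrC wFr ler]] := IHm C2 Y Z _ uC2 _ YZ' cov2.
- by lia.
- by move=> z /C2C/CC0.
exists (FNode b Fl Fr); split.
- rewrite /= inE; apply/orP; right; apply/flatten_mapP; exists b.
    apply/flatten_mapP; exists y => //; apply: YZ; exact: mem_head.
  apply/flatten_mapP; exists Fl => //; apply/mapP; by exists Fr.
- move=> z /=; rewrite !mem_cat => /or3P[/bK/KC|/FlK/K'K/KC|/FrC/C2C] //.
- have subK : {subset b <= C0} by move=> z /bK/KC/CC0.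
  have subl : {subset fnodes Fl <= C0} by move=> z /FlK/K'K/KC/CC0.
  have subr : {subset fnodes Fr <= C0} by move=> z /FrC/C2C/CC0.
  have wb := wt_block ub subK sb.
  have wlr : wt (fnodes Fl) + wt (fnodes Fr) <= wt (fnodes Fl ++ fnodes Fr).
    by apply: wt_cat => // x z /FlK/K'K xK /FrC; apply: KC2.
  have : wt b + wt (fnodes Fl ++ fnodes Fr) <= wt (b ++ fnodes Fl ++ fnodes Fr).
    apply: wt_cat => //.
      by move=> z; rewrite mem_cat => /orP[/subl|/subr].
    move=> x z xb; rewrite mem_cat => /orP[/FlK|/FrC];
      last exact: KC2 (bK _ xb).
    by rewrite mem_filter => /andP[/andP[_ /allP/(_ x xb)]].
  by rewrite /= mulnS mulnDr; lia.
have le_ent : q.+1 * size (entries b) <= q.+1 * (q.+1 * D * D).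
  by rewrite leq_mul2l -sb size_entries orbT.
rewrite szC szK /= mulnS mulnDr mulnS.
by move: lel ler; rewrite {1 3}/B; lia.
Qed.

End Selection.

End Forests.

(** * Tail bound for the exploration *)

Lemma count_mod_iota (n : nat) (P : pred nat) a :
  count (fun x => P (x %% n)) (iota a n) = count P (iota 0 n).
Proof.
elim: a => [|a IH].
  by apply: eq_in_count => x; rewrite mem_iota => /andP[_ lt];
    rewrite modn_small.
case: n IH => // n IH; rewrite -{}IH.
have -> : iota a.+1 n.+1 = iota a.+1 n ++ [:: a + n.+1].
  by rewrite -{1}(addn1 n) iotaD addSnnS.
rewrite count_cat /= addn0 addnC; congr (nat_of_bool (P _) + _).
by rewrite modnDr.
Qed.

Lemma count_mod_iota_mul (n c : nat) (P : pred nat) a :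
  count (fun x => P (x %% n)) (iota a (c * n)) = c * count P (iota 0 n).
Proof.
elim: c a => // c IH a.
by rewrite mulSn iotaD count_cat count_mod_iota IH mulSn.
Qed.

Lemma count_mem_iota (n : nat) (e : seq nat) :
  uniq e -> all (fun u => u < n) e -> count (mem e) (iota 0 n) = size e.
Proof.
move=> ue /allP lt; rewrite -size_filter; apply/perm_size/uniq_perm => //.
  by apply: filter_uniq; apply: iota_uniq.
move=> u; rewrite mem_filter mem_iota /= add0n.
by case: (boolP (u \in e)) => // /lt ->.
Qed.

Lemma modn_window n t x y : t <= x < t + n -> t <= y < t + n ->
  x %% n = y %% n -> x = y.
Proof.
wlog le : x y / x <= y.
  move=> H hx hy E; case/orP: (leq_total x y) => le; first exact: H.
  by apply/esym/H.
move=> hx hy /eqP; rewrite eq_sym eqn_mod_dvd // => /dvdnP[[|m] E]; lia.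
Qed.

Lemma maximal_independent (T : eqType) (conf : rel T) (s : seq T) :
  reflexive conf -> symmetric conf ->
  exists s', [/\ uniq s', {subset s' <= s},
    forall x y, x \in s' -> y \in s' -> x != y -> ~~ conf x y
    & forall x, x \in s -> exists2 y, y \in s' & conf x y].
Proof.
move=> rc sc; elim: s => [|x s [s' [us sub ind dom]]]; first by exists [::].
have [hx|nx] := boolP (has (conf x) s').
  exists s'; split => //; first by move=> y /sub; rewrite inE orbC => ->.
  move=> y; rewrite inE => /orP[/eqP ->|/dom //].
  by case/hasP: hx => z zs cz; exists z.
have /hasPn nx' := nx.
exists (x :: s'); split.
- rewrite /= us andbT; apply: contra nx => xs; apply/hasP.
  by exists x => //; apply: rc.
- move=> y; rewrite !inE => /orP[-> //|/sub ->]; exact: orbT.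
- move=> y z; rewrite !inE => /orP[/eqP ->|ys] /orP[/eqP ->|zs].
  + by rewrite eqxx.
  + by move=> _; apply: nx'.
  + by move=> _; rewrite sc; apply: nx'.
  exact: ind.
move=> y; rewrite inE => /orP[/eqP ->|/dom[z zs cz]].
  by exists x; rewrite ?mem_head ?rc.
by exists z => //; rewrite inE zs orbT.
Qed.

Section Cluster.
Variables (n k Delta : nat) (Es : seq (seq nat)).
Hypothesis n_gt0 : 0 < n.
Hypothesis uniq_Es : uniq Es.
Hypothesis Es_uniq : forall e : seq nat, e \in Es -> uniq e.
Hypothesis Es_size : forall e : seq nat, e \in Es -> size e = k.
Hypothesis Es_lt : forall e : seq nat, e \in Es -> all (fun u => u < n) e.
Hypothesis Es_linear : forall (e f : seq nat) (u w : nat), e \in Es ->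
  f \in Es ->
  u \in e -> w \in e -> u \in f -> w \in f -> u != w -> e = f.
Hypothesis Es_degree : forall u : nat, size [seq e <- Es | u \in e] <= Delta.

Lemma mem_win e t x : (x \in win n e t) = (x %% n \in e) && (t <= x < t + n).
Proof. by rewrite mem_filter mem_iota. Qed.

Lemma win_uniq e t : uniq (win n e t).
Proof. by apply: filter_uniq; apply: iota_uniq. Qed.

Lemma size_times e a c : e \in Es ->
  size [seq x <- iota a (c * n) | x %% n \in e] = c * k.
Proof.
move=> eE; rewrite size_filter (count_mod_iota_mul n c (mem e)).
by rewrite count_mem_iota ?Es_size ?Es_uniq ?Es_lt.
Qed.

Lemma size_win e t : e \in Es -> size (win n e t) = k.
Proof. by move=> eE; have := size_times t 1 eE; rewrite !mul1n. Qed.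

Lemma mem_win_self e t : t %% n \in e -> t \in win n e t.
Proof. by move=> te; rewrite mem_win te leqnn -addn1 leq_add2l. Qed.

(** * Closure and monotonicity of the reached times *)

Section Reach.
Variables (v : nat).
Implicit Types ones : seq nat.

Lemma reach_subS ones m :
  {subset reach n Es ones v m <= reach n Es ones v m.+1}.
Proof. by move=> x xm /=; case: ifP => _ //; rewrite mem_cat xm. Qed.

Lemma reach_sub ones m m' : m <= m' ->
  {subset reach n Es ones v m <= reach n Es ones v m'}.
Proof.
elim: m' => [|m' IH]; first by rewrite leqn0 => /eqP ->.
rewrite leq_eqVlt => /orP[/eqP -> //|/IH sub] x /sub.
exact: reach_subS.
Qed.

Lemma reach_root ones m : v \in reach n Es ones v m.
Proof. by apply: (reach_sub (leq0n m)); rewrite mem_seq1. Qed.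

(** What is added at turn [m] lies at or after [m], so the membership of [x] is settled before its
    own turn. *)
Lemma reach_early ones m (x : nat) : x \in reach n Es ones v m ->
  x < m -> x \in reach n Es ones v x.
Proof.
elim: m => // m IH /=; rewrite ltnS leq_eqVlt => + /orP[/eqP xm|]; last first.
  move=> + lt; case: ifP => [mr|_ /IH]; last exact.
  rewrite mem_cat => /orP[/IH|/flatten_mapP[e _]]; first exact.
  by rewrite mem_win leqNgt lt andbF.
by rewrite xm; have [//|/negP h /h] := boolP (m \in reach n Es ones v m).
Qed.

Lemma reach_closed ones m t e : t \in reach n Es ones v m -> t < m ->
  e \in Es -> t %% n \in e -> hot n ones e t ->
  {subset win n e t <= reach n Es ones v m}.
Proof.
move=> tr lt eE te h x xw; apply: (reach_sub lt) => /=.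
rewrite (reach_early tr lt) mem_cat; apply/orP; right.
by apply/flatten_mapP; exists e => //; rewrite mem_filter h mem_filter te.
Qed.

Lemma reach_ind ones m (P : nat -> Prop) : P v ->
  (forall t e x, t \in reach n Es ones v m -> P t -> t < m -> e \in Es ->
     t %% n \in e -> hot n ones e t -> x \in win n e t -> P x) ->
  forall x, x \in reach n Es ones v m -> P x.
Proof.
move=> Pv Pstep.
suff H : forall j, j <= m -> forall x, x \in reach n Es ones v j -> P x.
  exact: H.
elim=> [|j IH] le x; first by rewrite mem_seq1 => /eqP ->.
rewrite /=; case: ifP => [jr|_]; last exact: IH (ltnW le) x.
rewrite mem_cat => /orP[|/flatten_mapP[e]]; first exact: IH (ltnW le) x.
rewrite mem_filter => /andP[h]; rewrite mem_filter => /andP[te eE] xw.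
apply: (Pstep j e) => //; last exact: IH (ltnW le) j jr.
exact: reach_sub (ltnW le) _ jr.
Qed.

Lemma hot_mono ones ones' e t : {subset ones <= ones'} ->
  hot n ones e t -> hot n ones' e t.
Proof. by move=> sub /allP H; apply/allP => x /H /sub. Qed.

Lemma reach_mono ones ones' m : {subset ones <= ones'} ->
  {subset reach n Es ones v m <= reach n Es ones' v m}.
Proof.
move=> sub; apply: reach_ind; first exact: reach_root.
move=> t e x _ tr lt eE te h; apply: reach_closed => //.
exact: hot_mono h.
Qed.

Lemma mem_needed (A : seq nat) x : reflect
  (exists2 t, t \in A & x = t \/ exists e, [/\ e \in Es, t %% n \in e
     & x \in win n e t]) (x \in needed n Es A).
Proof.
apply: (iffP flatten_mapP) => -[t tA].
  rewrite inE => /orP[/eqP ->|/flatten_mapP[e]]; first by exists t => //; left.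
  rewrite mem_filter => /andP[te eE] xw; exists t => //; right.
  by exists e.
move=> H; exists t => //; case: H => [->|[e [eE te xw]]]; first exact: mem_head.
rewrite inE; apply/orP; right; apply/flatten_mapP; exists e => //.
by rewrite mem_filter te.
Qed.

Lemma needed_mono (A A' : seq nat) : {subset A <= A'} ->
  {subset needed n Es A <= needed n Es A'}.
Proof.
by move=> sub x /mem_needed[t /sub tA H]; apply/mem_needed; exists t.
Qed.

Lemma size_needed (A : seq nat) :
  size (undup (needed n Es A)) <= size (undup A) * (1 + Delta * k).
Proof.
apply: (@leq_trans (size (needed n Es (undup A)))).
  apply: uniq_leq_size (undup_uniq _) _ => x; rewrite mem_undup.
  by apply: needed_mono => t; rewrite mem_undup.
apply: size_flatten_le => t _ /=; rewrite add1n ltnS.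
apply: (@leq_trans (size (incident n Es t) * k)); last first.
  by rewrite leq_mul2r Es_degree orbT.
apply: size_flatten_le => e; rewrite mem_filter => /andP[_ eE].
by rewrite size_win.
Qed.

End Reach.

Implicit Types p : seq nat * nat.

Definition cluster (ones : seq nat) (v N : nat) : seq (seq nat * nat) :=
  [seq p <- [seq (e, t) | e <- Es, t <- iota 0 N]
  | [&& p.2 \in reach n Es ones v N, p.2 %% n \in p.1 & hot n ones p.1 p.2]].

(** Such windows can share many times, which linearity does not control. *)
Definition overlapping p p' : bool :=
  [&& p.1 == p'.1, p.2 < p'.2 + n & p'.2 < p.2 + n].

(** [3 * n] rather than [n]: a selected window stands for all the windows of
    its edge that it overlaps. *)
Definition adjacent p p' : bool :=
  [&& p.1 \in Es, p'.1 \in Es, p'.2 %% n \in p'.1, has (mem p'.1) p.1,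
      p.2 < p'.2 + 3 * n & p'.2 < p.2 + 3 * n].

Definition times_near (e : seq nat) (a c : nat) : seq (seq nat * nat) :=
  [seq (e, s) | s <- [seq s <- iota a (c * n) | s %% n \in e]].

(** A superset of the adjacent pairs: [k] vertices of the edge, [Delta] edges through each, and
    [6 * k] starting times within [3 * n] on either side. Hence $D = 6k^2\Delta$. *)
Definition neighbours p : seq (seq nat * nat) :=
  if p.1 \in Es then
    flatten [seq flatten [seq times_near f (p.2 - 3 * n) 6
                         | f <- [seq f <- Es | u \in f]]
            | u <- p.1]
  else [::].

(** The exploration starts at time [v], below [n], and the representative of a window starting there
    is less than [n] away: hence the range [2 * n]. *)
Definition roots (v : nat) : seq (seq nat * nat) :=
  flatten [seq times_near f 0 2 | f <- [seq f <- Es | v \in f]].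

Definition weight (s : seq (seq nat * nat)) : nat :=
  size (undup (flatten [seq win n p.1 p.2 | p <- s])).

Lemma mem_times_near e a c f s :
  ((f, s) \in times_near e a c) = [&& f == e,
    s %% n \in e & a <= s < a + c * n].
Proof.
apply/mapP/and3P => [[s' + [-> ->]]|[/eqP -> se ss]].
  by rewrite mem_filter mem_iota => /andP[-> ->].
by exists s => //; rewrite mem_filter mem_iota se.
Qed.

Lemma size_times_near e a c : e \in Es -> size (times_near e a c) = c * k.
Proof. by move=> eE; rewrite size_map size_times. Qed.

Lemma size_neighbours p : size (neighbours p) <= 6 * k ^ 2 * Delta.
Proof.
rewrite /neighbours; case: ifP => // pE.
apply: (@leq_trans (size p.1 * (Delta * (6 * k)))); last first.
  by rewrite (Es_size pE); lia.
apply: size_flatten_le => u _.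
apply: (@leq_trans (size [seq f <- Es | u \in f] * (6 * k))); last first.
  by rewrite leq_mul2r Es_degree orbT.
apply: size_flatten_le => f; rewrite mem_filter => /andP[_ fE].
by rewrite size_times_near.
Qed.

Lemma size_roots v : size (roots v) <= 2 * k * Delta.
Proof.
apply: (@leq_trans (size [seq f <- Es | v \in f] * (2 * k))); last first.
  by rewrite mulnC leq_mul2l Es_degree orbT.
apply: size_flatten_le => f; rewrite mem_filter => /andP[_ fE].
by rewrite size_times_near.
Qed.

Lemma adjacent_neighbours p p' : adjacent p p' -> p' \in neighbours p.
Proof.
case: p p' => [e t] [f s] /and5P[/= eE fE sf /hasP[u ue uf]] /andP[lt lt'].
rewrite /neighbours /= eE; apply/flatten_mapP; exists u => //.
apply/flatten_mapP; exists f; first by rewrite mem_filter fE andbT.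
by rewrite mem_times_near eqxx sf /=; clear -lt lt'; lia.
Qed.

Lemma mem_cluster ones v N p : p \in cluster ones v N ->
  [/\ p.1 \in Es, p.2 \in reach n Es ones v N, p.2 %% n \in p.1
    & hot n ones p.1 p.2].
Proof.
rewrite mem_filter => /andP[/and3P[r te h] /allpairsP[[e t] [eE _ E]]].
by move: r te h; rewrite E.
Qed.

Lemma cluster_uniq ones v N : uniq (cluster ones v N).
Proof.
apply: filter_uniq; apply: allpairs_uniq => //; first exact: iota_uniq.
by move=> [e t] [f s].
Qed.

Lemma size_cluster ones v N : size (cluster ones v N) <= size Es * N.
Proof.
rewrite size_filter; apply: leq_trans (count_size _ _) _.
by rewrite size_allpairs size_iota.
Qed.

Section Tail.
Variables (v N : nat).
Hypothesis v_lt : v < n.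

Lemma in_cluster ones e t : {subset ones <= gtn N} ->
  e \in Es -> t \in reach n Es ones v N -> t %% n \in e -> hot n ones e t ->
  (e, t) \in cluster ones v N.
Proof.
move=> lt eE tr te h; rewrite mem_filter /= tr te h /=.
apply/allpairsP; exists (e, t); split => //=; rewrite mem_iota /= add0n.
by apply: lt; apply: (allP h); apply: mem_win_self.
Qed.

Lemma size_reach ones : {subset ones <= gtn N} ->
  size (undup (reach n Es ones v N)) <= 1 + k * size (cluster ones v N).
Proof.
move=> lt.
pose s := v :: flatten [seq win n p.1 p.2 | p <- cluster ones v N].
apply: (@leq_trans (size s)).
  apply: uniq_leq_size (undup_uniq _) _ => x; rewrite mem_undup.
  move: x; apply: reach_ind; first exact: mem_head.
  move=> t e x tr _ _ eE te h xw; rewrite inE; apply/orP; right.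
  by apply/flatten_mapP; exists (e, t) => //; apply: in_cluster.
rewrite /s /= -add1n leq_add2l mulnC; apply: size_flatten_le => p.
by case/mem_cluster => pE _ _ _; rewrite size_win.
Qed.

Lemma win_meet p p' x : x \in win n p.1 p.2 -> x \in win n p'.1 p'.2 ->
  [/\ x %% n \in p.1, x %% n \in p'.1, p.2 < p'.2 + n & p'.2 < p.2 + n].
Proof. by rewrite !mem_win => /andP[-> h] /andP[-> h']; split => //; lia. Qed.

Section Selected.
Variables (ones : seq nat) (C : seq (seq nat * nat)).
Hypothesis ones_lt : {subset ones <= gtn N}.
Hypothesis C_sub : {subset C <= cluster ones v N}.
Hypothesis C_indep : forall p p',
  p \in C -> p' \in C -> p != p' -> ~~ overlapping p p'.
Hypothesis C_dom : forall p, p \in cluster ones v N ->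
  exists2 p', p' \in C & overlapping p p'.

(** A selected window stands for windows of its own edge starting less than [n] before or after it,
    and [2 * n] consecutive times contain [2 * k] updates of that edge. *)
Lemma size_cluster_selected : size (cluster ones v N) <= 2 * k * size C.
Proof.
rewrite mulnC.
apply: (@leq_trans (size (flatten [seq times_near p.1 (p.2 - n) 2 | p <- C]))).
  apply: uniq_leq_size (cluster_uniq _ _ _) _ => -[e t] pc.
  have [_ _ te _] := mem_cluster pc; have [[f s] p'C] := C_dom pc.
  move=> /and3P[/= /eqP E lt lt']; apply/flatten_mapP; exists (f, s) => //=.
  by rewrite mem_times_near -E eqxx te /=; clear -lt lt'; lia.
apply: size_flatten_le => p /C_sub/mem_cluster[pE _ _ _].
by rewrite size_times_near.
Qed.

(** Induction along the exploration, over all cluster elements starting at a reached time, as their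
    representatives may start elsewhere. Successive windows start less than [n] apart and each
    representative is less than [n] from its window, so successive representatives are adjacent. *)
Lemma selected_connected z : z \in C ->
  exists2 y, y \in roots v & conn adjacent C y z.
Proof.
move=> zC; have [zE zr zt zh] := mem_cluster (C_sub zC).
have H : forall t, t \in reach n Es ones v N -> forall e p,
    (e, t) \in cluster ones v N -> p \in C -> overlapping (e, t) p ->
    exists2 y, y \in roots v & conn adjacent C y p.
  apply: reach_ind.
    move=> e [f s] pc pC /and3P[/= /eqP E lt lt']; exists (f, s); last first.
      exact: conn_refl.
    have [eE _ ve _] := mem_cluster pc; have [_ _ sf _] :=
      mem_cluster (C_sub pC).
    rewrite /= in eE ve sf; rewrite modn_small // in ve.
    apply/flatten_mapP; exists e; first by rewrite mem_filter ve.
    by rewrite mem_times_near -E eqxx /= E sf /=; clear -lt lt' v_lt; lia.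
  move=> t e x tr IH lt eE te h xw f [f' s] pc pC ov.
  have tc : (e, t) \in cluster ones v N by apply: in_cluster.
  have [[e' s'] p'C ov'] := C_dom tc.
  have [y yr cy] := IH e (e', s') tc p'C ov'; exists y => //.
  apply: (conn_step cy pC).
  have [/= fE _ xf _] := mem_cluster pc.
  have [/= f'E _ sf' _] := mem_cluster (C_sub pC).
  have [/= e'E _ _ _] := mem_cluster (C_sub p'C).
  case/and3P: ov => /= /eqP Ef l1 l2; case/and3P: ov' => /= /eqP Ee l3 l4.
  move: xw; rewrite mem_win => /andP[xe xt].
  rewrite /adjacent /= e'E f'E sf' /=; apply/and3P; split;
    [|clear -l1 l2 l3 l4 xt; lia|clear -l1 l2 l3 l4 xt; lia].
  by apply/hasP; exists (x %% n); rewrite /= -?Ee -?Ef.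
by apply: (H z.2 zr z.1) => //; rewrite -?surjective_pairing ?C_sub //
  /overlapping eqxx /= andbb -addn1 leq_add2l.
Qed.

(** A common time gives two windows a common vertex and starts less than [n] apart, which is
    adjacency; so families without adjacency cover disjoint times. *)
Lemma weight_cat s1 s2 : {subset s1 <= C} -> {subset s2 <= C} ->
  (forall p p', p \in s1 -> p' \in s2 -> ~~ adjacent p p') ->
  weight s1 + weight s2 <= weight (s1 ++ s2).
Proof.
move=> sub1 sub2 nadj; rewrite /weight map_cat flatten_cat undup_cat size_cat.
rewrite leq_add2r (@eq_in_filter _ _ predT) ?filter_predT // => x.
rewrite mem_undup => /flatten_mapP[p p1 xp];
  apply/negP => /flatten_mapP[p' p2 xp'].
have [pE _ _ _] := mem_cluster (C_sub (sub1 _ p1)).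
have [p'E _ p't _] := mem_cluster (C_sub (sub2 _ p2)).
have [h h' l l'] := win_meet xp xp'.
case/negP: (nadj _ _ p1 p2); rewrite /adjacent pE p'E p't /=.
by apply/and3P; split; [apply/hasP; exists (x %% n)
  | clear -l; lia | clear -l'; lia].
Qed.

(** Two common times would have different residues and give two common vertices; by linearity the
    edges coincide, and then the windows overlap, against the independence of [C]. *)
Lemma size_win_meet p p' : p \in C -> p' \in C -> p != p' ->
  size [seq x <- win n p.1 p.2 | x \in win n p'.1 p'.2] <= 1.
Proof.
move=> pC p'C ne.
have : uniq [seq x <- win n p.1 p.2 | x \in win n p'.1 p'.2].
  by apply: filter_uniq; apply: win_uniq.
have : {subset [seq x <- win n p.1 p.2 | x \in win n p'.1 p'.2]
          <= [pred x | (x \in win n p.1 p.2) && (x \in win n p'.1 p'.2)]}.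
  by move=> x; rewrite mem_filter andbC.
case: filter => [|x [|y s]] // sub /=; rewrite inE negb_or.
case/andP => /andP[xy _] _; exfalso.
have /andP[xp xp'] : (x \in win n p.1 p.2) && (x \in win n p'.1 p'.2).
  by apply: sub; rewrite mem_head.
have /andP[yp yp'] : (y \in win n p.1 p.2) && (y \in win n p'.1 p'.2).
  by apply: sub; rewrite !inE eqxx orbT.
have [xe xe' l l'] := win_meet xp xp'; have [ye ye' _ _] := win_meet yp yp'.
have [pE _ _ _] := mem_cluster (C_sub pC).
have [p'E _ _ _] := mem_cluster (C_sub p'C).
have xy' : x %% n != y %% n.
  apply: contra xy => /eqP E; apply/eqP; move: xp yp; rewrite !mem_win.
  by move=> /andP[_ hx] /andP[_ hy]; exact: modn_window hx hy E.
have E := Es_linear pE p'E xe ye xe' ye' xy'.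
by case/negP: (C_indep pC p'C ne); rewrite /overlapping E eqxx l l'.
Qed.

(** Each window loses at most one time to each other window of the block. *)
Lemma weight_uniq b : uniq b -> {subset b <= C} ->
  size b * (k - size b) <= weight b.
Proof.
(* The loss per window is frozen at a fixed [m], since [size b] changes along the induction. *)
suff H : uniq b -> {subset b <= C} -> forall m, size b <= m ->
    size b * (k - m) <= weight b by move=> ub sub; apply: H.
elim: b => // p b IH /= /andP[pb ub] sub m le.
have pC : p \in C by apply: sub; rewrite mem_head.
have subb : {subset b <= C} by move=> x xb; apply: sub; rewrite inE xb orbT.
have pE : p.1 \in Es by have [] := mem_cluster (C_sub pC).
have {}IH := IH ub subb m (ltnW le).
rewrite /weight /= undup_cat size_cat mulSn; apply: leq_add => //.
rewrite undup_id ?win_uniq //.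
set F := flatten _.
have szp := count_predC (mem F) (win n p.1 p.2); rewrite size_win // in szp.
rewrite size_filter.
suff leF : count (mem F) (win n p.1 p.2) <= m.
  rewrite (_ : count _ _ = count (predC (mem F)) (win n p.1 p.2)) //.
  by rewrite leq_subLR -szp leq_add2r.
apply: leq_trans (ltnW le); rewrite -size_filter -[size b]muln1.
apply: (@leq_trans (size (flatten
   [seq [seq x <- win n p.1 p.2 | x \in win n p'.1 p'.2] | p' <- b]))).
  apply: uniq_leq_size; first by apply: filter_uniq; apply: win_uniq.
  move=> x; rewrite mem_filter => /andP[/flatten_mapP[p' p'b xp'] xp].
  by apply/flatten_mapP; exists p' => //; rewrite mem_filter xp'.
apply: size_flatten_le => p' p'b; apply: size_win_meet => //; first exact: subb.
by apply: contraNneq pb => ->.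
Qed.

End Selected.

(** * Union bound over bit strings *)

Definition ones_of_set (r : {set 'I_N}) : seq nat := [seq val i | i <- enum r].

Lemma ones_of_set_lt r : {subset ones_of_set r <= gtn N}.
Proof. by move=> x /mapP[i _ ->] /=; rewrite inE ltn_ord. Qed.

Lemma mem_ones_of_set (r : {set 'I_N}) (i : 'I_N) :
  (val i \in ones_of_set r) = (i \in r).
Proof. by rewrite (mem_map val_inj) mem_enum. Qed.

Lemma card_supersets (U : seq nat) : uniq U ->
  #|[set r : {set 'I_N} | all (fun x => x \in ones_of_set r) U]| * 2 ^ size U
    <= 2 ^ N.
Proof.
move=> uU; set S := [set r | _].
(* A time of [U] at or beyond [N] has bit 0 in every string, so then no string qualifies. *)
have [/allP ltU|/allPn[x xU nx]] := boolP (all (fun x => x < N) U); last first.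
  rewrite (_ : S = set0) ?cards0 //; apply/setP => r; rewrite !inE.
  apply/negP => /allP/(_ x xU) /ones_of_set_lt; rewrite inE /= => xN.
  by rewrite xN in nx.
pose U' := [set i : 'I_N | val i \in U].
have sU : size U <= #|U'|.
  rewrite cardE -(size_map val); apply: uniq_leq_size => // x xU.
  apply/mapP; exists (Ordinal (ltU x xU)) => //.
  by rewrite mem_enum inE.
have sub : S \subset [set s :|: U' | s in powerset (~: U')].
  apply/fintype.subsetP => r; rewrite inE => /allP H; apply/imsetP.
  exists (r :\: U').
    by rewrite powersetE; apply/fintype.subsetP => i; rewrite !inE => /andP[].
  apply/setP => i; rewrite !inE; case: (boolP (val i \in U)) => iU /=.
    by rewrite -mem_ones_of_set H.
  by rewrite orbF.
have cS : #|S| <= 2 ^ #|~: U'|.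
  apply: leq_trans (subset_leq_card sub) _.
  by apply: leq_trans (leq_imset_card _ _) _; rewrite card_powerset.
apply: (@leq_trans (2 ^ #|~: U'| * 2 ^ #|U'|)).
  by apply: leq_mul => //; rewrite leq_exp2l.
by rewrite -expnD addnC cardsC card_ord.
Qed.

Lemma card_has (T : finType) (I : Type) (P : I -> pred T) (s : seq I) :
  #|[set r | has (fun i => P i r) s]| <= \sum_(i <- s) #|[set r | P i r]|.
Proof.
elim: s => [|i s IH]; first by rewrite big_nil (_ : [set _ | _] = set0) ?cards0.
rewrite big_cons; apply: leq_trans (leq_add (leqnn _) IH).
rewrite (_ :
  [set _ | _] = [set r | P i r] :|: [set r | has (fun i => P i r) s]).
  by rewrite cardsU leq_subr.
by apply/setP => r; rewrite !inE.
Qed.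

Variable q : nat.
Hypothesis k_gt0 : 0 < k.
Hypothesis Delta_gt0 : 0 < Delta.

Let D := 6 * k ^ 2 * Delta.
Let w := q.+1 * (k - q.+1).
Definition block_overhead : nat := q.+1 * D.+1 + q.+1 * (q.+1 * D * D).

(** A composition of bounds, from inside out: selected windows for a forest of [f] blocks, all
    windows of the cluster, reached times, needed times. *)
Definition query_bound (f : nat) : nat :=
  (1 + k * (2 * k * (block_overhead * f + q.+1 * (2 * k * Delta)))) *
  (1 + Delta * k).

Definition forest_times (F : forest (seq nat * nat)) : seq nat :=
  flatten [seq win n p.1 p.2 | p <- fnodes F].

(* Windows of the same edge may share up to [k - 1] times, so the forest is
   built from a maximal family of pairwise non-overlapping ones. *)
Lemma forest_of_reach (ones : seq nat) : {subset ones <= gtn N} ->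
  exists F, [/\ F \in forests neighbours q (size Es * N) (roots v),
    {subset forest_times F <= ones}, w * fsize F <= weight (fnodes F)
    & size (undup (needed n Es (reach n Es ones v N))) <= query_bound (fsize
      F)].
Proof.
move=> lt.
have refl_ov : reflexive overlapping.
  by move=> p; rewrite /overlapping eqxx /= andbb -addn1 leq_add2l.
have sym_ov : symmetric overlapping.
  by move=> p p'; rewrite /overlapping eq_sym; congr (_ && _); rewrite andbC.
have [C [uC subC indC domC]] :=
  maximal_independent (cluster ones v N) refl_ov sym_ov.
have wb b : uniq b -> {subset b <= C} -> size b = q.+1 -> w <= weight b.
  by move=> ub sub sb; have := weight_uniq subC indC ub sub; rewrite sb.
have sC : size C <= size Es * N.
  by apply: leq_trans (uniq_leq_size uC subC) (size_cluster _ _ _).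
have [F [FF FC wF szC]] := forest_selection size_neighbours
    adjacent_neighbours (erefl _) (weight_cat subC) wb sC uC
    (fun z zC => zC) (fun z zr => zr) (fun z zC => selected_connected lt subC
      domC zC).
exists F; split => //.
  move=> x /flatten_mapP[p /FC/subC/mem_cluster[_ _ _ /allP h]]; exact: h.
apply: leq_trans (size_needed _) _; rewrite leq_mul2r; apply/orP; right.
apply: leq_trans (size_reach lt) _; rewrite leq_add2l leq_mul2l; apply/orP;
  right.
apply: leq_trans (size_cluster_selected subC domC) _.
rewrite leq_mul2l; apply/orP; right; apply: leq_trans szC _.
by rewrite leq_add2l leq_mul2l size_roots orbT.
Qed.

Hypothesis block_count :
  8 * ((q.+1 * D * D) * (q * D) ^ q) <= 2 ^ w.

(** More than [query_bound l] needed times force a forest of at least [l] blocks. A forest of [f]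
    blocks has all its bits equal to 1 with probability at most $2^{-wf}$; giving each block the
    doubled weight $x = 2 \cdot 2^{-w}$ extracts the factor $2^{-l}$, and the factor 8 in
    [block_count] is what keeps the sum of the weights below 2. *)
Lemma query_tail (l K : nat) : query_bound l < K ->
  #|[set r : {set 'I_N} |
      K <= size (undup (needed n Es (reach n Es (ones_of_set r) v N)))]| * 2 ^ l
    <= 2 * 2 ^ N.
Proof.
move=> ltK; set S := [set r | _].
pose Fs := forests neighbours q (size Es * N) (roots v).
pose P F (r : {set 'I_N}) := [&& l <= fsize F, w * fsize F <= weight (fnodes F)
  & all (fun x => x \in ones_of_set r) (undup (forest_times F))].
have SP : S \subset [set r | has (fun F => P F r) Fs].
  apply/fintype.subsetP => r; rewrite !inE => leK.
  have [F [FF FU wF sz]] := forest_of_reach (@ones_of_set_lt r).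
  apply/hasP; exists F => //; rewrite /P wF /=; apply/andP; split.
    rewrite leqNgt; apply/negP => ltf.
    have : query_bound (fsize F) <= query_bound l.
      rewrite leq_mul2r; apply/orP; right; rewrite leq_add2l !leq_mul2l.
      by rewrite leq_add2r leq_mul2l (ltnW ltf) !orbT.
    by rewrite leqNgt (leq_trans ltK) // (leq_trans leK).
  by apply/allP => x; rewrite mem_undup => /FU.
have cS : #|S| <= \sum_(F <- Fs) #|[set r | P F r]|.
  exact: leq_trans (subset_leq_card SP) (card_has _ _).
pose x : rat := (2 * 2 ^- w)%R.
have x_ge0 : (0 <= x)%R by rewrite mulr_ge0 // invr_ge0 exprn_ge0.
have w_gt0 : (0 < 2 ^+ w :> rat)%R by apply: exprn_gt0.
have sumx : (\sum_(F <- Fs) x ^+ fsize F <= 2)%R.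
  apply: (forests_sum size_neighbours) => //; last first.
    apply: leq_trans (size_roots v) _; rewrite -/D.
    apply: (@leq_trans D).
      by rewrite /D leq_mul2r; apply/orP; right; rewrite expnS expn1; nia.
    have D0 : 0 < D by rewrite /D !muln_gt0 k_gt0 Delta_gt0.
    by apply: leq_pmull; rewrite muln_gt0 D0.
  have := block_count; rewrite -/D; set L := (q.+1 * D * D * _)%N.
  rewrite -(ler_nat rat) natrM natrX => bc.
  rewrite (_ : (4 * x * L%:R = 8 * L%:R / 2 ^+ w)%R).
    by rewrite ler_pdivrMr // mul1r.
  by rewrite /x; set y : rat := (2 ^- w)%R; ring.
have term F : (#|[set r | P F r]|%:R <= 2 ^+ N * 2 ^- l * x ^+ fsize F)%R.
  have rhs0 : (0 <= 2 ^+ N * 2 ^- l * x ^+ fsize F)%R.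
    by rewrite !mulr_ge0 ?invr_ge0 ?exprn_ge0.
  have [/andP[lf wf]|nP] :=
    boolP ((l <= fsize F) && (w * fsize F <= weight (fnodes F)));
    last first.
    rewrite (_ : [set r | P F r] = set0) ?cards0 //; apply/setP => r.
    by rewrite !inE /P andbA (negbTE nP).
  have cU := card_supersets (undup_uniq (forest_times F)).
  rewrite -/(weight _) in cU.
  have cP : #|[set r | P F r]| * 2 ^ (w * fsize F) <= 2 ^ N.
    apply: leq_trans cU; apply: leq_mul; last by rewrite leq_exp2l.
    by apply: subset_leq_card; apply/fintype.subsetP => r;
      rewrite !inE => /and3P[].
  move: cP; rewrite -(ler_nat rat) natrM !natrX exprM => cP.
  have wf_gt0 : (0 < (2 ^+ w) ^+ fsize F :> rat)%R by apply: exprn_gt0.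
  move: cP; rewrite -ler_pdivlMr // => /le_trans; apply.
  rewrite /x exprMn exprVn -!mulrA; apply: ler_wpM2l; first exact: exprn_ge0.
  rewrite mulrA; apply: ler_peMl; first by rewrite invr_ge0 ltW.
  by rewrite mulrC ler_pdivlMr ?exprn_gt0 // mul1r ler_eXn2l // ltr1n.
rewrite -(ler_nat rat) !natrM !natrX -ler_pdivlMr ?exprn_gt0 //.
apply: (@le_trans _ _ (\sum_(F <- Fs) 2 ^+ N * 2 ^- l * x ^+ fsize F)%R).
  apply: (@le_trans _ _ ((\sum_(F <- Fs) #|[set r | P F r]|)%:R)%R).
    by rewrite ler_nat.
  by rewrite natr_sum; apply: ler_sum => F _; apply: term.
rewrite -mulr_sumr -[leRHS]mulrA [leRHS]mulrC.
by apply: ler_wpM2l sumx; rewrite mulr_ge0 ?invr_ge0 ?exprn_ge0.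
Qed.

End Tail.

End Cluster.

(** * The decision tree *)

Section DecisionTree.
Variables (n : nat) (Es : seq (seq nat)) (v N : nat).
Implicit Types (rho : seq (nat * bool)) (r : {set 'I_N}).

Definition advance (b : nat -> bool) rho : seq (nat * bool) :=
  if pending n Es v N rho is x :: _ then (x, b x) :: rho else rho.

Definition answers r (x : nat) : bool := x \in ones_of_set r.

Definition run r (K : nat) rho : seq (nat * bool) :=
  iter K (advance (answers r)) rho.

Definition agrees r rho : bool := all (fun p => answers r p.1 == p.2) rho.

Definition expand (s : seq (seq (nat * bool))) : seq (seq (nat * bool)) :=
  flatten [seq branch n Es v N rho | rho <- s].

Lemma level_expand K : level n Es v N K = iter K expand [:: [::]].
Proof. by elim: K => //= K ->. Qed.

Lemma iter_expand_cat K s t :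
  iter K expand (s ++ t) = iter K expand s ++ iter K expand t.
Proof. by elim: K => //= K ->; rewrite /expand map_cat flatten_cat. Qed.

Definition toggle (i : 'I_N) r : {set 'I_N} :=
  if i \in r then r :\ i else i |: r.

Lemma mem_toggle i r j : (j \in toggle i r) = (j == i) (+) (j \in r).
Proof.
rewrite /toggle; case: ifP => ir; rewrite !inE.
  by case: eqP => [->|] //=; rewrite ir.
by case: eqP => [->|] //=; rewrite ir.
Qed.

Lemma toggleK i : involutive (toggle i).
Proof. by move=> r; apply/setP => j; rewrite !mem_toggle addbA addbb. Qed.

Lemma answers_ord r (i : 'I_N) : answers r i = (i \in r).
Proof. exact: mem_ones_of_set. Qed.

Lemma answers_toggle (i : 'I_N) r x : x != i :> nat ->
  answers (toggle i r) x = answers r x.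
Proof.
move=> ne; case: (ltnP x N) => [lt|ge].
  rewrite -[x]/(val (Ordinal lt)) !answers_ord mem_toggle.
  by case: eqP => // E; rewrite -E /= eqxx in ne.
have out r' : answers r' x = false.
  by apply/negP => /ones_of_set_lt; rewrite inE /= ltnNge ge.
by rewrite !out.
Qed.

(** Toggling the bit at a listed time exchanges its two answers and, the times being distinct,
    leaves the other answers alone. *)
Lemma card_agrees rho : all (fun p => p.1 < N) rho ->
  uniq [seq p.1 | p <- rho] ->
  #|[set r | agrees r rho]| * 2 ^ size rho = 2 ^ N.
Proof.
elim: rho => [|[x b] rho IH] /=.
  move=> _ _; rewrite muln1 (_ : finset _ = powerset setT).
    by rewrite card_powerset cardsT card_ord.
  by apply/setP => r; rewrite !inE subsetT.
case/andP => xN ltN /andP[xr ur]; rewrite -(IH ltN ur).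
pose i := Ordinal xN.
pose S c := [set r | agrees r ((x, c) :: rho)].
have agt r : agrees (toggle i r) rho = agrees r rho.
  apply: eq_in_all => p pr; rewrite answers_toggle //.
  by apply: contraNneq xr => /= <-; apply: map_f.
have St c r : (toggle i r \in S c) = (r \in S (~~ c)).
  rewrite !inE /agrees /= -/(agrees _ _) -/(agrees r rho) agt.
  rewrite -[x]/(val i) !answers_ord mem_toggle eqxx.
  by case: (i \in r) c => [] [].
have cS c : #|S c| = #|S (~~ c)|.
  rewrite -(card_imset (mem (S c)) (inv_inj (toggleK i))); apply: eq_card => r.
  apply/imsetP/idP => [[r' r'S ->]|rS].
    by rewrite St negbK.
  by exists (toggle i r); rewrite ?toggleK ?St.
have -> : [set r | agrees r rho] = S b :|: S (~~ b).
  apply/setP => r; rewrite !inE /agrees /= -/(agrees r rho) -andb_orl.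
  by case: (answers r x) b {cS St} => [] [].
rewrite cardsU (_ : S b :&: S (~~ b) = set0) ?cards0 ?subn0.
  by rewrite -(cS b) addnn -muln2 expnS mulnA.
apply/setP => r; rewrite !inE /agrees /=; apply/negP => /andP[/andP[/eqP -> _]].
by case/andP => /eqP; case: b {cS St}.
Qed.

Lemma pending_fresh rho x s : pending n Es v N rho = x :: s ->
  (x < N) /\ x \notin [seq p.1 | p <- rho].
Proof.
move=> E; have : x \in pending n Es v N rho by rewrite E mem_head.
by rewrite mem_filter => /andP[/andP[]].
Qed.

(** Each of the $2^j$ entries stands for an equal share of the strings agreeing with [rho]; a
    finished branch asks nothing, and doubling it preserves the shares. *)
Lemma count_run (F : pred (seq (nat * bool))) j rho :
  all (fun p => p.1 < N) rho -> uniq [seq p.1 | p <- rho] ->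
  #|[set r | agrees r rho && F (run r j rho)]| * 2 ^ (j + size rho) =
  count F (iter j expand [:: rho]) * 2 ^ N.
Proof.
elim: j rho => [|j IH] rho lt u.
  rewrite /= addn0; case: (boolP (F rho)) => Fr.
    rewrite mul1n -(card_agrees lt u); congr (#|pred_of_set _| * _).
    by apply/setP => r; rewrite !inE /run /= ?Fr andbT.
  rewrite mul0n (_ : [set _ | _] = set0) ?cards0 //.
  by apply/setP => r; rewrite !inE /run /= ?(negbTE Fr) andbF.
have -> : [set r | agrees r rho && F (run r j.+1 rho)] =
          [set r | agrees r rho && F (run r j (advance (answers r) rho))].
  by apply/setP => r; rewrite !inE /run iterSr.
rewrite iterSr.
have -> : expand [:: rho] = branch n Es v N rho by rewrite /expand /= cats0.
rewrite /branch; case E : (pending n Es v N rho) => [|x s].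
  rewrite (iter_expand_cat j [:: rho]) count_cat mulnDl -!IH // addSn expnS.
  rewrite addnn -muln2 mulnCA [RHS]mulnC; congr (_ * (#|pred_of_set _| * _)).
  by apply/setP => r; rewrite !inE /advance E.
have [xN xr] := pending_fresh E.
rewrite (iter_expand_cat j [:: _]) count_cat mulnDl.
rewrite -!IH /= ?xN ?lt ?xr ?u // -mulnDl addSnnS; congr (_ * _).
pose S b := [set r | agrees r ((x, b) :: rho) && F (run r j ((x, b) :: rho))].
rewrite -/(S true) -/(S false).
have -> : [set r | agrees r rho && F (run r j (advance (answers r) rho))] =
          S false :|: S true.
  apply/setP => r; rewrite !inE /advance E /agrees /= -/(agrees r rho).
  by case: (answers r x); rewrite /= ?orbF.
rewrite cardsU (_ : S false :&: S true = set0) ?cards0 ?subn0 //.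
apply/setP => r; rewrite !inE /agrees /=; apply/negP.
by case/andP => /andP[/andP[/eqP -> _] _].
Qed.

Lemma vacant_count_run K :
  #|[set r | vacant_leaf n Es v N (run r K [::])]| * 2 ^ K =
  vacant_count n Es v N K * 2 ^ N.
Proof.
rewrite /vacant_count size_filter level_expand -count_run // addn0.
by congr (#|pred_of_set _| * _); apply/setP => r; rewrite !inE.
Qed.

Lemma ones_of_agrees r rho : agrees r rho ->
  {subset ones_of rho <= ones_of_set r}.
Proof.
move=> /allP ag x /mapP[[y b]]; rewrite mem_filter => /andP[/= by_ /ag /=].
by rewrite by_ => /eqP a ->.
Qed.

Lemma agrees_mem r rho x : agrees r rho -> x \in [seq p.1 | p <- rho] ->
  (x \in ones_of_set r) = (x \in ones_of rho).
Proof.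
move=> ag xr; apply/idP/idP => [xo|]; last exact: ones_of_agrees.
case/mapP: xr => [[y b] pr E]; move/allP: (ag) => /(_ _ pr) /= /eqP ya.
apply/mapP; exists (y, b) => //; rewrite mem_filter pr andbT /= -ya.
by rewrite /answers -[y]/((y, b).1) -E.
Qed.

(** Questions are asked on the strength of the ones revealed so far. As [reach] is monotone in the
    ones, they are still needed when the whole string is known. *)
Lemma run_invariant r K : let rho := run r K [::] in
  [/\ agrees r rho, uniq [seq p.1 | p <- rho], size rho <= K &
      {subset [seq p.1 | p <- rho]
         <= needed n Es (reach n Es (ones_of_set r) v N)}].
Proof.
elim: K => [|K [ag u sz sub]] //=; rewrite -/(run r K [::]) /advance.
case E : pending => [|x s]; first by split => //; apply: leqW.
have [xN xr] := pending_fresh E; split => //=.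
- by rewrite eqxx.
- by rewrite xr.
move=> y; rewrite inE => /orP[/eqP ->|/sub //].
have : x \in pending n Es v N (run r K [::]) by rewrite E mem_head.
rewrite mem_filter => /andP[_]; apply: needed_mono.
by apply: reach_mono; apply: ones_of_agrees.
Qed.

Lemma unfinished_queries r K : ~~ nilp (pending n Es v N (run r K [::])) ->
  K <= size (undup (needed n Es (reach n Es (ones_of_set r) v N))).
Proof.
move=> np; have [_ u _ sub] := run_invariant r K.
have <- : size (run r K [::]) = K.
  elim: K {u sub} np => //= K IH; rewrite -/(run r K [::]) /advance.
  case E : (pending n Es v N (run r K [::])) => [|x s]; first by rewrite E.
  by move=> _; rewrite /= IH ?E.
rewrite -(size_map fst); apply: uniq_leq_size => // x /sub.
by rewrite mem_undup.
Qed.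

End DecisionTree.

(** * Locality of the dynamics *)

Lemma window_residue n t u : 0 < n -> u < n ->
  exists2 x, t <= x < t + n & x %% n = u.
Proof.
move=> n0 un; exists (t + (u + (n - t %% n)) %% n).
  by rewrite leq_addr ltn_add2l ltn_pmod.
have tn := ltn_pmod t n0.
rewrite modnDmr -(modnDml t) addnCA subnKC ?(ltnW tn) //.
by rewrite modnDr modn_small.
Qed.

Section Chain.
Variables (n : nat) (Es : seq (seq nat)) (v N : nat).
Hypothesis n_gt0 : 0 < n.
Hypothesis v_lt : v < n.
Hypothesis Es_lt : forall e : seq nat, e \in Es -> all (fun u => u < n) e.

Definition state (ones S0 : seq nat) (t : nat) : seq nat :=
  foldr (glauber n Es ones) S0 (iota t (N - t)).

Definition free_at (S : seq nat) (t : nat) : bool :=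
  all (fun e => ~~ all (fun u => (u == t %% n) || (u \in S)) e) (incident n Es
    t).

Lemma mem_glauber ones t S u : (u \in glauber n Es ones t S) =
  if u == t %% n then (t \in ones) && free_at S t else u \in S.
Proof.
rewrite /glauber -/(free_at S t); case: ifP => _; rewrite ?inE ?mem_filter;
  by case: eqP.
Qed.

Lemma stateS ones S0 t : t < N ->
  state ones S0 t = glauber n Es ones t (state ones S0 t.+1).
Proof. by move=> lt; rewrite /state -{1}(subnSK lt). Qed.

(** The next update of this vertex after time [x] is numbered [n] lower, hence below [t], and has
    not happened yet. *)
Lemma state_persist ones S0 t x : t <= x -> x < N -> x < t + n ->
  (x %% n \in state ones S0 t) = (x %% n \in state ones S0 x).
Proof.
move=> le xN; have [m E] : exists m, x = t + m by exists (x - t);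
  rewrite subnKC.
elim: m t E le => [|m IH] t E le lt; first by rewrite E addn0.
have ltx : t < x by lia.
rewrite stateS ?(ltn_trans ltx) // mem_glauber.
rewrite (IH t.+1); [|lia|lia|lia].
case: eqP => // /esym E'; exfalso.
have : t = x by apply: (@modn_window n t) => //; lia.
lia.
Qed.

(** A move within a window advances by less than [n] and, unless it stays, lands on a further time
    with bit 1; so the distance is paid for by the number of ones. *)
Lemma reach_range ones t : t \in reach n Es ones v N ->
  t < n * (size [seq x <- undup ones | x <= t]).+1.
Proof.
move: t; apply: reach_ind => [|t e x _ IH _ _ _ /allP h xw].
  by apply: leq_trans v_lt _; rewrite leq_pmulr.
have xo := h _ xw; move: xw; rewrite mem_win => /andP[_ /andP[le lt]].
move: le; rewrite leq_eqVlt => /orP[/eqP <- //|ltx].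
have : size (x :: [seq y <- undup ones | y <= t]) <=
       size [seq y <- undup ones | y <= x].
  apply: uniq_leq_size.
    rewrite /= filter_uniq ?undup_uniq // mem_filter.
    by rewrite leqNgt ltx.
  move=> y; rewrite inE => /orP[/eqP ->|].
    by rewrite mem_filter leqnn mem_undup.
  by rewrite !mem_filter => /andP[ly ->]; rewrite (leq_trans ly) // ltnW.
move=> /= sz; apply: leq_trans (_ :
  n * (size [seq y <- undup ones | y <= t]).+2 <= _).
  by rewrite mulnS; lia.
by rewrite leq_mul2l ltnS sz orbT.
Qed.

Section Agreement.
Variables (rho : seq (nat * bool)).
Hypothesis rho_closed : nilp (pending n Es v N rho).
Hypothesis rho_small : n * (size rho).+2 <= N.

Let A := reach n Es (ones_of rho) v N.

(** Of the two extra multiples of [n] in [rho_small], one is for the start [v < n] and one for the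
    windows beginning at a reached time. *)
Lemma reach_lt t : t \in A -> t + n < N.
Proof.
move=> tA; apply: leq_trans rho_small; rewrite mulnS addnC ltn_add2l.
apply: leq_trans (reach_range tA) _; rewrite leq_mul2l; apply/orP; right.
rewrite ltnS size_filter; apply: leq_trans (count_size _ _) _.
apply: leq_trans (size_undup _) _; rewrite size_map size_filter.
exact: count_size.
Qed.

Lemma needed_revealed x : x \in needed n Es A -> x \in [seq p.1 | p <- rho].
Proof.
move=> xn; apply/negPn/negP => nx.
have xN : x < N.
  case/mem_needed: (xn) => t /reach_lt lt [->|[e [_ _]]]; first by lia.
  by rewrite mem_win; lia.
have : x \in pending n Es v N rho by rewrite mem_filter xN nx.
by rewrite (nilP rho_closed).
Qed.

Variables (ones1 ones2 S1 S2 : seq nat).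
Hypothesis agree1 : forall x, x \in [seq p.1 | p <- rho] ->
  (x \in ones1) = (x \in ones_of rho).
Hypothesis agree2 : forall x, x \in [seq p.1 | p <- rho] ->
  (x \in ones2) = (x \in ones_of rho).

(** Just before update [t], any other vertex of the edge has the value of its last update, and these
    updates are the later-numbered times of the window. The test on vertices becomes a test on
    times. *)
Lemma all_window ones S0 t e : t < N -> t + n < N -> e \in Es -> t %% n \in e ->
  all (fun u => (u == t %% n) || (u \in state ones S0 t.+1)) e =
  all (fun x => (x == t) || (x %% n \in state ones S0 x)) (win n e t).
Proof.
move=> tN tnN eE te; apply/allP/allP => H y.
  rewrite mem_win => /andP[ye yt]; case: eqP => //= /eqP ney.
  have /orP[/eqP E|] := H _ ye.
    have : y = t by apply: (@modn_window n t) => //; lia.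
    by move/eqP: ney.
  by rewrite (@state_persist ones S0 t.+1 y) //; lia.
move=> ye; have yn : y < n by apply: (allP (Es_lt eE)).
have [x xt E] := window_residue t n_gt0 yn.
have := H x; rewrite mem_win E ye xt => /(_ isT) /orP[/eqP Ex|].
  by rewrite -E Ex eqxx.
case: (eqVneq x t) => [Ex _|ne]; first by rewrite -E Ex eqxx.
rewrite -E => xs; rewrite (@state_persist ones S0 t.+1 x) ?xs ?orbT //; lia.
Qed.

(* Either a window is all ones, and then its times are themselves in [A], or
   it contains a revealed 0, which vacates its vertex in both chains. *)
Lemma closed_agreement t : t \in A ->
  (t %% n \in state ones1 S1 t) = (t %% n \in state ones2 S2 t).
Proof.
have [m] := ubnP (N - t); elim: m t => // m IH t le tA.
have tn := reach_lt tA; have tN : t < N by clear -tn; lia.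
rewrite (stateS ones1 S1 tN) (stateS ones2 S2 tN) !mem_glauber eqxx.
have tneed : t \in needed n Es A by apply/mem_needed; exists t => //; left.
have trho := needed_revealed tneed.
rewrite agree1 // agree2 //; have [to|] := boolP (t \in ones_of rho) => //=.
apply: eq_in_all => e; rewrite mem_filter => /andP[te eE].
rewrite !all_window //; congr (~~ _).
have inneed x : x \in win n e t -> x \in [seq p.1 | p <- rho].
  move=> xw; apply: needed_revealed; apply/mem_needed; exists t => //; right.
  by exists e.
have [h|/allPn[x xw nx]] := boolP (hot n (ones_of rho) e t).
  apply: eq_in_all => x xw; case: eqP => //= ne; apply: IH.
    move: xw; rewrite mem_win => /andP[_ xw]; move/eqP: ne => ne.
    by clear -le xw ne tN; lia.
  exact: reach_closed h _ xw.
have xn := inneed x xw.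
have xt : x == t = false by apply/negbTE; apply: contraNneq nx => ->.
have xN : x < N.
  by move: xw; rewrite mem_win => /andP[_ xt']; clear -xt' tn; lia.
have off ones S0 : x \notin ones ->
    all (fun x => (x == t) || (x %% n \in state ones S0 x)) (win n e t) = false.
  move=> no; apply/negbTE/allPn; exists x => //.
  by rewrite xt /= stateS // mem_glauber eqxx (negbTE no).
by rewrite !off // ?agree1 ?agree2.
Qed.

(** The last update of [v] is at time [v], so the value it produces is the final one. *)
Lemma closed_agreement_root :
  (v \in state ones1 S1 0) = (v \in state ones2 S2 0).
Proof.
have vA : v \in A by apply: reach_root.
have vN : v < N by have ltv := reach_lt vA; clear -ltv; lia.
have vv : v %% n = v by rewrite modn_small.
have := closed_agreement vA.
by rewrite -!(@state_persist _ _ 0 v) // vv.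
Qed.

End Agreement.
End Chain.

(** * Invariance of the uniform distribution *)

Section Invariance.
Variables (n : nat) (Es : seq (seq nat)).
Hypothesis n_gt0 : 0 < n.
Implicit Types S : {set 'I_n}.

Definition indep S : bool :=
  all (fun e => ~~ all (fun u => u \in ones_of_set S) e) Es.

Definition residue (t : nat) : 'I_n := Ordinal (ltn_pmod t n_gt0).

Definition heat_bath (t : nat) (b : bool) S : {set 'I_n} :=
  if b && free_at n Es (ones_of_set S) t then residue t |: S else S :\ residue
    t.

Lemma mem_ones_setU1 S t u : (u \in ones_of_set (residue t |: S)) =
  (u == t %% n) || (u \in ones_of_set S).
Proof.
case: (ltnP u n) => [lt|ge].
  by rewrite -[u]/(val (Ordinal lt)) !mem_ones_of_set !inE.
have out S' : u \in ones_of_set S' = false.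
  by apply/negP => /ones_of_set_lt; rewrite inE /= ltnNge ge.
by rewrite !out orbF; case: eqP => // E; move: ge; rewrite E leqNgt ltn_pmod.
Qed.

Lemma eq_free_at (S S' : seq nat) t : S =i S' ->
  free_at n Es S t = free_at n Es S' t.
Proof.
by move=> E; apply: eq_all => e; congr (~~ _); apply: eq_all => u; rewrite E.
Qed.

Lemma free_at_setU1 S t : free_at n Es (ones_of_set (residue t |: S)) t =
  free_at n Es (ones_of_set S) t.
Proof.
apply: eq_all => e; congr (~~ _); apply: eq_all => u.
by rewrite mem_ones_setU1 orbA orbb.
Qed.

Lemma glauber_heat_bath ones t (s : seq nat) S : s =i ones_of_set S ->
  glauber n Es ones t s =i ones_of_set (heat_bath t (t \in ones) S).
Proof.
move=> E u; rewrite mem_glauber (eq_free_at t E) /heat_bath.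
case: ifP => [/eqP -> |ne]; last first.
  rewrite E; case: ifP => _; first by rewrite mem_ones_setU1 ne.
  case: (ltnP u n) => [lt|ge].
    rewrite -[u]/(val (Ordinal lt)) !mem_ones_of_set !inE.
    by case: eqP => // E'; move: ne; rewrite -[u]/(val (Ordinal lt)) E' eqxx.
  by apply/idP/idP => /ones_of_set_lt; rewrite inE /= ltnNge ge.
case: ifP => _; first by rewrite mem_ones_setU1 eqxx.
by rewrite -[t %% n]/(val (residue t)) mem_ones_of_set !inE eqxx.
Qed.

Lemma indep_setU1 S t : indep S ->
  indep (residue t |: S) = free_at n Es (ones_of_set S) t.
Proof.
move=> iS; apply/allP/allP => H e.
  rewrite mem_filter => /andP[te eE]; apply: contra (H e eE) => /allP a.
  by apply/allP => u /a; rewrite mem_ones_setU1.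
move=> eE; have [te|nte] := boolP (t %% n \in e).
  have := H e; rewrite mem_filter te eE => /(_ isT); apply: contra => /allP a.
  by apply/allP => u /a; rewrite mem_ones_setU1.
apply: contra (allP iS e eE) => /allP a; apply/allP => u ue.
have := a u ue; rewrite mem_ones_setU1 => /orP[/eqP E|//].
by rewrite -E ue in nte.
Qed.

Lemma indep_of_setU1 S t : indep (residue t |: S) -> indep S.
Proof.
move=> /allP H; apply/allP => e eE; apply: contra (H e eE) => /allP a.
by apply/allP => u /a; rewrite mem_ones_setU1 orbC => ->.
Qed.

Lemma sum_indep_split t (g : {set 'I_n} -> nat) :
  \sum_(S : {set 'I_n} | indep S) g S =
  \sum_(S : {set 'I_n} | residue t \notin S)
     (indep S * g S + indep (residue t |: S) * g (residue t |: S)).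
Proof.
rewrite (bigID (fun S => residue t \notin S)) big_split /=; congr (_ + _).
  rewrite [LHS]big_mkcond [RHS]big_mkcond; apply: eq_bigr => S _.
  by case: (indep S); case: (_ \notin S); rewrite ?mul1n.
rewrite (reindex_onto (fun S => residue t |: S) (fun S => S :\ residue t)) /=.
  rewrite [LHS]big_mkcond [RHS]big_mkcond; apply: eq_bigr => S _.
  rewrite setU11 /= andbT.
  have -> : ((residue t |: S) :\ residue t == S) = (residue t \notin S).
    apply/eqP/idP => [<-|nS]; first by rewrite !inE eqxx.
    by rewrite setU1K.
  by case: (indep _); case: (_ \notin S); rewrite ?mul1n.
by move=> S /andP[_]; rewrite negbK => tS; rewrite setD1K.
Qed.

(* Pairing [S] with [residue t |: S]: either both are independent and each is
   hit twice, or only [S] is and it is hit by both bits. *)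
Lemma heat_bath_invariant t (f : {set 'I_n} -> nat) :
  \sum_(S : {set 'I_n} | indep S) (f (heat_bath t true S) + f (heat_bath t
    false S)) =
  2 * \sum_(S : {set 'I_n} | indep S) f S.
Proof.
rewrite !(sum_indep_split t) big_distrr /=; apply: eq_bigr => S nS.
have S0 : S :\ residue t = S.
  apply/setP => i; rewrite !inE; case: eqP => // ->.
  by rewrite (negbTE nS).
rewrite /heat_bath /= setU1K // S0 free_at_setU1 setUA setUid.
have [iS|niS] := boolP (indep S).
  by rewrite (indep_setU1 _ iS); case: (free_at _ _ _ _) => /=; lia.
have -> : indep (residue t |: S) = false.
  by apply/negbTE; apply: contra niS => /indep_of_setU1.
by [].
Qed.

Section Trajectory.
Variable N : nat.
Implicit Types r : {set 'I_N}.

Definition trajectory r S (t : nat) : {set 'I_n} :=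
  foldr (fun x => heat_bath x (answers r x)) S (iota t (N - t)).

Lemma trajectoryS r S t : t < N ->
  trajectory r S t = heat_bath t (answers r t) (trajectory r S t.+1).
Proof. by move=> lt; rewrite /trajectory -{1}(subnSK lt). Qed.

Lemma state_trajectory r S t :
  state n Es N (ones_of_set r) (ones_of_set S) t =i ones_of_set (trajectory r
    S t).
Proof.
rewrite /state /trajectory; elim: (iota _ _) => //= x s IH.
exact: glauber_heat_bath.
Qed.

Lemma trajectory_toggle (i : 'I_N) r S t : i < t ->
  trajectory (toggle i r) S t = trajectory r S t.
Proof.
move=> lt; rewrite /trajectory.
have : all (fun x => i < x) (iota t (N - t)).
  by apply/allP => x; rewrite mem_iota => /andP[/(leq_trans lt)].
elim: (iota _ _) => //= x s IH /andP[ix /IH ->].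
by rewrite answers_toggle // gtn_eqF.
Qed.

(** Peel off the chronologically last update, at time [j]: the trajectory before it does not see bit
    [j], so that bit averages [f] over both outcomes, and invariance removes the update. *)
Lemma sum_trajectory t (f : {set 'I_n} -> nat) : t <= N ->
  \sum_(r : {set 'I_N}) \sum_(S : {set 'I_n} | indep S) f (trajectory r S t) =
  2 ^ N * \sum_(S : {set 'I_n} | indep S) f S.
Proof.
move=> le; rewrite -(subKn le); elim: (N - t) (leq_subr t N) f => [|m IH] mN f.
  rewrite subn0 (eq_bigr (fun=> \sum_(S : {set 'I_n} | indep S) f S)).
    by rewrite sum_nat_const -[#|_|]cardsT -powersetT card_powerset cardsT
      card_ord.
  by move=> r _; apply: eq_bigr => S _; rewrite /trajectory subnn.
have mN' : m <= N by exact: ltnW.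
set j := N - m.+1; have jN : j < N by rewrite /j; lia.
have Ej : j.+1 = N - m by rewrite /j; lia.
pose i := Ordinal jN.
pose X r S := trajectory r S j.+1.
have split_sum : \sum_(r : {set 'I_N}) \sum_(S :
  {set 'I_n} | indep S) f (trajectory r S j) =
   \sum_(r : {set 'I_N}) \sum_(S :
     {set 'I_n} | indep S) f (heat_bath j (~~ answers r j) (X r S)).
  rewrite (reindex_inj (inv_inj (toggleK i))); apply: eq_bigr => r _.
  apply: eq_bigr => S _; rewrite trajectoryS // trajectory_toggle //.
  by rewrite -[j]/(val i) !answers_ord mem_toggle eqxx.
(* Doubling avoids halves: one copy of the sum keeps bit [j], the other has it toggled. *)
apply/eqP; rewrite -(eqn_pmul2l (isT : 0 < 2)) mul2n -addnn {2}split_sum.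
rewrite -big_split /= mulnCA -(heat_bath_invariant j f).
rewrite -(IH mN' (fun S => f (heat_bath j true S) + f (heat_bath j false S)))
  -Ej.
apply/eqP; apply: eq_bigr => r _; rewrite -big_split; apply: eq_bigr => S _ /=.
rewrite trajectoryS // -/(X r S).
by case: (answers r j) => //=; rewrite addnC.
Qed.

End Trajectory.
End Invariance.

(** * Marginals and binary numerals *)

(** The degree is bounded rather than prescribed, so that the conditions pass to every filtered list
    of edges. *)
Record linear_system (n k Delta : nat) (Es : seq (seq nat)) : Prop := {
  ls_uniq : uniq Es;
  ls_edge_uniq : forall e : seq nat, e \in Es -> uniq e;
  ls_size : forall e : seq nat, e \in Es -> size e = k;
  ls_lt : forall e : seq nat, e \in Es -> all (fun u => u < n) e;
  ls_linear : forall (e f : seq nat) (u w : nat), e \in Es -> f \in Es ->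
    u \in e -> w \in e -> u \in f -> w \in f -> u != w -> e = f;
  ls_degree : forall u : nat, size [seq e <- Es | u \in e] <= Delta }.

Lemma linear_system_filter n k Delta Es (c : pred (seq nat)) :
  linear_system n k Delta Es -> linear_system n k Delta [seq e <- Es | c e].
Proof.
case=> u eu sz lt lin deg.
have sub : {subset [seq e <- Es | c e] <= Es}.
  by move=> e; rewrite mem_filter => /andP[].
split; first exact: filter_uniq.
- by move=> e /sub/eu.
- by move=> e /sub/sz.
- by move=> e /sub/lt.
- by move=> e f x y /sub eE /sub fE; apply: lin.
move=> x; apply: leq_trans (deg x); rewrite !size_filter.
rewrite count_filter; apply: sub_count => e /andP[].
by [].
Qed.

Section Marginal.
Variables (n k Delta : nat) (Es : seq (seq nat)) (v q K l : nat).
Hypothesis ls : linear_system n k Delta Es.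
Hypothesis v_lt : v < n.
Hypothesis k_gt0 : 0 < k.
Hypothesis Delta_gt0 : 0 < Delta.
Hypothesis block_count :
  8 * ((q.+1 * (6 * k ^ 2 * Delta) * (6 * k ^ 2 * Delta)) *
       (q * (6 * k ^ 2 * Delta)) ^ q) <= 2 ^ (q.+1 * (k - q.+1)).
Hypothesis K_large : query_bound k Delta q l < K.

Let N := n * K.+2.
Let n_gt0 : 0 < n := leq_ltn_trans (leq0n v) v_lt.

Definition indeps : nat := #|[set S : {set 'I_n} | indep Es S]|.
Definition vacants : nat :=
  #|[set S : {set 'I_n} | indep Es S && (v \notin ones_of_set S)]|.

(** The simulation reads unrevealed bits as 0 and starts from the empty set, while the trajectory
    uses all of [r] and starts from [S]; a closed exploration makes them agree at [v]. *)
Lemma closed_run_vacant (r : {set 'I_N}) (S : {set 'I_n}) :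
  nilp (pending n Es v N (run n Es v r K [::])) ->
  vacant_leaf n Es v N (run n Es v r K [::]) =
  (v \notin ones_of_set (trajectory Es n_gt0 r S 0)).
Proof.
move=> closed; have [ag _ sz _] := run_invariant n Es v r K.
rewrite /vacant_leaf closed /= -(state_trajectory Es n_gt0 r S 0).
have -> : scan n Es (ones_of (run n Es v r K [::])) N =
          state n Es N (ones_of (run n Es v r K [::])) [::] 0.
  by rewrite /state subn0.
have small : n * (size (run n Es v r K [::])).+2 <= N.
  by rewrite leq_mul2l !ltnS sz orbT.
congr (~~ _); exact: (closed_agreement_root n_gt0 v_lt (ls_lt ls) closed small
  [::] (ones_of_set S) (fun x _ => erefl) (fun x => agrees_mem ag)).
Qed.

Let T := #|[set r : {set 'I_N} | vacant_leaf n Es v N (run n Es v r K [::])]|.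
Let U := #|[set r : {set 'I_N} |
            ~~ nilp (pending n Es v N (run n Es v r K [::]))]|.

Lemma unfinished_rare : U * 2 ^ l <= 2 * 2 ^ N.
Proof.
apply: leq_trans (query_tail n_gt0 (ls_uniq ls) (ls_edge_uniq ls) (ls_size ls)
  (ls_lt ls) (ls_linear ls) (ls_degree ls) N v_lt k_gt0 Delta_gt0 block_count
  K_large).
rewrite leq_mul2r; apply/orP; right; apply: subset_leq_card.
apply/fintype.subsetP => r; rewrite !inE; exact: unfinished_queries.
Qed.

Lemma card_sum (X : finType) (c : pred X) : #|[set x | c x]| = \sum_x c x.
Proof. by rewrite -sum1_card big_mkcond; apply: eq_bigr => x _; rewrite inE;
  case: (c x). Qed.

(** Over all strings and all independent starts, stationarity counts exactly [2 ^ N * vacants]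
    vacant outcomes. For each start the finished runs decide the outcome, so only the [U] unfinished
    strings are uncertain. *)
Lemma vacant_bounds : indeps * T <= 2 ^ N * vacants <= indeps * (T + U).
Proof.
have E : \sum_(S : {set 'I_n} | indep Es S)
    \sum_(r : {set 'I_N}) (v \notin ones_of_set (trajectory Es n_gt0 r S 0) :
      nat)
    = 2 ^ N * vacants.
  rewrite exchange_big /=.
  rewrite (sum_trajectory Es n_gt0 (fun S => (v \notin ones_of_set S) : nat)
     (leq0n N)).
  congr (_ * _); rewrite /vacants card_sum big_mkcond; apply: eq_bigr => S _.
  by case: (indep Es S).
have bnd (S : {set 'I_n}) : T <= \sum_(r : {set 'I_N})
    (v \notin ones_of_set (trajectory Es n_gt0 r S 0) : nat) <= T + U.
  rewrite /T /U !card_sum -big_split /=; apply/andP; split.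
    apply: leq_sum => r _; case: (boolP (vacant_leaf _ _ _ _ _)) => // vl.
    by rewrite -(closed_run_vacant S) ?vl //; case/andP: vl.
  apply: leq_sum => r _; have [c|_] := boolP (nilp (pending _ _ _ _ _)).
    by rewrite (closed_run_vacant S c) leq_addr.
  by rewrite addn1; case: (_ \notin _).
have EI m : indeps * m = \sum_(S : {set 'I_n} | indep Es S) m.
  by rewrite sum_nat_const /indeps; congr (_ * _); apply: eq_card => S;
    rewrite !inE.
rewrite -E !EI; apply/andP; split; apply: leq_sum => S _;
  by case/andP: (bnd S).
Qed.

Lemma vacant_count_le : vacant_count n Es v N K * indeps <= 2 ^ K * vacants.
Proof.
have E : T * 2 ^ K = vacant_count n Es v N K * 2 ^ N :=
  vacant_count_run n Es v N K.
case/andP: vacant_bounds => H _.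
rewrite -(leq_pmul2r (expn_gt0 2 N)) mulnAC -E.
by rewrite -mulnA mulnCA -mulnA leq_mul2l mulnC [vacants * _]mulnC H orbT.
Qed.

Lemma vacant_count_ge :
  2 ^ K * vacants * 2 ^ l <= indeps * (vacant_count n Es v N K * 2 ^ l + 2 * 2
    ^ K).
Proof.
have E : T * 2 ^ K = vacant_count n Es v N K * 2 ^ N :=
  vacant_count_run n Es v N K.
case/andP: vacant_bounds => _ H; have H2 := unfinished_rare.
have N0 : 0 < 2 ^ N by rewrite expn_gt0.
rewrite -(leq_pmul2l N0).
apply: (@leq_trans (indeps * (T + U) * (2 ^ K * 2 ^ l))).
  rewrite (_ : 2 ^ N * _ = 2 ^ N * vacants * (2 ^ K * 2 ^ l)); last by lia.
  by rewrite leq_mul2r H orbT.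
rewrite (_ : indeps * (T + U) * _ =
  indeps * (T * 2 ^ K * 2 ^ l + U * 2 ^ l * 2 ^ K)); last by lia.
rewrite E (_ : 2 ^ N * (indeps * _) = indeps *
  (vacant_count n Es v N K * 2 ^ N * 2 ^ l + 2 * 2 ^ N * 2 ^ K)); last by lia.
by rewrite leq_mul2l leq_add2l leq_mul2r H2 !orbT.
Qed.

End Marginal.

(** * Telescoping over the vertices *)

Lemma mem_ones_residue n (n_gt0 : 0 < n) v (S : {set 'I_n}) : v < n ->
  (v \in ones_of_set S) = (residue n_gt0 v \in S).
Proof. by move=> lt; rewrite -mem_ones_of_set /= modn_small. Qed.

Lemma vacants_sum n (n_gt0 : 0 < n) Es v : v < n ->
  vacants n Es v = \sum_(S : {set 'I_n} | residue n_gt0 v \notin S) indep Es S.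
Proof.
move=> lt; rewrite /vacants card_sum [RHS]big_mkcond; apply: eq_bigr => S _.
by rewrite (mem_ones_residue n_gt0 S lt); case: (indep Es S);
  case: (_ \notin S).
Qed.

Lemma indeps_sum n (n_gt0 : 0 < n) Es v :
  indeps n Es = \sum_(S : {set 'I_n} | residue n_gt0 v \notin S)
    (indep Es S + indep Es (residue n_gt0 v |: S)).
Proof.
rewrite /indeps card_sum.
transitivity (\sum_(S : {set 'I_n} | indep Es S) 1).
  by rewrite [RHS]big_mkcond; apply: eq_bigr => S _; case: (indep Es S).
rewrite (sum_indep_split Es n_gt0 v).
by apply: eq_bigr => S _; rewrite !muln1.
Qed.

(** Removing [v] preserves independence, so vacancy has probability at least one half. This turns
    the additive error of the tail into a relative one. *)
Lemma indeps_le_vacants n Es v : v < n -> indeps n Es <= 2 * vacants n Es v.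
Proof.
move=> lt; have n0 : 0 < n := leq_ltn_trans (leq0n v) lt.
rewrite (indeps_sum n0 Es v) (vacants_sum n0) // big_distrr /=.
apply: leq_sum => S _; rewrite mul2n -addnn leq_add2l.
case: (boolP (indep Es (residue n0 v |: S))) => // /indep_of_setU1 ->.
by [].
Qed.

(** While [i] is vacant the edges through it impose nothing, and without them [i] is free: hence the
    factor 2. *)
Lemma indeps_avoidingS n Es i : i < n ->
  indeps n (avoiding i.+1 Es) = 2 * vacants n (avoiding i Es) i.
Proof.
move=> lt; have n0 : 0 < n := leq_ltn_trans (leq0n i) lt.
rewrite (indeps_sum n0 _ i) (vacants_sum n0) // big_distrr /=.
apply: eq_bigr => S nS; rewrite mul2n -addnn.
have E1 : indep (avoiding i.+1 Es) (residue n0 i |: S) = indep (avoiding i.+1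
  Es) S.
  apply: eq_in_all => e; rewrite mem_filter => /andP[/allP ei _]; congr (~~ _).
  apply: eq_in_all => u /ei iu; rewrite mem_ones_setU1 modn_small //.
  by rewrite gtn_eqF.
have E2 : indep (avoiding i.+1 Es) S = indep (avoiding i Es) S.
  apply/allP/allP => H e; rewrite mem_filter => /andP[/allP ei eE]; last first.
    by apply: H; rewrite mem_filter eE andbT; apply/allP => u /ei /ltnW.
  have [ie|nie] := boolP (i \in e).
    by apply/allPn; exists i => //; rewrite (mem_ones_residue n0).
  apply: H; rewrite mem_filter eE andbT; apply/allP => u ue.
  by rewrite ltn_neqAle ei // andbT; apply: contraNneq nie => ->.
by rewrite E1 E2.
Qed.

Lemma avoiding0 Es : avoiding 0 Es = Es.
Proof. by rewrite /avoiding -[RHS]filter_predT; apply: eq_filter => e;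
  apply/allP. Qed.

Lemma indeps_avoiding_order n k Delta Es : linear_system n k Delta Es ->
  0 < k ->
  indeps n (avoiding n Es) = 2 ^ n.
Proof.
move=> ls k0.
have -> : avoiding n Es = [::].
  apply/eqP; rewrite -[_ == _]negbK -has_filter;
    apply/negP => /hasP[e eE /allP h].
  have := ls_size ls eE; case: e eE h => [_ _ k0'|u e eE h _].
    by rewrite -k0' in k0.
  have /andP[un _] := ls_lt ls eE.
  by have := h u (mem_head _ _); rewrite leqNgt un.
rewrite /indeps (_ : [set _ | _] = powerset setT).
  by rewrite card_powerset cardsT card_ord.
by apply/setP => S; rewrite !inE subsetT.
Qed.

(** * Values of binary numerals *)

Fixpoint bits_value (s : seq bool) : nat :=
  if s is b :: s' then b + 2 * bits_value s' else 0.

Lemma nat_of_tree_bits (s : seq bool) : nat_of_tree (enc s) = bits_value s.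
Proof.
elim: s => // b s IH.
have -> : nat_of_tree (enc (b :: s)) =
    (if enc b is Leaf then 0 else 1) + 2 * nat_of_tree (enc s) by [].
by rewrite IH; case: b.
Qed.

Lemma bits_value_cat s t :
  bits_value (s ++ t) = bits_value s + 2 ^ size s * bits_value t.
Proof.
elim: s => [|b s IH] /=; first by rewrite mul1n.
by rewrite IH mulnDr expnS mulnA addnA.
Qed.

Lemma bits_value_false (T : Type) (s : seq T) :
  bits_value [seq false | _ <- s] = 0.
Proof. by elim: s => //= _ s ->. Qed.

(** The loop invariant of addition with carry, [res] being the digits already produced. A longer
    [ys] would lose digits. *)
Lemma badd_foldl xs ys c res : size ys <= size xs ->
  let st := foldl (fun st x => badd_step x st) (ys, (c, res)) xs in
  bits_value (rev (st.2.1 :: st.2.2)) =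
  bits_value (rev res) + 2 ^ size res * (c + bits_value xs + bits_value ys).
Proof.
elim: xs ys c res => [|x xs IH] ys c res /=.
  rewrite leqn0 => /nilP ->.
  by rewrite rev_cons -cats1 bits_value_cat size_rev /= !addn0.
move=> le; rewrite /badd_step /=.
have le' : size (behead ys) <= size xs by case: ys le.
rewrite (IH _ _ _ le') rev_cons -cats1 bits_value_cat size_rev /= expnS.
have -> : bits_value ys = head false ys + 2 * bits_value (behead ys).
  by case: ys {le le'}.
set y := head false ys; set B := bits_value (behead ys).
set X := bits_value xs; set R := bits_value (rev res); set P := 2 ^ size res.
have E : (x (+) y (+) c) + 2 * (x && y || c && (x || y)) = c + x + y.
  by clear; case: x y c => [] [] [].
move: E; set s1 := nat_of_bool (x (+) y (+) c).
set c1 := nat_of_bool (x && y || c && (x || y)) => E.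
rewrite -addnA; congr (_ + _); rewrite [2 * P]mulnC -mulnA -mulnDr.
by congr (P * _); clear -E; lia.
Qed.

Lemma bits_value_badd xs ys : size ys <= size xs ->
  bits_value (badd xs ys) = bits_value xs + bits_value ys.
Proof.
move=> le; rewrite /badd.
have -> st : foldr badd_step st (rev xs) =
             foldl (fun st x => badd_step x st) st xs.
  by rewrite -{2}[xs]revK foldl_rev.
by have /= -> := @badd_foldl xs ys false [::] le; rewrite mul1n.
Qed.

Lemma bits_value_bmul m x : bits_value (bmul m x) = m * bits_value x.
Proof.
elim: m => [|m IH] /=; first by rewrite bits_value_false.
by rewrite bits_value_badd ?IH ?mulSn ?size_bmul ?leq_addr // addnC.
Qed.

Lemma bits_value_bprod l :
  bits_value (foldr bmul [:: true] l) = \prod_(m <- l) m.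
Proof.
elim: l => [|m l IH]; first by rewrite big_nil.
by rewrite big_cons /= bits_value_bmul IH.
Qed.

(** [query_bound] is affine in the number of blocks; the two coefficients given to [depth] are its
    slope and its value at 0 plus one. *)
Lemma depth_gt n k Delta q c :
  query_bound k Delta q (lg (16 * (n * c))) <
  depth (k * (2 * k * block_overhead k Delta q) * (1 + Delta * k))
        (query_bound k Delta q 0).+1 n c.
Proof.
rewrite /depth; set f := lg _; rewrite addnS ltnS /query_bound muln0 add0n.
set B := block_overhead k Delta q; set Q := _ * (2 * k * Delta).
set W := 1 + Delta * k.
rewrite (_ : k * (2 * k * B) * W * f = k * (2 * k * (B * f)) * W); last by lia.
rewrite -mulnDl leq_mul2r; apply/orP; right.
by rewrite addnCA leq_add2l -mulnDr leq_mul2l -mulnDr leqnn orbT.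
Qed.

Lemma lg_gt m : m < 2 ^ lg m.
Proof. by case: (lgpP m) => <-. Qed.

(** * Approximation guarantee *)

From mathcomp Require Import all_classical all_reals all_analysis.

Lemma sqrt_bracket (k : nat) : (0 < k)%N ->
  exists q : nat, (q ^ 2 < k <= q.+1 ^ 2)%N.
Proof.
elim: k => // k IH _; case: k IH => [_|k /(_ isT)[q /andP[lt le]]].
  by exists 0%N.
move: le; rewrite leq_eqVlt => /orP[/eqP E|lt'].
  exists q.+1; rewrite E ltnSn /=; nia.
by exists q; rewrite lt' ltnW.
Qed.

(** The degree condition raised to the power $q+2$ provides the $q+2$ factors $D$; its exponent
    exceeds the one on the right by $k+(q+1)^2$, and $2^{5q}$ with a spare 16 per factor absorbs the
    excess. *)
Lemma block_count_bound (k Delta q : nat) :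
  (q ^ 2 < k <= q.+1 ^ 2)%N -> (100 * k ^ 3 * Delta * 2 ^ (5 * q) <= 2 ^ k)%N ->
  (8 * ((q.+1 * (6 * k ^ 2 * Delta) * (6 * k ^ 2 * Delta)) *
       (q * (6 * k ^ 2 * Delta)) ^ q) <= 2 ^ (q.+1 * (k - q.+1)))%N.
Proof.
move=> /andP[qk kq] H; set D := (6 * k ^ 2 * Delta)%N.
have qk' : (q.+1 <= k)%N by clear -qk; nia.
(* $6k^2\Delta \cdot 16k = 96k^3\Delta$, which fits below $100k^3\Delta$. *)
have HD : (D * (16 * k) * 2 ^ (5 * q) <= 2 ^ k)%N.
  apply: leq_trans H; rewrite leq_mul2r; apply/orP; right.
  rewrite /D (_ : 6 * k ^ 2 * Delta * (16 * k) = 96 * (k ^ 3 * Delta))%N.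
    by rewrite -mulnA leq_mul2r orbT.
  by rewrite (expnS k 2); move: (k ^ 2)%N; clear; lia.
clearbody D.
have Hpow : ((D * (16 * k) * 2 ^ (5 * q)) ^ q.+2 <= 2 ^ (k * q.+2))%N.
  by rewrite (expnM 2 k); apply: expn_mono.
have lhs : (8 * (q.+1 * D * D * (q * D) ^ q) <= 8 * (k ^ q.+2 * D ^ q.+2))%N.
  rewrite leq_mul2l /= expnMn.
  rewrite (_ : q.+1 * D * D * (q ^ q * D ^ q) = (q ^ q * q.+1) * D ^ q.+2)%N.
    rewrite leq_mul2r; apply/orP; right.
    apply: (@leq_trans (k ^ q * k)%N).
      by apply: leq_mul => //; apply: expn_mono; clear -qk'; lia.
    by rewrite -expnSr leq_pexp2l //; clear -qk'; lia.
  rewrite !expnS; move: (q ^ q)%N (D ^ q)%N; clear; lia.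
apply: leq_trans lhs _.
have P0 : (0 < 2 ^ (q.+1 ^ 2 + k))%N by rewrite expn_gt0.
rewrite -(leq_pmul2r P0) -expnD.
have -> : (q.+1 * (k - q.+1) + (q.+1 ^ 2 + k) = k * q.+2)%N.
  by rewrite mulnBr; clear -qk'; nia.
apply: leq_trans Hpow.
have -> : ((D * (16 * k) * 2 ^ (5 * q)) ^ q.+2 =
  (16 ^ q.+2 * (2 ^ (5 * q)) ^ q.+2) * (k ^ q.+2 * D ^ q.+2))%N.
  rewrite !expnMn; move: (D ^ _)%N (16 ^ _)%N (k ^ _)%N ((2 ^ _) ^ _)%N.
  by clear; lia.
rewrite mulnAC leq_mul2r; apply/orP; right.
(* It remains to compare exponents: $3+(q+1)^2+k \le (4+5q)(q+2)$, true as $k \le (q+1)^2$. *)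
rewrite -[8%N]/(2 ^ 3)%N -[16%N]/(2 ^ 4)%N -!expnM -!expnD leq_exp2l //.
by clear -kq; nia.
Qed.

Section Approximation.
Variables (R : realType) (n K l : nat).
Variables (I Z a : nat -> nat).
Hypothesis n_gt0 : (0 < n)%N.
Hypothesis IS : forall i, (i < n)%N -> I i.+1 = (2 * Z i)%N.
Hypothesis In : I n = (2 ^ n)%N.
Hypothesis ZI : forall i, (i < n)%N -> (Z i <= I i <= 2 * Z i)%N.
Hypothesis a_le : forall i, (i < n)%N -> (a i * I i <= 2 ^ K * Z i)%N.
Hypothesis a_ge : forall i, (i < n)%N ->
  (2 ^ K * Z i * 2 ^ l <= I i * (a i * 2 ^ l + 2 * 2 ^ K))%N.

Local Open Scope ring_scope.

Lemma I_gt0 i : (i <= n)%N -> (0 < I i)%N.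
Proof.
move=> le; rewrite -(subKn le); elim: (n - i)%N (leq_subr i n) => [|m IH] mn.
  by rewrite subn0 In expn_gt0.
have mn' : (n - m.+1 < n)%N by lia.
have := IH (ltnW mn); have -> : (n - m = (n - m.+1).+1)%N by lia.
rewrite (IS mn') muln_gt0 /= => Z0.
by case/andP: (ZI mn') => /(leq_trans Z0).
Qed.

Let p i : R := (Z i)%:R / (I i)%:R.
Let b i : R := (a i)%:R / 2 ^+ K.

Lemma telescope_p j : (j <= n)%N ->
  \prod_(0 <= i < j) p i = (I j)%:R / (2 ^+ j * (I 0)%:R).
Proof.
have I0 : (I 0)%:R != 0 :> R by rewrite pnatr_eq0 -lt0n I_gt0.
elim: j => [|j IH] le; first by rewrite big_nil expr0 mul1r divff.
rewrite big_nat_recr //= IH ?(ltnW le) // /p (IS le) natrM.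
have Ij : (I j)%:R != 0 :> R by rewrite pnatr_eq0 -lt0n I_gt0 // ltnW.
have j0 : 2 ^+ j != 0 :> R by rewrite expf_neq0.
rewrite exprS; field; by rewrite Ij I0 j0.
Qed.

(** The additive error $2/2^l$ is at most $4/2^l$ relative to [p i], which is at least one half. *)
Lemma b_bounds i : (i < n)%N ->
  0 <= b i /\ (1 - 4 / 2 ^+ l) * p i <= b i <= p i.
Proof.
move=> lt; have Ii : 0 < (I i)%:R :> R by rewrite ltr0n I_gt0 // ltnW.
have K0 : 0 < 2 ^+ K :> R by apply: exprn_gt0.
have l0 : 0 < 2 ^+ l :> R by apply: exprn_gt0.
split; first by rewrite divr_ge0 // ltW.
have h1 := a_le lt; have h2 := a_ge lt; case/andP: (ZI lt) => _ h3.
move: h1 h2 h3; rewrite -!(ler_nat R) !(natrM, natrD, natrX).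
set A := (a i)%:R; set z := (Z i)%:R; set J := (I i)%:R in Ii *.
set k2 := 2 ^+ K in K0 *; set l2 := 2 ^+ l in l0 *.
rewrite -/J -/z -/A -/k2 -/l2 => h1 h2 h3.
apply/andP; split; last first.
  by rewrite /p /b -/A -/z -/J ler_pdivrMr // mulrAC ler_pdivlMr //
    [leRHS]mulrC.
rewrite /b /p -/A -/z -/J -/k2 -/l2 ler_pdivlMr //.
rewrite (_ : (1 - 4 / l2) * (z / J) * k2 = (l2 - 4) * z * k2 / (l2 * J));
  last first.
  by field; rewrite !lt0r_neq0.
rewrite ler_pdivrMr ?mulr_gt0 //; nra.
Qed.

Lemma bernoulli (x : R) m : 0 <= x <= 1 -> 1 - m%:R * x <= (1 - x) ^+ m.
Proof.
move=> /andP[x0 x1]; elim: m => [|m IH]; first by rewrite mul0r subr0 expr0.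
rewrite exprS; apply: (@le_trans _ _ ((1 - x) * (1 - m%:R * x))).
  rewrite -natr1; have : 0 <= m%:R :> R by []. nra.
by apply: ler_wpM2l => //; lra.
Qed.

(** [b i] never exceeds [p i], so the estimate is at least the count. In the other direction $n$
    relative errors $4/2^l$ add up to at most $\varepsilon/4$, and $1/(1-\varepsilon/4) \le
    1+\varepsilon$. *)
Lemma product_approximation (eps : R) : 0 < eps -> eps < 1 ->
  16 * n%:R <= eps * 2 ^+ l ->
  (1 - eps) * (I 0)%:R <= 2 ^+ (K * n) / (\prod_(0 <= i < n) a i)%N%:R
     <= (1 + eps) * (I 0)%:R.
Proof.
move=> e0 e1 hl.
have I0 : 0 < (I 0)%:R :> R by rewrite ltr0n I_gt0.
have l0 : 0 < 2 ^+ l :> R by apply: exprn_gt0.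
have Ep : \prod_(0 <= i < n) p i = ((I 0)%:R)^-1.
  rewrite telescope_p // In natrX invfM mulrA divff ?mul1r //.
have Eb : \prod_(0 <= i < n) b i = (\prod_(0 <= i < n) a i)%N%:R / 2 ^+ (K * n).
  rewrite big_split /= natr_prod; congr (_ * _).
  by rewrite big_const_nat iter_mulr_1 subn0 exprVn exprM.
set A := \prod_(0 <= i < n) b i in Eb.
pose x : R := 4 / 2 ^+ l.
have x0 : 0 <= x by rewrite divr_ge0 // ltW.
have nx : n%:R * x <= eps / 4.
  by rewrite /x mulrA ler_pdivrMr //; lra.
have n1 : 1 <= n%:R :> R by rewrite ler1n.
have x1 : x <= 1 by nra.
have Ale : A <= ((I 0)%:R)^-1.
  rewrite -Ep /A !big_nat; apply: ler_prod => i /andP[_ lt].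
  by have [-> /andP[_ ->]] := b_bounds lt.
have Age : (1 - eps / 4) / (I 0)%:R <= A.
  apply: (@le_trans _ _ (\prod_(0 <= i < n) ((1 - x) * p i))).
    rewrite big_split /= Ep; apply: ler_wpM2r; first by rewrite invr_ge0 ltW.
    rewrite big_const_nat iter_mulr_1 subn0.
    apply: le_trans (bernoulli n _); last by rewrite x0.
    by lra.
  rewrite /A !big_nat; apply: ler_prod => i /andP[_ lt].
  have [_ /andP[-> _]] := b_bounds lt; rewrite andbT mulr_ge0 //; first by lra.
  by rewrite divr_ge0.
have A0 : 0 < A.
  apply: lt_le_trans Age; rewrite divr_gt0 //; lra.
have -> : 2 ^+ (K * n) / (\prod_(0 <= i < n) a i)%N%:R = A^-1.
  by rewrite Eb invf_div.
apply/andP; split.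
  apply: (@le_trans _ _ (I 0)%:R); first by nra.
  by rewrite -[leLHS]invrK lef_pV2 // posrE invr_gt0.
rewrite -[leRHS]invrK lef_pV2 ?posrE ?invr_gt0 ?mulr_gt0 //; last by lra.
apply: le_trans Age; rewrite invfM ler_pM2r ?invr_gt0 //.
rewrite -[leLHS]mul1r ler_pdivrMr; [nra|lra].
Qed.

End Approximation.

Lemma uniq_map_injective (T U : eqType) (f : T -> U) (s : seq T) :
  uniq (map f s) -> {in s &, injective f}.
Proof.
elim: s => // x s IH /= /andP[nx us] y z; rewrite !inE.
case/orP=> [/eqP ->|ys] /orP[/eqP ->|zs] // E.
- by rewrite E map_f in nx.
- by rewrite -E map_f in nx.
exact: IH.
Qed.

(** * From input lists to edge systems *)

Section HypergraphInput.
Variable (H : hypergraph_input).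
Let n := hg_order H.

Definition edge_lists : seq (seq nat) :=
  [seq [seq nat_of_ord u | u <- e] | e <- hg_list H].

Definition edge_set (e : seq 'I_n) : {set 'I_n} := [set u in e]%SET.

Lemma edge_set_uniq : uniq [seq edge_set e | e <- hg_list H].
Proof. by rewrite (perm_uniq (hg_listP H)) enum_uniq. Qed.

Lemma edge_set_mem e : e \in hg_list H -> edge_set e \in hg_edges H.
Proof.
move=> eH; have : edge_set e \in enum (hg_edges H).
  by rewrite -(perm_mem (hg_listP H)); apply: map_f.
by rewrite mem_enum.
Qed.

(** Vertices may come in any order, but two listings of the same edge would repeat an entry in a
    permutation of [enum]. *)
Lemma edge_set_inj : {in hg_list H &, injective edge_set}.
Proof. exact: uniq_map_injective edge_set_uniq. Qed.

Lemma card_edge_set e : e \in hg_list H -> #|edge_set e| = size e.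
Proof.
move=> eH; rewrite cardsE; apply/card_uniqP.
exact: (allP (hg_list_uniq H)).
Qed.

Lemma linear_system_edges k Delta : uniform_linear_maxdeg k Delta H ->
  linear_system n k Delta edge_lists.
Proof.
case=> unif lin deg.
have ivi : injective (map (@nat_of_ord n)) by apply: inj_map; apply: ord_inj.
split.
- by rewrite map_inj_uniq //; apply: map_uniq edge_set_uniq.
- move=> e /mapP[e' eH ->]; rewrite map_inj_uniq; last exact: ord_inj.
  exact: (allP (hg_list_uniq H)).
- move=> e /mapP[e' eH ->]; rewrite size_map -card_edge_set //.
  by apply: unif; apply: edge_set_mem.
- by move=> e /mapP[e' eH ->]; apply/allP => u /mapP[i _ ->]; apply: ltn_ord.
- move=> e f u w /mapP[e' eH ->] /mapP[f' fH ->] /mapP[i ie ->] /mapP[j je ->].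
  rewrite !(mem_map (@ord_inj n)) => i_f jf ij; congr map.
  apply: edge_set_inj => //; apply/eqP; apply: contraT => ne.
  have := lin _ _ (edge_set_mem eH) (edge_set_mem fH) ne.
  suff : ([set i; j]%SET \subset edge_set e' :&: edge_set f').
    move=> /subset_leq_card le1 le2; have := leq_trans le1 le2.
    by rewrite cards2 (_ : i != j) //; apply: contra ij => /eqP ->.
  apply/fintype.subsetP => x; rewrite !inE.
  by case/orP => /eqP ->; rewrite ?ie ?je ?i_f ?jf.
move=> u; case: (ltnP u n) => [lt|ge]; last first.
  rewrite (_ : [seq _ <- _ | _] = [::]) //; apply/eqP.
  rewrite -[_ == _]negbK -has_filter; apply/negP => /hasP[e /mapP[e' _ ->]].
  by case/mapP => i _ E; move: ge; rewrite E leqNgt ltn_ord.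
rewrite -deg /edge_lists filter_map size_map.
apply: leq_trans (leq_bigmax (Ordinal lt)); rewrite /hdegree cardE.
rewrite -(size_map edge_set); apply: uniq_leq_size.
  apply: (subseq_uniq _ edge_set_uniq); apply: map_subseq; exact: filter_subseq.
move=> x /mapP[e]; rewrite mem_filter /= => /andP[ue eH] ->.
rewrite mem_enum inE edge_set_mem //= inE.
by move: ue; rewrite -[u]/(nat_of_ord (Ordinal lt)) (mem_map (@ord_inj n)).
Qed.

Lemma num_independent_indeps :
  num_independent (hg_edges H) = indeps n edge_lists.
Proof.
rewrite /num_independent /indeps; apply: eq_card => S; rewrite !inE.
have subE e : (all (fun u => u \in ones_of_set S) [seq nat_of_ord u | u <- e])
    = (edge_set e \subset S).
  rewrite all_map; apply/allP/fintype.subsetP => h x.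
    by rewrite inE => /h /=; rewrite (mem_ones_of_set S x).
  by move=> xe /=; rewrite (mem_ones_of_set S x); apply: h; rewrite inE.
apply/forallP/allP => [h e' /mapP[e eH ->]|h x].
  by rewrite subE; apply: (implyP (h (edge_set e))); apply: edge_set_mem.
apply/implyP => xE; have : x \in enum (hg_edges H) by rewrite mem_enum.
rewrite -(perm_mem (hg_listP H)) => /mapP[e eH ->].
by rewrite -/(edge_set e) -subE; apply: h; apply: map_f.
Qed.

Lemma enc_hypergraph : enc (n, edge_lists) = tree_of_hypergraph H.
Proof.
rewrite /tree_of_hypergraph /enc /Enc_prod /=; congr Node.
rewrite /enc /Enc_seq /edge_lists -map_comp; congr tree_of_seq.
by apply: eq_map => e /=; rewrite /enc -map_comp.
Qed.

Lemma hg_order_gt0 k Delta : (0 < Delta)%N -> uniform_linear_maxdeg k Delta H ->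
  (0 < n)%N.
Proof.
move=> D0 [_ _ deg]; rewrite lt0n; apply/eqP => n0.
suff : max_hdegree (hg_edges H) = 0%N by move=> E; rewrite -deg E in D0.
apply/eqP; rewrite -leqn0; apply/bigmax_leqP => v _.
have lt : (nat_of_ord v < n)%N := ltn_ord v.
by exfalso; move: (nat_of_ord v) lt => u; rewrite n0.
Qed.

End HypergraphInput.

(** With $y = (1+\delta)/\delta$, the bounds $25y^2 \le k$ and $q^2 \le k$ multiply to $5yq \le k$,
    that is, $k/(1+\delta) \le k - 5q$. *)
Lemma degree_bound (R : realType) (delta : R) (k Delta q : nat) :
  (0 < delta)%R -> (25%:R * (1 + delta) ^+ 2 / delta ^+ 2 <= k%:R)%R ->
  (Delta%:R <= 1 / (100%:R * k%:R ^+ 3) * (2%:R `^ (k%:R / (1 + delta))))%R ->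
  (0 < k)%N -> (q ^ 2 < k)%N ->
  (100 * k ^ 3 * Delta * 2 ^ (5 * q) <= 2 ^ k)%N.
Proof.
move=> d0 k_ge D_le k0 qk.
have k0R : (0 < k%:R :> R)%R by rewrite ltr0n.
pose y : R := ((1 + delta) / delta)%R.
have y0 : (0 < y)%R by rewrite divr_gt0 //; lra.
have yk : (25 * y ^+ 2 <= k%:R)%R by rewrite /y expr_div_n mulrA.
have qkR : (q%:R ^+ 2 <= k%:R :> R)%R by rewrite -natrX ler_nat ltnW.
have q0 : (0 <= q%:R :> R)%R by [].
have yq : (5 * y * q%:R <= k%:R)%R.
  have sq : ((5 * y * q%:R) ^+ 2 <= k%:R ^+ 2)%R.
    rewrite (_ : (_ * _) ^+ 2 = (25 * y ^+ 2) * q%:R ^+ 2)%R; last by ring.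
    have y2 : (0 <= 25 * y ^+ 2)%R by apply: mulr_ge0 => //; apply: sqr_ge0.
    by rewrite [leRHS]expr2; apply: ler_pM => //; apply: sqr_ge0.
  have y5 : (0 <= 5 * y * q%:R)%R by do 2 apply: mulr_ge0 => //; apply: ltW.
  by rewrite -(@ler_pXn2r _ 2) ?nnegrE.
have expo : (k%:R / (1 + delta) <= k%:R - (5 * q)%N%:R)%R.
  have d1 : (0 < 1 + delta)%R by lra.
  rewrite ler_pdivrMr // natrM.
  have : (5 * (1 + delta) * q%:R <= k%:R * delta)%R.
    by move: yq; rewrite /y mulrA mulrAC ler_pdivrMr.
  by rewrite (_ : (5%N)%:R = 5 :> R)%R //; lra.
have pw : (2%:R `^ (k%:R / (1 + delta)) <= 2 ^+ k / 2 ^+ (5 * q) :> R)%R.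
  apply: (@le_trans _ _ (2%:R `^ (k%:R - (5 * q)%N%:R))%R).
    by apply: ler_powR => //; rewrite ler1n.
  by rewrite powRB ?pnatr_eq0 ?implybT // !powR_mulrn.
have c0 : (0 < 100 * k%:R ^+ 3 :> R)%R by rewrite mulr_gt0 // exprn_gt0.
have : (Delta%:R * (100 * k%:R ^+ 3) * 2 ^+ (5 * q) <= 2 ^+ k :> R)%R.
  rewrite -ler_pdivlMr ?exprn_gt0 //; apply: le_trans pw.
  by rewrite -ler_pdivlMr // [leRHS]mulrC -[X in (_ <= X * _)%R]mul1r.
rewrite -(ler_nat R) !natrM !natrX => h; apply: le_trans h.
by rewrite [(Delta%:R * _)%R]mulrC.
Qed.

Local Open Scope ring_scope.

Theorem theorem1p2 (R : realType) (delta : R) (k Delta : nat)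
    (delta_gt0 : 0 < delta)
    (k_ge : 25%:R * (1 + delta) ^+ 2 / delta ^+ 2 <= k%:R)
    (Delta_ge2 : (2 <= Delta)%N)
    (Delta_le : Delta%:R <=
       1 / (100%:R * k%:R ^+ 3) * (2%:R `^ (k%:R / (1 + delta)))) :
  exists P : program,
    is_FPTAS R tree_of_hypergraph (uniform_linear_maxdeg k Delta)
      (fun H : hypergraph_input => num_independent (hg_edges H)) P.
Proof.
have k_gt0 : (0 < k)%N.
  rewrite -(ltr0n R); apply: lt_le_trans k_ge.
  by rewrite divr_gt0 ?mulr_gt0 ?exprn_gt0 //; lra.
have Delta_gt0 : (0 < Delta)%N by apply: ltnW.
have [q qk] := sqrt_bracket k_gt0.
have qk1 : (q ^ 2 < k)%N by case/andP: qk.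
have bc := block_count_bound qk
  (degree_bound delta_gt0 k_ge Delta_le k_gt0 qk1).
pose c1 := (k * (2 * k * block_overhead k Delta q) * (1 + Delta * k))%N.
pose c0 := (query_bound k Delta q 0).+1.
have [_ [T [c [d HT]] impl]] := ptime_count_fraction c1 c0.
(* The code is linked from position 1 on, which leaves function 0 for the entry expression [e]. *)
have [P1 [e He]] := impl 1%N.
exists (e :: P1).
(* The outer variable is the instance size $s$, the inner one $1/\varepsilon$. The program receives
   a tree of size $s+2m+2$ with $m = \lceil 1/\varepsilon \rceil$, at most $s+2/\varepsilon+4$. *)
exists ((c%:R%:P)%:P * ('X + (2%:P * 'X + 4%:P)%:P) ^+ d) => H eps dom e0 e1.
have n_gt0 := hg_order_gt0 Delta_gt0 dom.
have ls := linear_system_edges dom.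
set n := hg_order H in n_gt0 ls.
set m := `|Num.ceil eps^-1|%N.
have einv : 1 < eps^-1 by rewrite invf_gt1.
have ceil_ge0 : (0 <= Num.ceil eps^-1)%R by rewrite ceil_ge0; lra.
have mE : m%:R = (Num.ceil eps^-1)%:~R :> R.
  by rewrite /m -[in RHS](gez0_abs ceil_ge0).
have m_ge : eps^-1 <= m%:R by rewrite mE ceil_ge.
have m_le : m%:R <= eps^-1 + 1.
  by rewrite mE; have := ceilB1_lt eps^-1; rewrite intrB; lra.
pose a : nat * seq (seq nat) * nat := ((n, edge_lists H), m).
have [t le_t ev] := He [:: e] [::] erefl a.
have encE : enc a = Node (tree_of_hypergraph H) (tree_of_nat m).
  by rewrite -enc_hypergraph.
exists (enc (count_fraction c1 c0 a)), t; split.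
- by rewrite /runs /= -encE -[P1]cats0.
- apply: (@le_trans _ _ ((c * esize a ^ d)%N%:R)).
    by rewrite ler_nat; apply: leq_trans le_t _.
  set s := tree_size (tree_of_hypergraph H).
  have -> : esize a = (s + m.*2.+1).+1.
    by rewrite esize_pair esize_nat /esize enc_hypergraph.
  rewrite hornerM hornerC horner_exp hornerD hornerX hornerC.
  rewrite hornerM hornerC horner_exp hornerD hornerC hornerD hornerM hornerX
    !hornerC.
  rewrite natrM natrX; apply: ler_wpM2l => //.
  have -> : (s + m.*2.+1).+1 = (s + m + m + 2)%N by lia.
  have s_ge0 : 0 <= s%:R :> R by [].
  by apply: lerXn2r; rewrite ?nnegrE // ?natrD; lra.
pose K := depth c1 c0 n m.
pose f i := vacant_count n (avoiding i (edge_lists H)) i (n * K.+2) K.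
have -> : value_of_tree R (enc (count_fraction c1 c0 a)) =
    2 ^+ (K * n) / (\prod_(0 <= i < n) f i)%N%:R.
  rewrite /value_of_tree; congr (_ / _%:R); rewrite nat_of_tree_bits.
    rewrite bits_value_cat bits_value_false size_map size_iota /=.
    by rewrite add0n muln0 addn0 muln1 natrX.
  by rewrite bits_value_bprod big_map /index_iota subn0.
have Kl : (query_bound k Delta q (lg (16 * (n * m))) < K)%N by apply: depth_gt.
have lsi i : linear_system n k Delta (avoiding i (edge_lists H)).
  exact: linear_system_filter.
rewrite num_independent_indeps -[edge_lists H]avoiding0.
apply: (@product_approximation R n K (lg (16 * (n * m)))
  (fun i => indeps n (avoiding i (edge_lists H)))
  (fun i => vacants n (avoiding i (edge_lists H)) i)) => //.
- by move=> i lt; apply: indeps_avoidingS.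
- exact: indeps_avoiding_order ls k_gt0.
- move=> i lt; rewrite indeps_le_vacants // andbT; apply: subset_leq_card.
  by apply/fintype.subsetP => S; rewrite !inE => /andP[].
- by move=> i lt; apply: (vacant_count_le K (lsi i) lt).
- by move=> i lt; apply: vacant_count_ge (lsi i) lt k_gt0 Delta_gt0 bc Kl.
(* $2^l > 16nm$ and $m \ge 1/\varepsilon$ give the accuracy required of each factor. *)
have := lg_gt (16 * (n * m)); rewrite -(ltr_nat R) natrX !natrM => /ltW lel.
rewrite -ler_pdivrMl //; apply: le_trans lel.
rewrite mulrCA ler_wpM2l // mulrC ler_wpM2l //.
Qed.
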